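(* There is a positive constant $C$ (with $\beta$ and the spaces $E_m$ fixed as in the context) such that for all $m, m'$ in $B$, all $u$ in $E_m$ and all $v$ in $E_{m'}$, $$\| \mathcal{A}_m u - \mathcal{A}_{m'} v \| \;\geq\; C\, \|\mathcal{A}_{m'} v\|\, |m - m'|,$$ where the norms are those of $L^2(V)$.
   Context: Setting. $R$ and $V$ are two compact manifolds (possibly with boundary) embedded in $\mathbb{R}^d$, with surface measures $\sigma$ and $\sigma'$ respectively. $B$ is a compact subset of $\mathbb{R}^p$. For each $m\in B$, $\mathbf{H}_m : V\times R\to\mathbb{R}$ is an integration kernel, and $\mathcal{A}_m$ is the operator $$\mathcal{A}_m g(x)=\int_R \mathbf{H}_m(x,y)\,g(y)\,d\sigma(y),\qquad x\in V .$$ Norms. On $H^1_0(R)$ use $\|\phi\|=\big(\int_R|\nabla\phi|^2\,d\sigma\big)^{1/2}$, which by Poincaré's inequality is a norm equivalent to the usual one, with associated inner product $\langle\phi,\psi\rangle=\int_R\nabla\phi\cdot\nabla\psi\,d\sigma$. On $L^2(V)$ use $\|\psi\|=\big(\int_V|\psi|^2\,d\sigma'\big)^{1/2}$. $|\cdot|$ is the Euclidean norm on $\mathbb{R}^p$. Standing assumptions. (Regularity 1) $(m,x,y)\mapsto \mathbf{H}_m(x,y)$ is continuous on $B\times V\times R$, and the gradient in $x$, $(m,x,y)\mapsto\nabla_x\mathbf{H}_m(x,y)$, exists and is continuous on $B\times V\times R$. (Regularity 2) There is an open set $B'\subset\mathbb{R}^p$ with $B\subset B'$ (the kernels $\mathbf{H}_m$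 being defined for $m\in B'$) such that the derivatives $\partial_{m_i}\mathbf{H}_m(x,y)$ and $\partial_{m_i}\nabla_x\mathbf{H}_m(x,y)$, $1\le i\le p$, exist and are continuous on $B'\times V\times R$. For a unit vector $\mathbf{q}\in\mathbb{R}^p$ and $m\in B'$, $\partial_{\mathbf{q}}\mathcal{A}_m=\nabla_m\mathcal{A}_m\cdot\mathbf{q}$ denotes the directional derivative, i.e. the integral operator with kernel $\nabla_m\mathbf{H}_m(x,y)\cdot\mathbf{q}$. (Uniqueness 1) For all $m,m'\in B$ and $u,v\in H^1_0(R)$: if $\mathcal{A}_m u=\mathcal{A}_{m'}v$ in $L^2(V)$ and ($u\ne0$ or $v\neq0$), then $m=m'$ and $u=v$. In particular $\mathcal{A}_m$ is injective for all $m\in B$. (Uniqueness 2) For all unit vectors $\mathbf{q}\in\mathbb{R}^p$, all $m\in B$ and all $u,v\in H^1_0(R)$: $\partial_{\mathbf{q}}\mathcal{A}_m u=\mathcal{A}_m v$ implies $u=v=0$. The spaces $E_m$. $\mathcal{A}_m$ is regarded as a compact linear operator $H^1_0(R)\to L^2(V)$, and $\mathcal{A}_m^*:L^2(V)\to H^1_0(R)$ is its adjoint with respect to the inner products above, so that $\mathcal{A}_m^*\mathcal{A}_m$ is compact and symmetric on $H^1_0(R)$. Fix $\beta>0$ such that $\|\mathcal{A}_m^*\mathcal{A}_m\|>\beta^2$ for all $m\in B$. $E_m\subset H^1_0(R)$ is the (finite dimensional) span of the eigenvectors of $\mathcal{A}_m^*\mathcal{A}_m$ corresponding to eigenvalues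 strictly greater than $\beta^2$. *)

(* Defs.v *)
From HB Require Import structures.
From mathcomp Require Import all_boot all_order all_algebra.
From mathcomp Require Import all_classical all_reals all_analysis.

Set Implicit Arguments.
Unset Strict Implicit.
Unset Printing Implicit Defensive.

Import Order.TTheory GRing.Theory Num.Theory.
Import numFieldNormedType.Exports.

Local Open Scope classical_set_scope.
Local Open Scope ring_scope.

(* The library norm on ['rV[R]_n] is the sup norm (it only serves for the
   topology here), hence [enorm]. *)
Definition dotp (R : realType) (n : nat) (a b : 'rV[R]_n) : R :=
  \sum_(i < n) a 0 i * b 0 i.

Definition enorm (R : realType) (n : nat) (a : 'rV[R]_n) : R :=
  Num.sqrt (dotp a a).

Definition borel (R : realType) (n : nat) :=
  g_sigma_algebraType (@open 'rV[R]_n).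

(* The values on boxes determine a Borel measure of R^n. *)
Definition is_lebesgue (R : realType) (n : nat)
    (lam : {measure set (borel R n) -> \bar R}) : Prop :=
  forall a b : 'rV[R]_n, (forall i, a 0 i <= b 0 i) ->
    lam [set t | forall i, a 0 i <= t 0 i <= b 0 i] =
    (\prod_(i < n) (b 0 i - a 0 i))%:E.

(* For n = 0 this is the whole (one-point) space. *)
Definition halfspace (R : realType) (n : nat) : set 'rV[R]_n :=
  [set t | forall i : 'I_n, val i = 0%N -> 0 <= t 0 i].

(* [psi], restricted to W /\ halfspace, is a C^1 parametrization of a
   relatively open piece of M; derivatives are taken on the full open set W.
   Class C^1 is all that tangent spaces, surface measure and gradients need, so
   no more smoothness is asked of M.  With the row-vector convention,
   ['d psi t h = h *m 'J psi t], so [row_free] says that the differential is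
   injective. *)
Definition param (R : realType) (n d : nat) (M : set 'rV[R]_d)
    (W : set 'rV[R]_n) (psi : 'rV[R]_n -> 'rV[R]_d) : Prop :=
  [/\ open W,
      forall t, W t -> differentiable psi t /\ row_free ('J psi t),
      {within W, continuous (fun t => 'J psi t)} &
      exists (U : set 'rV[R]_d) (g : 'rV[R]_d -> 'rV[R]_n),
        [/\ open U,
            psi @` (W `&` @halfspace R n) = M `&` U,
            forall t, W t -> halfspace t -> g (psi t) = t &
            {within M `&` U, continuous g}]].

Definition compact_manifold (R : realType) (n d : nat) (M : set 'rV[R]_d) :
    Prop :=
  compact M /\
  forall x, M x -> exists (W : set 'rV[R]_n) (psi : 'rV[R]_n -> 'rV[R]_d),
    param M W psi /\ (psi @` (W `&` @halfspace R n)) x.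

Definition minterior (R : realType) (n d : nat) (M : set 'rV[R]_d) :
    set 'rV[R]_d :=
  [set x | exists (W : set 'rV[R]_n) (psi : 'rV[R]_n -> 'rV[R]_d) t,
    [/\ param M W psi, W t, psi t = x &
        forall i : 'I_n, val i = 0%N -> 0 < t 0 i]].

Definition tangent (R : realType) (n d : nat) (M : set 'rV[R]_d)
    (x : 'rV[R]_d) : set 'rV[R]_d :=
  [set w | exists (W : set 'rV[R]_n) (psi : 'rV[R]_n -> 'rV[R]_d) t,
    [/\ param M W psi, W t, halfspace t, psi t = x &
        (w <= 'J psi t)%MS]].

(* The values of [sigma] on the Borel subsets of M are determined by the area
   formula in every local parametrization; [sigma] is only ever integrated
   over M. *)
Definition surface_measure (R : realType) (n d : nat) (M : set 'rV[R]_d)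
    (sigma : {measure set (borel R d) -> \bar R}) : Prop :=
  exists2 lam : {measure set (borel R n) -> \bar R}, is_lebesgue lam &
  forall (W : set 'rV[R]_n) (psi : 'rV[R]_n -> 'rV[R]_d), param M W psi ->
  forall A : set (borel R d), measurable A ->
    A `<=` psi @` (W `&` @halfspace R n) ->
    sigma A = (\int[lam]_(t in W `&` @halfspace R n `&` psi @^-1` A)
      (Num.sqrt (\det ('J psi t *m ('J psi t)^T)))%:E)%E.

(* G is the gradient along M, at x, of a function of which only the values on
   M matter. *)
Definition is_tgrad (R : realType) (n d : nat) (M : set 'rV[R]_d)
    (f : 'rV[R]_d -> R) (x G : 'rV[R]_d) : Prop :=
  tangent n M x G /\
  forall e : R, 0 < e -> \forall z \near within M (nbhs x),
    `|f z - f x - dotp G (z - x)| <= e * enorm (z - x).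

Definition tdifferentiable (R : realType) (n d : nat) (M : set 'rV[R]_d)
    (f : 'rV[R]_d -> R) (x : 'rV[R]_d) : Prop :=
  exists G, is_tgrad n M f x G.

Definition tgrad (R : realType) (n d : nat) (M : set 'rV[R]_d)
    (f : 'rV[R]_d -> R) (x : 'rV[R]_d) : 'rV[R]_d :=
  xget 0 (is_tgrad n M f x).

(* Functions are representatives of their classes: equality in L^2 and in
   H^1_0 is [eqL2], [eqH10]. *)
Definition inL2 (R : realType) (d : nat) (M : set 'rV[R]_d)
    (sigma : {measure set (borel R d) -> \bar R}) (f : 'rV[R]_d -> R) : Prop :=
  measurable_fun (M : set (borel R d)) (f : borel R d -> R) /\
  sigma.-integrable M (fun x => ((f x) ^+ 2)%:E).

Definition eqL2 (R : realType) (d : nat) (M : set 'rV[R]_d)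
    (sigma : {measure set (borel R d) -> \bar R}) (f g : 'rV[R]_d -> R) :
    Prop :=
  {ae sigma, forall x, M x -> f x = g x}.

Definition dotL2 (R : realType) (d : nat) (M : set 'rV[R]_d)
    (sigma : {measure set (borel R d) -> \bar R}) (f g : 'rV[R]_d -> R) : R :=
  \int[sigma]_(x in M) (f x * g x).

Definition normL2 (R : realType) (d : nat) (M : set 'rV[R]_d)
    (sigma : {measure set (borel R d) -> \bar R}) (f : 'rV[R]_d -> R) : R :=
  Num.sqrt (dotL2 M sigma f f).

(* C^1 functions on M with compact support in the interior of M. *)
Definition testfun (R : realType) (n d : nat) (M : set 'rV[R]_d)
    (phi : 'rV[R]_d -> R) : Prop :=
  [/\ forall x, M x -> tdifferentiable n M phi x,
      {within M, continuous (tgrad n M phi)} &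
      exists K : set 'rV[R]_d, [/\ compact K, K `<=` minterior n M &
        forall x, M x -> ~ K x -> phi x = 0]].

Definition fungrad (R : realType) (d : nat) : Type :=
  (('rV[R]_d -> R) * ('rV[R]_d -> 'rV[R]_d))%type.

(* H^1_0 is the closure of the test functions in the H^1 norm.  An element is a
   function u.1 with its weak gradient u.2 along M: the L^2 limit of the
   gradients of the test functions converging to u.1.  It is determined almost
   everywhere by u.1 and is carried along as data. *)
Definition H10 (R : realType) (n d : nat) (M : set 'rV[R]_d)
    (sigma : {measure set (borel R d) -> \bar R}) : set (fungrad R d) :=
  [set u : fungrad R d | [/\ inL2 M sigma u.1,
      forall j, inL2 M sigma (fun x => u.2 x 0 j) &
      exists2 phi : nat -> 'rV[R]_d -> R, forall k, testfun n M (phi k) &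
        ((fun k => \int[sigma]_(x in M) ((u.1 x - phi k x) ^+ 2)%:E)%E
           @ \oo --> 0%E) /\
        ((fun k => \int[sigma]_(x in M)
             ((enorm (u.2 x - tgrad n M (phi k) x)) ^+ 2)%:E)%E
           @ \oo --> 0%E)]].

Definition eqH10 (R : realType) (d : nat) (M : set 'rV[R]_d)
    (sigma : {measure set (borel R d) -> \bar R}) (u v : fungrad R d) : Prop :=
  {ae sigma, forall x, M x -> u.1 x = v.1 x /\ u.2 x = v.2 x}.

Definition dotH10 (R : realType) (d : nat) (M : set 'rV[R]_d)
    (sigma : {measure set (borel R d) -> \bar R}) (u v : fungrad R d) : R :=
  \int[sigma]_(x in M) dotp (u.2 x) (v.2 x).

Definition normH10 (R : realType) (d : nat) (M : set 'rV[R]_d)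
    (sigma : {measure set (borel R d) -> \bar R}) (u : fungrad R d) : R :=
  Num.sqrt (dotH10 M sigma u u).

Definition normH1 (R : realType) (d : nat) (M : set 'rV[R]_d)
    (sigma : {measure set (borel R d) -> \bar R}) (u : fungrad R d) : R :=
  Num.sqrt (normL2 M sigma u.1 ^+ 2 + normH10 M sigma u ^+ 2).

(* The Poincare inequality, as the equivalence of [normH10] and [normH1] on H^1_0; the other inequality is
   immediate.  It fails when M has a component without boundary. *)
Definition poincare (R : realType) (n d : nat) (M : set 'rV[R]_d)
    (sigma : {measure set (borel R d) -> \bar R}) : Prop :=
  exists c : R, forall u, H10 n M sigma u ->
    normH1 M sigma u <= c * normH10 M sigma u.

Definition intop (R : realType) (d : nat) (M : set 'rV[R]_d)
    (sigma : {measure set (borel R d) -> \bar R})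
    (K : 'rV[R]_d -> 'rV[R]_d -> R) (u : fungrad R d) : 'rV[R]_d -> R :=
  fun x => \int[sigma]_(y in M) (K x y * u.1 y).

Definition is_adjoint (R : realType) (n d : nat) (M V : set 'rV[R]_d)
    (sigma sigma' : {measure set (borel R d) -> \bar R})
    (T : fungrad R d -> 'rV[R]_d -> R) (S : ('rV[R]_d -> R) -> fungrad R d) :
    Prop :=
  forall g, inL2 V sigma' g -> H10 n M sigma (S g) /\
    forall u, H10 n M sigma u -> dotL2 V sigma' (T u) g = dotH10 M sigma u (S g).

(* Unique up to [eqH10]; it exists as soon as T is bounded for [normH10]. *)
Definition adjoint (R : realType) (n d : nat) (M V : set 'rV[R]_d)
    (sigma sigma' : {measure set (borel R d) -> \bar R})
    (T : fungrad R d -> 'rV[R]_d -> R) : ('rV[R]_d -> R) -> fungrad R d :=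
  xget (fun _ => (cst 0, cst 0)) (is_adjoint n M V sigma sigma' T).

Definition normal_op (R : realType) (n d : nat) (M V : set 'rV[R]_d)
    (sigma sigma' : {measure set (borel R d) -> \bar R})
    (T : fungrad R d -> 'rV[R]_d -> R) (u : fungrad R d) : fungrad R d :=
  adjoint n M V sigma sigma' T (T u).

Definition opnormH10 (R : realType) (n d : nat) (M : set 'rV[R]_d)
    (sigma : {measure set (borel R d) -> \bar R})
    (T : fungrad R d -> fungrad R d) : \bar R :=
  ereal_sup [set (normH10 M sigma (T u))%:E |
    u in [set u : fungrad R d | H10 n M sigma u /\ normH10 M sigma u <= 1]].

Definition eigenvector (R : realType) (n d : nat) (M : set 'rV[R]_d)
    (sigma : {measure set (borel R d) -> \bar R})
    (T : fungrad R d -> fungrad R d) (lam : R) (e : fungrad R d) : Prop :=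
  [/\ H10 n M sigma e, ~ eqH10 M sigma e 0 & eqH10 M sigma (T e) (lam *: e)].

Definition eigenspan (R : realType) (n d : nat) (M : set 'rV[R]_d)
    (sigma : {measure set (borel R d) -> \bar R})
    (T : fungrad R d -> fungrad R d) (mu : R) : set (fungrad R d) :=
  [set u : fungrad R d | H10 n M sigma u /\
    exists (k : nat) (c : 'I_k -> R) (e : 'I_k -> fungrad R d),
      (forall i, exists2 lam, mu < lam & eigenvector n M sigma T lam (e i)) /\
      eqH10 M sigma u (\sum_(i < k) c i *: e i)].

Definition dm (R : realType) (p : nat) (E : normedModType R) (i : 'I_p)
    (f : 'rV[R]_p -> E) (m : 'rV[R]_p) : E := 'D_(delta_mx 0 i) f m.

Definition dirker (R : realType) (p d : nat)
    (H : 'rV[R]_p -> 'rV[R]_d -> 'rV[R]_d -> R) (q m : 'rV[R]_p) :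
    'rV[R]_d -> 'rV[R]_d -> R :=
  fun x y => \sum_(i < p) dm i (fun m' => H m' x y) m * q 0 i.

Definition regularity1 (R : realType) (p d nV : nat) (B : set 'rV[R]_p)
    (V M : set 'rV[R]_d) (H : 'rV[R]_p -> 'rV[R]_d -> 'rV[R]_d -> R) : Prop :=
  [/\ {within B `*` V `*` M, continuous
        (fun z : 'rV[R]_p * 'rV[R]_d * 'rV[R]_d => H z.1.1 z.1.2 z.2)},
      forall m x y, B m -> V x -> M y ->
        tdifferentiable nV V (fun x' => H m x' y) x &
      {within B `*` V `*` M, continuous
        (fun z : 'rV[R]_p * 'rV[R]_d * 'rV[R]_d =>
           tgrad nV V (fun x' => H z.1.1 x' z.2) z.1.2)}].

Definition regularity2 (R : realType) (p d nV : nat) (B' : set 'rV[R]_p)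
    (V M : set 'rV[R]_d) (H : 'rV[R]_p -> 'rV[R]_d -> 'rV[R]_d -> R) : Prop :=
  (forall m x y, B' m -> V x -> M y ->
     tdifferentiable nV V (fun x' => H m x' y) x) /\
  forall i : 'I_p,
  [/\ forall m x y, B' m -> V x -> M y ->
        derivable (fun m' => H m' x y) m (delta_mx 0 i),
      {within B' `*` V `*` M, continuous
        (fun z : 'rV[R]_p * 'rV[R]_d * 'rV[R]_d =>
           dm i (fun m' => H m' z.1.2 z.2) z.1.1)},
      forall m x y, B' m -> V x -> M y ->
        derivable (fun m' => tgrad nV V (fun x' => H m' x' y) x) m
          (delta_mx 0 i) &
      {within B' `*` V `*` M, continuous
        (fun z : 'rV[R]_p * 'rV[R]_d * 'rV[R]_d =>
           dm i (fun m' => tgrad nV V (fun x' => H m' x' z.2) z.1.2) z.1.1)}].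

Definition uniqueness1 (R : realType) (p d nM : nat) (B : set 'rV[R]_p)
    (V M : set 'rV[R]_d) (sigma sigma' : {measure set (borel R d) -> \bar R})
    (H : 'rV[R]_p -> 'rV[R]_d -> 'rV[R]_d -> R) : Prop :=
  forall m m' u v, B m -> B m' -> H10 nM M sigma u -> H10 nM M sigma v ->
    eqL2 V sigma' (intop M sigma (H m) u) (intop M sigma (H m') v) ->
    ~ eqH10 M sigma u 0 \/ ~ eqH10 M sigma v 0 ->
    m = m' /\ eqH10 M sigma u v.

Definition uniqueness2 (R : realType) (p d nM : nat) (B : set 'rV[R]_p)
    (V M : set 'rV[R]_d) (sigma sigma' : {measure set (borel R d) -> \bar R})
    (H : 'rV[R]_p -> 'rV[R]_d -> 'rV[R]_d -> R) : Prop :=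
  forall q m u v, enorm q = 1 -> B m -> H10 nM M sigma u -> H10 nM M sigma v ->
    eqL2 V sigma' (intop M sigma (dirker H q m) u) (intop M sigma (H m) v) ->
    eqH10 M sigma u 0 /\ eqH10 M sigma v 0.

(* Main.v *)
Require Import Defs.
From HB Require Import structures.
From mathcomp Require Import all_boot all_order all_algebra.
From mathcomp Require Import all_classical all_reals all_analysis.
From mathcomp Require Import perm measurable_realfun ring lra.
Set Implicit Arguments.
Unset Strict Implicit.
Unset Printing Implicit Defensive.
Import Order.TTheory GRing.Theory Num.Theory.
Import numFieldNormedType.Exports.
Local Open Scope classical_set_scope.
Local Open Scope ring_scope.

(** If the estimate failed, there would be parameters [m_j], [m'_j] and
    combinations of eigenvectors [u_j], [v_j], normalized by
    [|A_(m'_j) v_j| = 1], with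
      [|A_(m_j) u_j - A_(m'_j) v_j| <= |m_j - m'_j| / (j + 1)].
    On the spans of eigenvectors [|A_m u| >= beta |u|] ([spectral_lower]), so
    [u_j] and [v_j] are bounded and have weak limits [u], [v] in H^1_0
    ([ultra_weak_cvg]); the parameters have limits [m], [m'] in B.  The
    operators are compact and depend continuously on the parameter, so the
    images converge strongly ([opA_cvg]): [A_m u = A_m' v], of norm 1.  The
    first uniqueness assumption gives [m = m'] and [u = v], not null.

    Put [h_j = |m_j - m'_j|].  Dividing by [h_j],
      [A_(m'_j) ((u_j - v_j) / h_j) + ((A_(m_j) - A_(m'_j)) / h_j) u_j]
    tends to 0, and its second term tends to the derivative of [A] at [m] in a
    limit direction [q], applied to [u] ([quotient_unif]).  If
    [(u_j - v_j) / h_j] is bounded, it has a weak limit [w], and in the limit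
    the derivative of [A] in the direction [q] maps [u] to [A_m (- w)]: the
    second uniqueness assumption makes [u] null, a contradiction
    ([sequences_absurd]).

    The bound on the quotients is the delicate point, because the eigenvalues
    are not isolated from the threshold uniformly in [m] and the spans of
    eigenvectors may jump.  What is uniform is the number of eigenvalues above
    the threshold: by Bessel's inequality the operators have uniformly bounded
    Hilbert-Schmidt norms ([opA_hs], [spectral_size]).  Given combinations [u],
    [v] of boundedly many eigenvectors of [A^* A] and [A'^* A'], apply
    [1 - A^* A / l] to [u] and [1 - A'^* A' / l] to [v], where [l] is one of the
    eigenvalues: this deletes a component and changes [u - v] by at most a
    multiple of [|A'(u - v)| + |A - A'| |u|].  By induction [|u - v|] itself is
    controlled by that quantity ([spectral_close]), and the kernels are
    Lipschitz in the parameter.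

    The Hilbert space structure has to be established first.  L^2 is complete
    ([L2_complete]).  By the area formula a compact manifold has finite surface
    measure ([surface_finite]), so bounded kernels act on L^2.  Tangential
    gradients are unique, also at the boundary, because a vector orthogonal to
    the manifold to first order is orthogonal to all tangent vectors
    ([flat_orth]), and they are linear because all parametrizations have the
    same range of differentials at a point ([tangent_param]).  Hence test
    functions form a vector space, and H^1_0, their closure, is complete for
    the gradient norm by Poincare's inequality ([H10_complete]). *)

(** * Semi-inner products *)

(** The spaces of functions used below consist of representatives: [D] is a
    subspace of a space of functions, and the form vanishes on those that are
    null almost everywhere. *)
Record semi_inner (K : realType) (X : lmodType K) (D : set X)
    (f : X -> X -> K) : Prop := SemiInner {
  si0 : D 0;
  siZD : forall a u v, D u -> D v -> D (a *: u + v);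
  siC : forall u v, D u -> D v -> f u v = f v u;
  siZDl : forall a u v w, D u -> D v -> D w ->
    f (a *: u + v) w = a * f u w + f v w;
  si_ge0 : forall u, D u -> 0 <= f u u }.

Definition nrm (K : realType) (X : lmodType K) (f : X -> X -> K) (u : X) : K :=
  Num.sqrt (f u u).

Section SemiInner.
Context (K : realType) (X : lmodType K) (D : set X) (f : X -> X -> K).
Hypothesis S : semi_inner D f.
Implicit Types (u v w : X) (a : K).

Lemma siD u v : D u -> D v -> D (u + v).
Proof. by move=> Du Dv; rewrite -(scale1r u); exact: (siZD S). Qed.

Lemma siZ a u : D u -> D (a *: u).
Proof. by move=> Du; rewrite -[_ *: _]addr0; apply: (siZD S) => //; exact: si0 S. Qed.

Lemma siN u : D u -> D (- u).
Proof. by move=> Du; rewrite -scaleN1r; exact: siZ. Qed.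

Lemma siB u v : D u -> D v -> D (u - v).
Proof. by move=> Du Dv; apply: siD => //; exact: siN. Qed.

Lemma si_sum (I : eqType) (s : seq I) (P : pred I) (F : I -> X) :
  (forall i, i \in s -> P i -> D (F i)) -> D (\sum_(i <- s | P i) F i).
Proof.
move=> h; rewrite big_seq_cond; apply: big_ind => [|u v|i /andP[]]; last exact: h.
- exact: si0 S.
- exact: siD.
Qed.

Lemma siDl u v w : D u -> D v -> D w -> f (u + v) w = f u w + f v w.
Proof. by move=> Du Dv Dw; rewrite -{1}(scale1r u) (siZDl S)// mul1r. Qed.

Lemma si0l w : D w -> f 0 w = 0.
Proof.
move=> Dw; have D0 := si0 S; have := siDl D0 D0 Dw.
by rewrite addr0 => /eqP; rewrite -subr_eq subrr eq_sym => /eqP.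
Qed.

Lemma siZl a u w : D u -> D w -> f (a *: u) w = a * f u w.
Proof.
move=> Du Dw; have D0 := si0 S.
by rewrite -[_ *: _]addr0 (siZDl S)// si0l// addr0.
Qed.

Lemma siNl u w : D u -> D w -> f (- u) w = - f u w.
Proof. by move=> Du Dw; rewrite -scaleN1r siZl// mulN1r. Qed.

Lemma siBl u v w : D u -> D v -> D w -> f (u - v) w = f u w - f v w.
Proof. by move=> Du Dv Dw; rewrite siDl ?siNl//; exact: siN. Qed.

Lemma si_suml (I : eqType) (s : seq I) (F : I -> X) w :
  (forall i, i \in s -> D (F i)) -> D w ->
  f (\sum_(i <- s) F i) w = \sum_(i <- s) f (F i) w.
Proof.
move=> + Dw; elim: s => [|x s IH] h; first by rewrite !big_nil si0l.
have Ds : forall i, i \in s -> D (F i) by move=> i si; apply: h; rewrite inE si orbT.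
rewrite !big_cons siDl// ?IH//; first by apply: h; rewrite inE eqxx.
by apply: si_sum => i si _; exact: Ds.
Qed.

Lemma siDr u v w : D u -> D v -> D w -> f w (u + v) = f w u + f w v.
Proof.
move=> Du Dv Dw; rewrite (siC S)//; last exact: siD.
by rewrite siDl// (siC S Dw Du) (siC S Dw Dv).
Qed.

Lemma siZr a u w : D u -> D w -> f w (a *: u) = a * f w u.
Proof.
move=> Du Dw; rewrite (siC S)//; last exact: siZ.
by rewrite siZl// (siC S Dw Du).
Qed.

Lemma siBr u v w : D u -> D v -> D w -> f w (u - v) = f w u - f w v.
Proof.
move=> Du Dv Dw; rewrite (siC S)//; last exact: siB.
by rewrite siBl// (siC S Dw Du) (siC S Dw Dv).
Qed.

Lemma si_sumr (I : eqType) (s : seq I) (F : I -> X) w :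
  (forall i, i \in s -> D (F i)) -> D w ->
  f w (\sum_(i <- s) F i) = \sum_(i <- s) f w (F i).
Proof.
move=> h Dw; rewrite (siC S)//; last by apply: si_sum => i /h.
by rewrite si_suml//; apply: eq_big_seq => i /h Di; exact: (siC S).
Qed.

Lemma nrm_ge0 u : 0 <= nrm f u. Proof. exact: sqrtr_ge0. Qed.

Lemma sqr_nrm u : D u -> nrm f u ^+ 2 = f u u.
Proof. by move=> Du; rewrite sqr_sqrtr// (si_ge0 S). Qed.

Lemma nrm_leP u c : D u -> 0 <= c -> (nrm f u <= c) = (f u u <= c ^+ 2).
Proof. by move=> Du c0; rewrite -sqr_nrm// ler_sqr// ?nnegrE ?nrm_ge0. Qed.

Lemma nrm0 : nrm f 0 = 0.
Proof. by rewrite /nrm si0l ?sqrtr0//; exact: si0 S. Qed.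

Lemma nrmZ a u : D u -> nrm f (a *: u) = `|a| * nrm f u.
Proof.
move=> Du; rewrite /nrm siZl ?siZr//; last exact: siZ.
by rewrite mulrA -expr2 sqrtrM ?sqr_ge0// sqrtr_sqr.
Qed.

Lemma nrmN u : D u -> nrm f (- u) = nrm f u.
Proof. by move=> Du; rewrite -scaleN1r nrmZ// normrN1 mul1r. Qed.

Lemma nrm_sym u v : D u -> D v -> nrm f (u - v) = nrm f (v - u).
Proof. by move=> Du Dv; rewrite -nrmN ?opprB//; exact: siB. Qed.

Lemma si_lin_sqr u v t : D u -> D v ->
  f (t *: u + v) (t *: u + v) = t ^+ 2 * f u u + 2 * t * f u v + f v v.
Proof.
move=> Du Dv; have Dt := siZ t Du.
rewrite siDl ?siDr ?siZl ?siZr//; last exact: siD.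
by rewrite (siC S Dv Du); ring.
Qed.

(** The discriminant inequality behind Cauchy-Schwarz; also covers [a = 0],
    which occurs because the forms are degenerate. *)
Lemma quad_ge0 (a b c : K) :
  (forall t, 0 <= t ^+ 2 * a + 2 * t * b + c) -> b ^+ 2 <= a * c.
Proof.
move=> h; have c0 : 0 <= c by have := h 0; lra.
case: (ltgtP a 0) => [a0|a0|a0].
- have t1 : 0 <= c / - a by rewrite divr_ge0//; lra.
  have ta : (1 + c / - a) * a = a - c by field; lra.
  have := h (1 + c / - a); have := h (- (1 + c / - a)).
  move: ta t1; set t := c / - a => ta t1; nra.
- have := h (- b / a).
  have -> : (- b / a) ^+ 2 * a + 2 * (- b / a) * b + c = (a * c - b ^+ 2) / a.
    by field; lra.
  by rewrite pmulr_lge0 ?invr_gt0// subr_ge0.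
- rewrite a0 mul0r; suff -> : b = 0 by rewrite expr0n.
  apply/eqP; apply/negPn/negP => b0.
  have := h (- (c + 1) / (2 * b)); rewrite a0.
  have -> : (- (c + 1) / (2 * b)) ^+ 2 * 0 + 2 * (- (c + 1) / (2 * b)) * b + c = -1.
    by field.
  by rewrite ler0N1.
Qed.

Lemma si_CS u v : D u -> D v -> `|f u v| <= nrm f u * nrm f v.
Proof.
move=> Du Dv; rewrite /nrm -sqrtrM ?(si_ge0 S)// -sqrtr_sqr ler_wsqrtr//.
apply: quad_ge0 => t; rewrite -si_lin_sqr//; apply: (si_ge0 S).
exact: (siZD S).
Qed.

Lemma si_CSle u v : D u -> D v -> f u v <= nrm f u * nrm f v.
Proof. by move=> Du Dv; apply: le_trans (ler_norm _) _; exact: si_CS. Qed.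

Lemma nrmD u v : D u -> D v -> nrm f (u + v) <= nrm f u + nrm f v.
Proof.
move=> Du Dv; rewrite nrm_leP ?addr_ge0 ?nrm_ge0//; last exact: siD.
have := si_lin_sqr 1 Du Dv; rewrite scale1r => ->.
rewrite sqrrD !sqr_nrm//; have := si_CSle Du Dv.
by rewrite -mulr_natl; lra.
Qed.

Lemma nrmB u v : D u -> D v -> nrm f (u - v) <= nrm f u + nrm f v.
Proof. by move=> Du Dv; rewrite -(nrmN Dv); apply: nrmD => //; exact: siN. Qed.

Lemma nrm_le_sub u v : D u -> D v -> nrm f u <= nrm f (u - v) + nrm f v.
Proof.
by move=> Du Dv; rewrite -{1}(subrK v u); apply: nrmD => //; exact: siB.
Qed.

End SemiInner.

(** * Riesz representation and weak limits *)

(** Completeness tested on sequences with a fixed geometric rate: those are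
    the ones that occur below, and in L^2 they converge almost everywhere
    without extraction. *)
Definition si_complete (K : realType) (X : lmodType K) (D : set X)
    (f : X -> X -> K) : Prop :=
  forall u : nat -> X, (forall k, D (u k)) ->
  (forall k, f (u k.+1 - u k) (u k.+1 - u k) <= 8^-1 ^+ k) ->
  exists2 l, D l & (fun k => nrm f (u k - l)) @ \oo --> (0 : K).

Section Riesz.
Context (K : realType) (X : lmodType K) (D : set X) (f : X -> X -> K).
Hypotheses (S : semi_inner D f) (Dc : si_complete D f).
Implicit Types (u v w : X) (a : K).

Definition bounded_functional (L : X -> K) :=
  (forall a u v, D u -> D v -> L (a *: u + v) = a * L u + L v) /\
  exists c : K, forall u, D u -> `|L u| <= c * nrm f u.

Lemma bounded_functionalP L : bounded_functional L ->
  exists2 c : K, 0 <= c & forall u, D u -> `|L u| <= c * nrm f u.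
Proof.
move=> [_ [c hc]]; exists `|c| => // u Du; apply: le_trans (hc _ Du) _.
by rewrite ler_wpM2r ?nrm_ge0// ler_norm.
Qed.

(** The representing vector minimizes [f w w - 2 L w], which works as it
    stands for a degenerate form. *)
Lemma riesz L : bounded_functional L ->
  exists2 z, D z & forall w, D w -> L w = f z w.
Proof.
move=> BL; have [c c0 hc] := bounded_functionalP BL; case: BL => LL _.
have L0 : L 0 = 0.
  by have := LL 1 0 0 (si0 S) (si0 S); rewrite scaler0 addr0 mul1r; lra.
have LZ a u : D u -> L (a *: u) = a * L u.
  by move=> Du; rewrite -[_ *: _]addr0 LL ?L0 ?addr0//; exact: si0 S.
pose J w := f w w - 2 * L w.
pose E := J @` D.
have hE : has_inf E.
  split; first by exists (J 0), 0 => //; exact: si0 S.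
  exists (- c ^+ 2) => _ [w Dw <-]; rewrite /J -(sqr_nrm S Dw).
  have := le_trans (ler_norm _) (hc w Dw).
  by have := sqr_ge0 (nrm f w - c); rewrite sqrrB -mulr_natl; nra.
pose e (k : nat) : K := 8^-1 ^+ k / 4.
have e0 k : 0 < e k by rewrite divr_gt0// exprn_gt0.
have /choice[u hu] k : exists w, D w /\ J w < inf E + e k.
  by have [_ [w Dw <-] hw] := inf_adherent (e0 k) hE; exists w.
have Du k : D (u k) by have [] := hu k.
have infJ w : D w -> inf E <= J w.
  by move=> Dw; apply: ge_inf; [exact: hE.2|exists w].
have [k|z Dz uz] := @Dc u Du.
- set a := u k.+1; set b := u k.
  have Da : D a by exact: Du.
  have Db : D b by exact: Du.
  (* the parallelogram identity at the midpoint of two near-minimizers; the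
     constant in e makes it give exactly the rate of si_complete *)
  have Dm : D (2^-1 *: (a + b)) by apply: (siZ S); exact: (siD S).
  have := infJ _ Dm; have := (hu k).2; have := (hu k.+1).2.
  have ek : e k.+1 <= e k.
    by rewrite /e exprS ler_pM2r ?invr_gt0// ler_piMl ?exprn_ge0//; lra.
  rewrite /J -/a -/b LZ; last exact: (siD S).
  have -> : L (a + b) = L a + L b by have := LL 1 a b Da Db; rewrite scale1r mul1r.
  rewrite (siZl S) ?(siZr S)//; try by apply: (siD S).
  rewrite (siBl S) ?(siBr S)//; try by apply: (siB S).
  rewrite (siDl S) ?(siDr S)//; try by apply: (siD S).
  rewrite (siC S Db Da).
  have -> : 8^-1 ^+ k = 4 * e k by rewrite /e; field.
  lra.
exists z => // w Dw.
have /cvgr0Pnorm_lt uz' := uz.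
have cvgf : (fun k => f (u k) w) @ \oo --> f z w.
  apply/subr_cvg0; apply/cvgr0Pnorm_lt => eps eps0.
  have n0 : 0 < nrm f w + 1 by rewrite ltr_wpDl ?nrm_ge0.
  have := uz' (eps / (nrm f w + 1)); rewrite divr_gt0// => /(_ isT).
  apply: filterS => k; rewrite ger0_norm ?nrm_ge0// => hk.
  have Duz : D (u k - z) by apply: (siB S).
  rewrite -(siBl S)//; apply: le_lt_trans (si_CS S Duz Dw) _.
  move: hk; rewrite ltr_pdivlMr//; apply: le_lt_trans.
  by rewrite ler_wpM2l ?nrm_ge0// lerDl.
apply/eqP; rewrite eq_sym -subr_eq0; apply/eqP.
have main t : 0 <= t ^+ 2 * f w w + 2 * t * (f z w - L w) + 0.
  apply: (@ler_cvg_to _ \oo _ _ (fun=> 0)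
    (fun k => t ^+ 2 * f w w + 2 * t * (f (u k) w - L w) + e k)).
  - exact: cvg_cst.
  - apply: cvgD; last first.
      rewrite -(mul0r 4^-1); apply: cvgMl; apply: cvg_expr.
      by rewrite ger0_norm//; lra.
    apply: cvgD; first exact: cvg_cst.
    by apply: cvgMr; apply: cvgB => //; exact: cvg_cst.
  - apply: nearW => k.
    have Dt : D (t *: w + u k) by apply: (siZD S).
    have := infJ _ Dt; have := (hu k).2.
    rewrite /J (si_lin_sqr S)// LL// (siC S Dw)//; lra.
have := quad_ge0 main; rewrite mulr0 => h.
by apply/eqP; rewrite -sqrf_eq0 eq_le h sqr_ge0.
Qed.

End Riesz.

Section Ultra.
Context (K : realType) (I : Type) (F : set_system I).
Hypothesis FU : UltraFilter F.

Let FF : ProperFilter F := ultra_proper.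

Lemma ultra_compact_cvg (T : topologicalType) (A : set T) (u : I -> T) :
  compact A -> (forall i, A (u i)) -> exists2 p, A p & u @ F --> p.
Proof.
move=> cA Au; have FA : (u @ F) A by apply: (@filterE _ F) => i; exact: Au.
have [p [Ap cp]] := cA _ _ FA.
exists p => // N Np; have [//|Fn] := in_ultra_setVsetC (u @^-1` N) FU.
have [x []] := cp (~` N) N Fn Np; by [].
Qed.

Lemma ultra_bounded_cvg (u : I -> K) (c : K) : (forall i, `|u i| <= c) ->
  exists2 l, `|l| <= c & u @ F --> l.
Proof.
move=> uc; have [|l] := @ultra_compact_cvg _ `[- c, c]%classic u (@segment_compact _ _ _).
  by move=> i; rewrite /= in_itv/= -ler_norml.
by rewrite /= in_itv/= -ler_norml => lc ul; exists l.
Qed.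

(** Along an ultrafilter every bounded family of reals converges, so bounded
    families converge weakly with no extraction of subsequences: the limit of
    [f (u i) w] is a bounded functional of [w], which Riesz represents. *)
Lemma ultra_weak_cvg (X : lmodType K) (D : set X) (f : X -> X -> K)
    (u : I -> X) (c : K) : semi_inner D f -> si_complete D f ->
  (forall i, D (u i)) -> (forall i, nrm f (u i) <= c) ->
  exists2 z, D z &
    forall L, bounded_functional D f L -> (fun i => L (u i)) @ F --> L z.
Proof.
move=> S Dc Du uc.
have hl w : exists l, D w -> `|l| <= c * nrm f w /\ (fun i => f (u i) w) @ F --> l.
  have [Dw|nDw] := pselect (D w); last by exists 0.
  have [i|l lc ul] := @ultra_bounded_cvg (fun i => f (u i) w) (c * nrm f w).
    by apply: le_trans (si_CS S _ _) _ => //; rewrite ler_wpM2r ?nrm_ge0.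
  by exists l.
have [l {}hl] := choice hl.
have [|z Dz hz] := riesz S Dc (L := l).
  split; last by exists c => w /hl[].
  move=> a v w Dv Dw; have Dvw := siZD S a Dv Dw.
  apply: (@cvg_unique _ _ (f (u i) (a *: v + w) @[i --> F])) => //.
    exact: (hl _ Dvw).2.
  have -> : (fun i => f (u i) (a *: v + w)) = (fun i => a * f (u i) v + f (u i) w).
    apply/funext => i; rewrite (siDr S) ?(siZr S)//; exact: (siZ S).
  by apply: cvgD; [apply: cvgMr; exact: (hl _ Dv).2|exact: (hl _ Dw).2].
exists z => // L /(riesz S Dc)[y Dy Ly].
rewrite Ly// (siC S)// -hz//.
have -> : (fun i => L (u i)) = (fun i => f (u i) y).
  by apply/funext => i; rewrite Ly// (siC S).
exact: (hl _ Dy).2.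
Qed.

End Ultra.

(** * Combinations of eigenvectors of A^* A *)

Section Spectral.
Context (K : realType) (X Y : lmodType K) (D : set X) (f : X -> X -> K)
  (DY : set Y) (g : Y -> Y -> K).
Hypotheses (S : semi_inner D f) (SY : semi_inner DY g).
Implicit Types (A : X -> Y) (u v w : X) (s : seq K) (a : K -> X).

Definition linear_on A := (forall u, D u -> DY (A u)) /\
  forall c u v, D u -> D v -> A (c *: u + v) = c *: A u + A v.

Definition bounded_by A (c : K) := forall u, D u -> nrm g (A u) <= c * nrm f u.

(** The weak form of A^* A e = l e, which makes sense without an adjoint. *)
Definition eig A (l : K) e :=
  D e /\ forall w, D w -> l * f e w = g (A e) (A w).

Definition spectral A (b2 : K) s a :=
  forall l, l \in s -> b2 < l /\ eig A l (a l).

(** A bound on the Hilbert-Schmidt norm, tested on finite orthonormal families. *)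
Definition hs_bounded A (M : K) := forall s a, uniq s ->
  (forall l, l \in s -> D (a l)) ->
  (forall l l', l \in s -> l' \in s -> f (a l) (a l') = (l == l')%:R) ->
  \sum_(l <- s) g (A (a l)) (A (a l)) <= M.

Lemma lin0 A : linear_on A -> A 0 = 0.
Proof.
move=> [_ LA]; have D0 := si0 S; have := LA 1 0 0 D0 D0.
by rewrite !scale1r addr0 => /eqP; rewrite -subr_eq subrr eq_sym => /eqP.
Qed.

Lemma linZ A c u : linear_on A -> D u -> A (c *: u) = c *: A u.
Proof.
move=> LA Du; have D0 := si0 S; have := LA.2 c u 0 Du D0.
by rewrite !addr0 lin0// addr0.
Qed.

Lemma linB A u v : linear_on A -> D u -> D v -> A (u - v) = A u - A v.
Proof.
move=> LA Du Dv; have := LA.2 (-1) v u Dv Du.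
by rewrite !scaleN1r ![- _ + _]addrC.
Qed.

Lemma lin_sum A s a : linear_on A -> (forall l, l \in s -> D (a l)) ->
  A (\sum_(l <- s) a l) = \sum_(l <- s) A (a l).
Proof.
move=> LA; elim: s => [|x s IH] h; first by rewrite !big_nil lin0.
have Ds l : l \in s -> D (a l) by move=> ls; apply: h; rewrite inE ls orbT.
rewrite !big_cons -IH// -{1}(scale1r (a x)) LA.2 ?scale1r//.
  by apply: h; rewrite inE eqxx.
by apply: (si_sum S) => l ls _; exact: Ds.
Qed.

Lemma eigZ A l c e : linear_on A -> eig A l e -> eig A l (c *: e).
Proof.
move=> LA [De he]; split=> [|w Dw]; first exact: (siZ S).
rewrite (siZl S)// linZ// (siZl SY) ?LA.1//; last 2 first.
- exact: LA.1.
- exact: LA.1.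
by rewrite -he//; ring.
Qed.

Lemma eigD A l e e' : linear_on A -> eig A l e -> eig A l e' -> eig A l (e + e').
Proof.
move=> LA [De he] [De' he']; split=> [|w Dw]; first exact: (siD S).
rewrite (siDl S)// mulrDr he// he'// -(siDl SY)//; try exact: LA.1.
by have := LA.2 1 e e' De De'; rewrite !scale1r => ->.
Qed.

Lemma eig0 A l : linear_on A -> eig A l 0.
Proof.
move=> LA; have D0 := si0 S; split=> // w Dw.
by rewrite lin0// (si0l S)// (si0l SY) ?mulr0//; exact: LA.1.
Qed.

Lemma eig_orth A l l' e e' : eig A l e -> eig A l' e' -> linear_on A ->
  l != l' -> f e e' = 0.
Proof.
move=> [De he] [De' he'] LA ll'.
have := he _ De'; have := he' _ De.
rewrite (siC S De' De) (siC SY (LA.1 _ De') (LA.1 _ De)) => <- /eqP.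
by rewrite -subr_eq0 -mulrBl mulf_eq0 subr_eq0 (negbTE ll') => /eqP.
Qed.

(** Grouping eigenvectors by eigenvalue, and discarding the null ones, makes
    any finite combination an orthogonal one. *)
Lemma spectral_group A b2 (k : nat) (lam : 'I_k -> K) (e : 'I_k -> X) :
  linear_on A -> (forall i, b2 < lam i) -> (forall i, eig A (lam i) (e i)) ->
  exists s a, [/\ uniq s, spectral A b2 s a,
    forall l, l \in s -> 0 < f (a l) (a l) &
    nrm f (\sum_(i < k) e i - \sum_(l <- s) a l) = 0].
Proof.
move=> LA hl he.
pose s := undup [seq lam i | i : 'I_k].
pose a l := \sum_(i < k | lam i == l) e i.
have ha l : eig A l (a l).
  by apply: big_ind => [|x y|i /eqP <-]; [exact: eig0|exact: eigD|exact: he].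
have hs l : l \in s -> b2 < l.
  by rewrite mem_undup => /mapP[i _ ->].
have es : \sum_(i < k) e i = \sum_(l <- s) a l.
  rewrite /a (exchange_big_dep xpredT)//=; apply: eq_bigr => i _.
  rewrite -big_filter [X in \big[_/_]_(_ <- X) _](_ : _ = [:: lam i]) ?big_seq1//.
  apply: perm_small_eq => //; apply: uniq_perm => //.
    by rewrite filter_uniq// undup_uniq.
  move=> l; rewrite mem_filter mem_seq1 eq_sym; case: eqP => //= ->.
  by rewrite mem_undup map_f// mem_enum.
exists [seq l <- s | 0 < f (a l) (a l)], a; split.
- by rewrite filter_uniq// undup_uniq.
- by move=> l; rewrite mem_filter => /andP[_ /hs].
- by move=> l; rewrite mem_filter => /andP[].
have Da l : D (a l) by have [] := ha l.
rewrite es big_filter [X in X - _](bigID (fun l => 0 < f (a l) (a l)))/=.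
rewrite addrAC subrr add0r; apply/eqP; rewrite eq_le nrm_ge0 andbT.
suff [] : let v := \sum_(l <- s | ~~ (0 < f (a l) (a l))) a l in
  D v /\ nrm f v <= 0 by [].
apply: (big_ind (fun v => D v /\ nrm f v <= 0)) => [|v w [Dv v0] [Dw w0]|l h].
- by rewrite (nrm0 S); split=> //; exact: si0 S.
- split; first exact: (siD S).
  by apply: le_trans (nrmD S Dv Dw) _; rewrite -(addr0 0) lerD.
- by split=> //; rewrite /nrm; case: ltgtP (si_ge0 S (Da l)) h => // <-; rewrite sqrtr0.
Qed.

Lemma spectral_D A b2 s a : spectral A b2 s a -> forall l, l \in s -> D (a l).
Proof. by move=> h l /h[_ []]. Qed.

(** The combination weighted by the eigenvalues is [A^* A] applied to the
    combination. *)
Lemma spectral_weak A b2 s a w : linear_on A -> spectral A b2 s a -> D w ->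
  f (\sum_(l <- s) l *: a l) w = g (A (\sum_(l <- s) a l)) (A w).
Proof.
move=> LA hs Dw; have Da := spectral_D hs.
rewrite lin_sum// (si_suml SY) ?(si_suml S)//; try exact: LA.1.
- apply: eq_big_seq => l ls; have Dl := Da _ ls; rewrite (siZl S)//.
  by have [_ [_ ->]] := hs _ ls.
- by move=> l /Da; exact: (siZ S).
- by move=> l /Da; exact: LA.1.
Qed.

(** Pieces for distinct eigenvalues are orthogonal, so the quadratic form of
    [A^* A] is a weighted sum with weights above [b ^+ 2]. *)
Lemma spectral_lower A b s a : linear_on A -> 0 <= b -> uniq s ->
  spectral A (b ^+ 2) s a ->
  b * nrm f (\sum_(l <- s) a l) <= nrm g (A (\sum_(l <- s) a l)).
Proof.
move=> LA b0 us hs; have Da := spectral_D hs.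
set u := \sum_(l <- s) a l.
have Du : D u by apply: (si_sum S) => l ls _; exact: Da.
have orth l l' : l \in s -> l' \in s -> f (a l) (a l') = (l == l')%:R * f (a l) (a l).
  move=> ls l's; have [->|ll'] := eqVneq l l'; first by rewrite mul1r.
  by rewrite mul0r; exact: (eig_orth (hs _ ls).2 (hs _ l's).2 LA ll').
have fu l : l \in s -> f (a l) u = f (a l) (a l).
  move=> ls; have Dl := Da _ ls; rewrite (si_sumr S)// (bigD1_seq l)//= big1_seq ?addr0//.
  by move=> l' /andP[ll' l's]; rewrite orth// eq_sym (negbTE ll') mul0r.
have fuu : f u u = \sum_(l <- s) f (a l) (a l).
  by rewrite {1}/u (si_suml S)//; apply: eq_big_seq.
rewrite -ler_sqr ?nnegrE ?mulr_ge0 ?nrm_ge0//.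
rewrite exprMn (sqr_nrm S)// (sqr_nrm SY); last exact: LA.1.
rewrite -(spectral_weak LA hs)// fuu (si_suml S)//; last first.
  by move=> l /Da; exact: (siZ S).
rewrite mulr_sumr big_seq [leRHS]big_seq; apply: ler_sum => l ls; have Dl := Da _ ls.
rewrite (siZl S)// fu// ler_wpM2r ?(si_ge0 S)//.
by have [/ltW] := hs _ ls.
Qed.

(** Normalized, the pieces form an orthonormal family on which A is bounded
    below, so a bound on the Hilbert-Schmidt sums counts them. *)
Lemma spectral_size A b2 M s a : linear_on A -> hs_bounded A M -> 0 < b2 ->
  uniq s -> spectral A b2 s a -> (forall l, l \in s -> 0 < f (a l) (a l)) ->
  (size s)%:R * b2 <= M.
Proof.
move=> LA HS b0 us hs pos; have Da := spectral_D hs.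
pose n l := (nrm f (a l))^-1 *: a l.
have n0 l : l \in s -> 0 < nrm f (a l) by move=> ls; rewrite sqrtr_gt0 pos.
have Dn l : l \in s -> D (n l) by move=> ls; apply: (siZ S); exact: Da.
have fn l : l \in s -> f (n l) (n l) = 1.
  move=> ls; have Dl := Da _ ls; have Dnl := Dn _ ls.
  rewrite (siZl S)// (siZr S)// mulrA -invfM -expr2 (sqr_nrm S)//.
  by rewrite mulVf// gt_eqF// pos.
apply: le_trans (HS s n us Dn _); last first.
  move=> l l' ls l's; have [<-|ll'] := eqVneq l l'; first exact: fn.
  by apply: (eig_orth (eigZ _ LA (hs _ ls).2) (eigZ _ LA (hs _ l's).2) LA ll').
rewrite [leLHS](_ : _ = \sum_(l <- s) b2).
  rewrite big_seq [leRHS]big_seq; apply: ler_sum => l ls.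
  have [/ltW bl /(eigZ (nrm f (a l))^-1 LA)[Dl hl]] := hs _ ls.
  by rewrite -hl// fn// mulr1.
by rewrite big_const_seq count_predT iter_addr_0 mulr_natl.
Qed.

(** The operator [1 - A^* A / l0] kills exactly the component for [l0]. *)
Lemma rem_sum (l0 : K) s a : l0 != 0 ->
  \sum_(l <- rem l0 s) (1 - l / l0) *: a l =
  \sum_(l <- s) a l - l0^-1 *: \sum_(l <- s) l *: a l.
Proof.
move=> l00.
have -> : \sum_(l <- s) a l - l0^-1 *: \sum_(l <- s) l *: a l
    = \sum_(l <- s) (1 - l / l0) *: a l.
  rewrite scaler_sumr -sumrB; apply: eq_bigr => l _.
  by rewrite scalerBl scale1r scalerA mulrC.
have [l0s|l0s] := boolP (l0 \in s); last by rewrite rem_id.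
by rewrite [RHS](big_rem l0)//= divff// subrr scale0r add0r.
Qed.

Lemma spectral_rem A b2 l0 s a : linear_on A -> spectral A b2 s a ->
  spectral A b2 (rem l0 s) (fun l => (1 - l / l0) *: a l).
Proof.
move=> LA hs l /mem_rem ls; split; first exact: (hs _ ls).1.
by apply: eigZ => //; exact: (hs _ ls).2.
Qed.

(** By induction on the number of eigenvectors.  Subtracting [l0^-1 A^* A]
    deletes the component for [l0], and the change is controlled since [A^* A]
    depends on [A] in a Lipschitz way.  No gap between eigenvalues enters. *)
Lemma spectral_close (c b2 : K) (n : nat) : 0 <= c -> 0 < b2 ->
  exists2 C, 0 <= C & forall A A' eta s s' a a',
    linear_on A -> linear_on A' -> bounded_by A c -> bounded_by A' c ->
    0 <= eta -> (forall w, D w -> nrm g (A w - A' w) <= eta * nrm f w) ->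
    spectral A b2 s a -> spectral A' b2 s' a' -> (size s + size s' <= n)%N ->
    forall u v, u = \sum_(l <- s) a l -> v = \sum_(l <- s') a' l ->
    nrm f (u - v) <= C * (nrm g (A' (u - v)) + eta * nrm f u).
Proof.
move=> c0 b0; elim: n => [|n [C C0 IH]].
  exists 0; first by [].
  move=> A A' eta s s' a a' LA LA' BA BA' eta0 hd hs hs' sz _ _ -> ->.
  set u := \sum_(l <- s) _; set v := \sum_(l <- s') _.
  have -> : u = 0.
    by rewrite /u; case: s sz {u hs} => //; rewrite big_nil.
  have -> : v = 0.
    by rewrite /v; case: s' sz {v hs'} => [|x s']; rewrite ?big_nil//= addnS.
  by rewrite subrr (nrm0 S) mul0r.
pose Z := 2 * c; pose C' := C * (1 + c * Z / b2 + (1 + c ^+ 2 / b2)) + Z / b2.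
have Z0 : 0 <= Z by rewrite mulr_ge0.
have C'0 : 0 <= C'.
  have b1 := ltW b0.
  by rewrite /C'; apply: addr_ge0; rewrite ?divr_ge0// mulr_ge0// !addr_ge0//
    divr_ge0// ?sqr_ge0// mulr_ge0.
exists C'; first by [].
move=> A A' eta s s' a a' LA LA' BA BA' eta0 hd hs hs' sz _ _ -> ->.
set u := \sum_(l <- s) _; set v := \sum_(l <- s') _.
have Da := spectral_D hs; have Da' := spectral_D hs'.
have Du : D u by apply: (si_sum S) => l ls _; exact: Da.
have Dv : D v by apply: (si_sum S) => l ls _; exact: Da'.
have Duv : D (u - v) by apply: (siB S).
pose q := nrm g (A' (u - v)); rewrite -/q.
have q0 : 0 <= q by exact: nrm_ge0.
have [ss0|] := posnP (size s + size s').
  have -> : u = 0.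
    by rewrite /u; case: s ss0 {u sz hs Da Du Duv q q0} => //; rewrite big_nil.
  have -> : v = 0.
    by rewrite /v; case: s' ss0 {v sz hs' Da' Dv Duv q q0} => [|x s']; rewrite ?big_nil//= addnS.
  rewrite subrr (nrm0 S) mulr_ge0// addr_ge0// mulr_ge0// (nrm0 S)//.
move=> ss0.
have [l0 l0s] : exists l0, (l0 \in s) || (l0 \in s').
  case: s ss0 {sz hs Da u Du Duv q q0} => [|x s].
    case: s' {hs' Da' v Dv} => // x s'; exists x; by rewrite mem_head orbT.
  by exists x; rewrite mem_head.
have bl0 : b2 < l0 by case/orP: l0s => [/hs|/hs'] [].
have l00 : 0 < l0 by exact: lt_trans bl0.
have l0n : l0 != 0 by rewrite gt_eqF.
pose Tu := \sum_(l <- s) l *: a l; pose Tv := \sum_(l <- s') l *: a' l.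
have DTu : D Tu by apply: (si_sum S) => l ls _; apply: (siZ S); exact: Da.
have DTv : D Tv by apply: (si_sum S) => l ls _; apply: (siZ S); exact: Da'.
(* z is the difference of the two values of A^* A; testing it against itself
   bounds it by the right-hand side *)
pose z := Tu - Tv.
have Dz : D z by apply: (siB S).
have hTu w : D w -> f Tu w = g (A u) (A w).
  by move=> Dw; exact: (spectral_weak LA hs Dw).
have hTv w : D w -> f Tv w = g (A' v) (A' w).
  by move=> Dw; exact: (spectral_weak LA' hs' Dw).
have nA w : D w -> DY (A w) by exact: LA.1.
have nA' w : D w -> DY (A' w) by exact: LA'.1.
have nTu : nrm f Tu <= c ^+ 2 * nrm f u.
  have h : nrm f Tu ^+ 2 <= c ^+ 2 * nrm f u * nrm f Tu.
    rewrite (sqr_nrm S)// hTu//; apply: le_trans (si_CSle SY _ _) _; try exact: LA.1.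
    apply: le_trans (ler_pM (nrm_ge0 _ _) (nrm_ge0 _ _) (BA _ Du) (BA _ DTu)) _.
    by rewrite le_eqVlt; apply/orP; left; apply/eqP; ring.
  have [h0|h0] := eqVneq (nrm f Tu) 0.
    by rewrite h0 mulr_ge0 ?sqr_ge0 ?nrm_ge0.
  by move: h; rewrite expr2 ler_pM2r// lt_neqAle eq_sym h0 nrm_ge0.
have nz : nrm f z <= Z * (q + eta * nrm f u).
  have h : nrm f z ^+ 2 <= Z * (q + eta * nrm f u) * nrm f z.
    rewrite (sqr_nrm S)// {1}/z (siBl S)// hTu// hTv//.
    have -> : g (A u) (A z) - g (A' v) (A' z) =
      g (A u) (A z - A' z) + g (A u - A' u) (A' z) + g (A' (u - v)) (A' z).
      have Au := nA _ Du; have A'u := nA' _ Du; have A'v := nA' _ Dv.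
      have Az := nA _ Dz; have A'z := nA' _ Dz.
      by rewrite (linB LA' Du Dv) (siBr SY)// !(siBl SY)//; ring.
    have e1 : g (A u) (A z - A' z) <= c * nrm f u * (eta * nrm f z).
      apply: le_trans (si_CSle SY _ _) _; [exact: nA|apply: (siB SY); [exact: nA|exact: nA']|].
      by apply: ler_pM; rewrite ?nrm_ge0// ?BA// hd.
    have e2 : g (A u - A' u) (A' z) <= eta * nrm f u * (c * nrm f z).
      apply: le_trans (si_CSle SY _ _) _; [apply: (siB SY); [exact: nA|exact: nA']|exact: nA'|].
      by apply: ler_pM; rewrite ?nrm_ge0// ?BA'// hd.
    have e3 : g (A' (u - v)) (A' z) <= q * (c * nrm f z).
      apply: le_trans (si_CSle SY _ _) _; [exact: nA'|exact: nA'|].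
      by apply: ler_pM; rewrite ?nrm_ge0// ?BA'.
    have e4 : 0 <= q * (c * nrm f z) by rewrite !mulr_ge0// nrm_ge0.
    rewrite /Z; move: e1 e2 e3 e4; lra.
  have [h0|h0] := eqVneq (nrm f z) 0.
    by rewrite h0 mulr_ge0 ?addr_ge0 ?mulr_ge0 ?nrm_ge0.
  by move: h; rewrite expr2 ler_pM2r// lt_neqAle eq_sym h0 nrm_ge0.
have rw : u - l0^-1 *: Tu - (v - l0^-1 *: Tv) = (u - v) - l0^-1 *: z.
  rewrite /z scalerBr !opprB addrACA [RHS]addrACA; congr (_ + _).
  by rewrite addrC.
have sz' : (size (rem l0 s) + size (rem l0 s') <= n)%N.
  have rle t : (size (rem l0 t) <= size t)%N.
    by have [lt|lt] := boolP (l0 \in t); [rewrite size_rem// leq_pred|rewrite rem_id].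
  have rlt t : l0 \in t -> (size (rem l0 t) < size t)%N.
    by move=> lt; rewrite size_rem// prednK//; case: (t) lt.
  rewrite -ltnS; apply: leq_trans sz.
  case/orP: l0s => /rlt h; [rewrite -addSn|rewrite -addnS];
    exact: leq_add.
have := IH A A' eta (rem l0 s) (rem l0 s') _ _ LA LA' BA BA' eta0 hd
  (spectral_rem LA hs) (spectral_rem LA' hs') sz'.
move=> /(_ _ _ erefl erefl); rewrite !rem_sum// -/u -/v -/Tu -/Tv rw.
have DTl : D (l0^-1 *: z) by apply: (siZ S).
have nl0 : `|l0^-1| <= b2^-1.
  have h := ltW l00; rewrite ger0_norm ?invr_ge0// lef_pV2 ?posrE//.
  exact: ltW.
have nlz : nrm f (l0^-1 *: z) <= nrm f z / b2.
  by rewrite (nrmZ S)// mulrC ler_wpM2l ?nrm_ge0.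
have t1 : nrm f (u - v) <= nrm f ((u - v) - l0^-1 *: z) + nrm f z / b2.
  by apply: le_trans (nrm_le_sub S Duv DTl) _; rewrite lerD2l.
have t2 : nrm g (A' ((u - v) - l0^-1 *: z)) <= q + c * (nrm f z / b2).
  rewrite linB//; apply: le_trans (nrmB SY _ _) _; try exact: nA'.
  rewrite lerD2l; apply: le_trans (BA' _ _) _ => //.
  by rewrite ler_wpM2l.
have t3 : nrm f (u - l0^-1 *: Tu) <= (1 + c ^+ 2 / b2) * nrm f u.
  apply: le_trans (nrmB S _ _) _ => //; first exact: (siZ S).
  rewrite (nrmZ S)// mulrDl mul1r lerD2l.
  have -> : c ^+ 2 / b2 * nrm f u = b2^-1 * (c ^+ 2 * nrm f u) by ring.
  by apply: ler_pM => //; exact: nrm_ge0.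
move=> t4; apply: le_trans t1 _.
have nzb : nrm f z / b2 <= Z / b2 * (q + eta * nrm f u).
  by rewrite mulrAC ler_wpM2r// invr_ge0 ltW.
set Q := q + eta * nrm f u in nz nzb *.
have qQ : q <= Q by rewrite lerDl mulr_ge0// nrm_ge0.
have uQ : eta * nrm f u <= Q by rewrite lerDr.
have t5 : nrm g (A' (u - v - l0^-1 *: z)) <= (1 + c * Z / b2) * Q.
  apply: le_trans t2 _; rewrite mulrDl mul1r; apply: lerD => //.
  by apply: le_trans (ler_wpM2l c0 nzb) _; rewrite !mulrA.
have t6 : eta * nrm f (u - l0^-1 *: Tu) <= (1 + c ^+ 2 / b2) * Q.
  apply: le_trans (ler_wpM2l eta0 t3) _; rewrite mulrCA ler_wpM2l//.
  by rewrite addr_ge0// divr_ge0 ?sqr_ge0// ltW.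
have t7 := ler_wpM2l C0 (lerD t5 t6).
apply: le_trans (lerD (le_trans t4 t7) nzb) _.
by rewrite /C' le_eqVlt; apply/orP; left; apply/eqP; ring.
Qed.

End Spectral.

(** * The space L^2 *)

Lemma fast_cauchy_dist (K : realType) (X : lmodType K) (D : set X)
    (f : X -> X -> K) (u : nat -> X) : semi_inner D f -> (forall k, D (u k)) ->
  (forall k, f (u k.+1 - u k) (u k.+1 - u k) <= 8^-1 ^+ k) ->
  forall k j, (k <= j)%N -> nrm f (u j - u k) <= 2 * 2^-1 ^+ k.
Proof.
move=> S Du hu k j.
have step i : nrm f (u i.+1 - u i) <= 2^-1 ^+ i.
  have Di : D (u i.+1 - u i) by apply: (siB S).
  rewrite (nrm_leP S)// ?exprn_ge0//; apply: le_trans (hu i) _.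
  rewrite -exprM mulnC exprM lerXn2r ?nnegrE ?exprn_ge0//; lra.
move=> /subnKC <-; elim: (j - k)%N => [|i IH].
  by rewrite addn0 subrr (nrm0 S) mulr_ge0// exprn_ge0.
suff : nrm f (u (k + i.+1)%N - u k) <= 2 * (2^-1 ^+ k - 2^-1 ^+ (k + i.+1)).
  by move/le_trans; apply; rewrite ler_wpM2l// gerBl exprn_ge0.
elim: i.+1 => [|m IHm]; first by rewrite addn0 !subrr (nrm0 S) mulr0.
rewrite addnS -(subrK (u (k + m)%N) (u (k + m).+1)) -addrA.
apply: le_trans (nrmD S _ _) _; try by apply: (siB S).
apply: le_trans (lerD (step _) IHm) _.
by rewrite (exprS _ (k + m)) le_eqVlt; apply/orP; left; apply/eqP; field.
Qed.

Lemma limn_einfE (K : realType) (u : nat -> \bar K) :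
  limn_einf u = ereal_sup [set ereal_inf (u @` V) | V in \oo].
Proof. exact: limf_einfE. Qed.

Section L2.
Context (K : realType) (n : nat) (M : set 'rV[K]_n)
  (sigma : {measure set (borel K n) -> \bar K}).
Hypothesis mM : measurable (M : set (borel K n)).
Implicit Types f g h : 'rV[K]_n -> K.
Local Notation L2 := (inL2 M sigma).
Local Notation dot := (dotL2 M sigma).

Definition meas f := measurable_fun (M : set (borel K n)) (f : borel K n -> K).

Lemma meas_cst (c : K) : meas (fun=> c). Proof. exact: measurable_cst. Qed.

Lemma meas_add f g : meas f -> meas g -> meas (fun x => f x + g x).
Proof. exact: measurable_funD. Qed.

Lemma meas_sub f g : meas f -> meas g -> meas (fun x => f x - g x).
Proof. exact: measurable_funB. Qed.

Lemma meas_mul f g : meas f -> meas g -> meas (fun x => f x * g x).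
Proof. exact: measurable_funM. Qed.

Lemma meas_sqr f : meas f -> meas (fun x => f x ^+ 2).
Proof. exact: measurable_funX. Qed.

Lemma emeas f : meas f -> measurable_fun (M : set (borel K n))
  ((fun x => (f x)%:E) : borel K n -> \bar K).
Proof. by move=> mf; apply/measurable_EFinP. Qed.

Lemma ae_imp (P Q : 'rV[K]_n -> Prop) : (forall x, P x -> Q x) ->
  {ae sigma, forall x, P x} -> {ae sigma, forall x, Q x}.
Proof. by move=> PQ; apply: (@filterS _ _ (ae_filter_ringOfSetsType sigma)). Qed.

Lemma inL2_mul f g : L2 f -> L2 g ->
  sigma.-integrable M (fun x => (f x * g x)%:E).
Proof.
move=> [mf If] [mg Ig].
apply: (@le_integrable _ _ _ sigma M mM _ (fun x => (f x ^+ 2 + g x ^+ 2)%:E)).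
- by apply: emeas; exact: meas_mul.
- move=> x _; rewrite lee_fin [leRHS]ger0_norm ?addr_ge0 ?sqr_ge0// normrM.
  have := sqr_ge0 (`|f x| - `|g x|); rewrite sqrrB !real_normK ?num_real//.
  have := sqr_ge0 (f x); have := sqr_ge0 (g x); rewrite -mulr_natl; lra.
- have -> : (fun x => (f x ^+ 2 + g x ^+ 2)%:E) =
    ((fun x => (f x ^+ 2)%:E) \+ (fun x => (g x ^+ 2)%:E))%E by [].
  exact: integrableD.
Qed.

Lemma inL2ZD (a : K) f g : L2 f -> L2 g -> L2 (a *: f + g).
Proof.
move=> Lf Lg; have [mf If] := Lf; have [mg Ig] := Lg.
have mfg : meas (a *: f + g).
  exact: meas_add (meas_mul (meas_cst a) mf) mg.
split=> //.
have -> : (fun x => ((a *: f + g) x ^+ 2)%:E) =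
    ((fun x => (a ^+ 2)%:E * (f x ^+ 2)%:E) \+
    ((fun x => (2 * a)%:E * (f x * g x)%:E) \+ (fun x => (g x ^+ 2)%:E)))%E.
  apply/funext => x /=; rewrite -!EFinM -!EFinD; congr EFin.
  have -> : (a *: f + g) x = a * f x + g x by [].
  by ring.
apply: integrableD => //; first exact: integrableZl.
by apply: integrableD => //; apply: integrableZl => //; exact: inL2_mul.
Qed.

Lemma inL20 : L2 0.
Proof.
split; first exact: measurable_cst.
have -> : (fun x : borel K n => (((0 : 'rV[K]_n -> K) x) ^+ 2)%:E) = cst 0%E.
  by apply/funext => x; rewrite -[X in X ^+ 2]/(0 : K) expr0n.
exact: integrable0.
Qed.

Lemma L2_semi_inner : semi_inner L2 dot.
Proof.
split; [exact: inL20|by move=> *; exact: inL2ZD|..].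
- by move=> f g _ _; apply: eq_Rintegral => x _; rewrite mulrC.
- move=> a f g h Lf Lg Lh; rewrite /dotL2.
  have Ifh := inL2_mul Lf Lh; have Igh := inL2_mul Lg Lh.
  rewrite -RintegralZl// -RintegralD//.
    by apply: eq_Rintegral => x _; rewrite mulrA -mulrDl.
  have -> : EFin \o (fun x => a * (f x * h x)) =
    (fun x => a%:E * (f x * h x)%:E)%E by [].
  exact: integrableZl.
- by move=> f _; apply: Rintegral_ge0 => x _; rewrite -expr2 sqr_ge0.
Qed.

Lemma dotL2E f g : L2 f -> L2 g ->
  (dot f g)%:E = (\int[sigma]_(x in M) (f x * g x)%:E)%E.
Proof.
move=> Lf Lg; rewrite /dotL2 /Rintegral fineK//.
by apply: integrable_fin_num => //; exact: inL2_mul.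
Qed.

Lemma dotL2_sqrE f : L2 f ->
  (dot f f)%:E = (\int[sigma]_(x in M) (f x ^+ 2)%:E)%E.
Proof.
by move=> Lf; rewrite dotL2E//; apply: eq_integral => x _; rewrite expr2.
Qed.

Lemma eq_dotL2 f f' g g' : (forall x, M x -> f x = f' x) ->
  (forall x, M x -> g x = g' x) -> dot f g = dot f' g'.
Proof.
move=> e e'; apply: eq_Rintegral => x; rewrite inE => Mx.
by rewrite e// e'.
Qed.

Lemma eq_inL2 f f' : (forall x, M x -> f x = f' x) -> L2 f -> L2 f'.
Proof.
move=> e [mf If]; split.
  by apply: eq_measurable_fun mf => x; rewrite inE => /e.
by apply: eq_integrable If => // x; rewrite inE => /e ->.
Qed.

Lemma eqL2_dot f g h : L2 f -> L2 g -> L2 h -> eqL2 M sigma f g ->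
  dot f h = dot g h.
Proof.
move=> Lf Lg Lh e; rewrite /dotL2 /Rintegral; congr fine.
apply: ae_eq_integral => //.
- exact: measurable_int (inL2_mul Lf Lh).
- exact: measurable_int (inL2_mul Lg Lh).
- by apply: ae_imp e => x e Mx; rewrite /= e.
Qed.

Lemma dotL2_eq0 f : L2 f -> dot f f = 0 -> eqL2 M sigma f 0.
Proof.
move=> Lf f0.
have : (\int[sigma]_(x in M) `|(f x ^+ 2)%:E| = 0)%E.
  rewrite -[RHS](_ : (dot f f)%:E = 0%E); last by rewrite f0.
  rewrite dotL2_sqrE//; apply: eq_integral => x _.
  by rewrite gee0_abs// lee_fin sqr_ge0.
move/ae_eq_integral_abs => /(_ mM (measurable_int _ Lf.2)).
apply: ae_imp => x h Mx.
by have [/eqP] := h Mx; rewrite sqrf_eq0 => /eqP.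
Qed.

(** Riesz-Fischer. The rate makes the sum of [4 ^+ k * (u k.+1 - u k) ^+ 2]
    integrable, hence finite almost everywhere, which forces pointwise
    convergence; Fatou's lemma turns the uniform L^2 estimate into an estimate
    of the distance to the pointwise limit. *)
Lemma L2_complete : si_complete L2 dot.
Proof.
move=> u Lu hu.
pose De k (x : 'rV[K]_n) : K := u k.+1 x - u k x.
have LDe k : L2 (De k) by exact: (siB L2_semi_inner (Lu k.+1) (Lu k)).
have mu_ k : meas (u k) by have [] := Lu k.
pose t k (x : 'rV[K]_n) : \bar K := (4 ^+ k * De k x ^+ 2)%:E.
have t0 k x : (0 <= t k x)%E by rewrite lee_fin mulr_ge0 ?sqr_ge0 ?exprn_ge0.
have mt k : measurable_fun (M : set (borel K n)) (t k : borel K n -> \bar K).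
  apply: emeas; apply: (@meas_mul (fun=> 4 ^+ k) (fun x => De k x ^+ 2)).
    exact: meas_cst.
  exact: meas_sqr (LDe k).1.
pose G x := (\big[+%E/0%E]_(0 <= k <oo) t k x)%E.
have IG : sigma.-integrable M G.
  have mG : measurable_fun (M : set (borel K n)) (G : borel K n -> \bar K).
    by apply: ge0_emeasurable_sum => // k x Mx _; exact: t0.
  apply/integrableP; split=> //.
  have -> : (\int[sigma]_(x in M) `|G x| =
             \big[+%E/0%E]_(0 <= k <oo) \int[sigma]_(x in M) t k x)%E.
    rewrite -integral_nneseries//; apply: eq_integral => x _.
    by rewrite gee0_abs// nneseries_ge0.
  apply: (@le_lt_trans _ _ (\big[+%E/0%E]_(0 <= k <oo) (2^-1 ^+ k)%:E)%E).
    apply: lee_nneseries => [k _ _|k _].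
      by apply: integral_ge0 => x _; exact: t0.
    have -> : (\int[sigma]_(x in M) t k x = (4 ^+ k)%:E * (dot (De k) (De k))%:E)%E.
      rewrite dotL2_sqrE// -ge0_integralZl// ?lee_fin ?exprn_ge0//.
      - exact: emeas (meas_sqr (LDe k).1).
      - by move=> x _; rewrite lee_fin sqr_ge0.
    rewrite -EFinM lee_fin.
    have -> : (2^-1 : K) ^+ k = 4 ^+ k * 8^-1 ^+ k.
      by rewrite -exprMn; congr (_ ^+ _); field.
    by rewrite ler_wpM2l ?exprn_ge0//; exact: hu.
  have /cvg_lim := @cvg_geometric_eseries_half K 2 0.
  rewrite expr0 divr1 => /(_ (@ereal_hausdorff _)) h.
  have -> : (\big[+%E/0%E]_(0 <= k <oo) (2^-1 ^+ k)%:E = 2%:E :> \bar K)%E.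
    rewrite -h; congr (limn _); apply/funext => m; apply: eq_bigr => k _.
    by congr EFin; rewrite addn1 natrX exprS invfM mulrA divff// mul1r exprVn.
  exact: ltry.
have aeG := integrable_ae mM IG.
pose l x := fine (limn_esup (fun k => (u k x)%:E)).
have ml : meas l.
  apply: (@measurableT_comp _ _ _ _ _ _ fine); first exact: fine_measurable.
  by apply: measurable_fun_limn_esup => k; apply/measurable_EFinP; exact: mu_.
have cvl : {ae sigma, forall x, M x -> (fun k => u k x) @ \oo --> l x}.
  apply: ae_imp aeG => x + Mx => /(_ Mx) Gfin.
  have /cvg_ex[/= y uy] : cvg ((fun k => u k x) @ \oo).
    have tG k : (t k x <= G x)%E.
      apply: le_trans (nneseries_lim_ge k.+1 _); last by move=> i _ _; exact: t0.
      by rewrite big_nat_recr//= leeDr// sume_ge0// => i _; exact: t0.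
    pose c := fine (G x).
    have tc k : `|De k x| <= Num.sqrt c * 2^-1 ^+ k.
      have := tG k; rewrite -(fineK Gfin) lee_fin -/c => h.
      have c0 : 0 <= c by apply: le_trans h; rewrite mulr_ge0 ?sqr_ge0 ?exprn_ge0.
      have r0 : 0 <= Num.sqrt c * 2^-1 ^+ k.
        by rewrite mulr_ge0 ?sqrtr_ge0// exprn_ge0.
      rewrite -ler_sqr ?nnegrE ?normr_ge0//.
      rewrite real_normK ?num_real// exprMn sqr_sqrtr// -exprM mulnC exprM.
      have -> : (2^-1 ^+ 2 : K) = 4^-1 by field.
      by rewrite exprVn ler_pdivlMr ?exprn_gt0// mulrC.
    have -> : (fun k => u k x) = (fun k => u 0%N x + series (De ^~ x) k).
      by apply/funext => k; exact: (eq_sum_telescope (fun k => u k x)).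
    apply: is_cvgD; first exact: is_cvg_cst.
    apply: normed_cvg; apply: (series_le_cvg _ _ tc) => [i|i|].
    - exact: normr_ge0.
    - by rewrite mulr_ge0 ?sqrtr_ge0 ?exprn_ge0.
    - by apply: is_cvg_geometric_series; rewrite ger0_norm//; lra.
  suff -> : l x = y by [].
  rewrite /l; have -> : limn_esup (fun k => (u k x)%:E) = y%:E; last by [].
  apply: (cvg_limn_einf_sup _).2.
  by apply/fine_cvgP; split; [exact: nearW|exact: uy].
have key k : (\int[sigma]_(x in M) ((u k x - l x) ^+ 2)%:E <= ((2 * 2^-1 ^+ k) ^+ 2)%:E)%E.
  have Lkj j : L2 (u j - u k) by exact: (siB L2_semi_inner (Lu j) (Lu k)).
  have mkj j : measurable_fun (M : set (borel K n))
      ((fun x => ((u j x - u k x) ^+ 2)%:E) : borel K n -> \bar K).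
    by apply: measurable_int (Lkj j).2.
  have mkl : measurable_fun (M : set (borel K n))
      ((fun x => ((u k x - l x) ^+ 2)%:E) : borel K n -> \bar K).
    by apply: emeas; apply: meas_sqr; exact: meas_sub.
  have p0 j x : M x -> (0 <= ((u j x - u k x) ^+ 2)%:E)%E.
    by move=> _; rewrite lee_fin sqr_ge0.
  apply: (@le_trans _ _
    (\int[sigma]_(x in M) limn_einf (fun j => ((u j x - u k x) ^+ 2)%:E))%E).
    apply: ae_ge0_le_integral => //.
    - by move=> x _; rewrite lee_fin sqr_ge0.
    - move=> x Mx; rewrite limn_einfE; apply: le_trans (ereal_sup_ubound _).
        2: by exists setT => //; exact: filterT.
      by apply: le_ereal_inf_tmp => _ [j _ <-]; exact: p0.
    - have -> : (fun x => limn_einf (fun j => ((u j x - u k x) ^+ 2)%:E)) =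
          (-%E \o (fun x => limn_esup (fun j => - ((u j x - u k x) ^+ 2)%:E)))%E by [].
      apply: (@measurableT_comp _ _ _ _ _ _ -%E); first exact: oppe_measurable.
      apply: measurable_fun_limn_esup => j.
      by apply: (@measurableT_comp _ _ _ _ _ _ -%E); first exact: oppe_measurable.
    - apply: ae_imp cvl => x cx Mx.
      have -> : limn_einf (fun j => ((u j x - u k x) ^+ 2)%:E) = ((u k x - l x) ^+ 2)%:E.
        apply: (cvg_limn_einf_sup _).1; apply/fine_cvgP; split; first exact: nearW.
        have c : (fun j => u j x - u k x) @ \oo --> l x - u k x.
          by apply: cvgB; [exact: cx|exact: cvg_cst].
        rewrite -sqrrN opprB; exact: (cvgM c c).
      by [].
  have F := fatou sigma mM mkj p0; apply: (le_trans F).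
  rewrite limn_einfE; apply: ge_ereal_sup => _ [V [N _ NV] <-].
  apply: (@le_trans _ _ (\int[sigma]_(x in M) ((u (maxn N k) x - u k x) ^+ 2)%:E)%E).
    by apply: ereal_inf_lbound; exists (maxn N k) => //; apply: NV => /=; exact: leq_maxl.
  rewrite -(dotL2_sqrE (Lkj (maxn N k))) lee_fin -(sqr_nrm L2_semi_inner (Lkj _)).
  rewrite lerXn2r ?nnegrE ?nrm_ge0 ?mulr_ge0 ?exprn_ge0//.
  by apply: (fast_cauchy_dist L2_semi_inner) => //; exact: leq_maxr.
have Ll k : L2 (u k - l).
  split; first by apply: meas_sub => //; exact: (Lu k).1.
  apply/integrableP; split.
    by apply: emeas; apply: meas_sqr; apply: meas_sub => //; exact: (Lu k).1.
  apply: le_lt_trans (ltry ((2 * 2^-1 ^+ k) ^+ 2)); apply: le_trans (key k).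
  rewrite le_eqVlt; apply/orP; left; apply/eqP; apply: eq_integral => x _.
  by rewrite gee0_abs// lee_fin sqr_ge0.
exists l.
  have := siB L2_semi_inner (Lu 0%N) (Ll 0%N).
  by rewrite opprB addrC subrK.
apply: (@squeeze_cvgr _ _ _ _ (cst 0) (fun k => 2 * 2^-1 ^+ k)).
- apply: nearW => k; rewrite nrm_ge0/= (nrm_leP L2_semi_inner)// ?mulr_ge0 ?exprn_ge0//.
  by rewrite -lee_fin dotL2_sqrE//; exact: key.
- exact: cvg_cst.
- rewrite -(mulr0 2); apply: cvgMr; apply: cvg_expr; rewrite ger0_norm//; lra.
Qed.

End L2.

(** * Finiteness of the surface measure *)

Section Euclid.
Context (K : realType).

Lemma dotp_semi_inner (n : nat) : semi_inner setT (@dotp K n).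
Proof.
split=> //.
- by move=> u v _ _; apply: eq_bigr => i _; rewrite mulrC.
- move=> a u v w _ _ _; rewrite /dotp mulr_sumr -big_split/=.
  by apply: eq_bigr => i _; rewrite !mxE; ring.
- by move=> u _; apply: sumr_ge0 => i _; rewrite -expr2 sqr_ge0.
Qed.

Lemma coord_le_norm (m n : nat) (a : 'M[K]_(m, n)) i j : `|a i j| <= `|a|.
Proof.
rewrite [leRHS]/Num.Def.normr /= mx_normrE; apply/bigmax_geP; right => /=.
by exists (i, j).
Qed.

Lemma norm_leP (m n : nat) (a : 'M[K]_(m, n)) (c : K) : 0 <= c ->
  (forall i j, `|a i j| <= c) -> `|a| <= c.
Proof.
move=> c0 h; rewrite /Num.Def.normr /= mx_normrE; apply/bigmax_leP; split=> // -[i j] _.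
Qed.

Lemma enorm_ge0 (n : nat) (a : 'rV[K]_n) : 0 <= enorm a.
Proof. exact: sqrtr_ge0. Qed.

Lemma sqr_enorm (n : nat) (a : 'rV[K]_n) : enorm a ^+ 2 = dotp a a.
Proof. exact: (sqr_nrm (dotp_semi_inner n)). Qed.

Lemma coord_le_enorm (n : nat) (a : 'rV[K]_n) i : `|a 0 i| <= enorm a.
Proof.
rewrite -ler_sqr ?nnegrE ?normr_ge0 ?enorm_ge0// sqr_enorm.
rewrite real_normK ?num_real// /dotp (bigD1 i)//= -expr2 lerDl.
by apply: sumr_ge0 => j _; rewrite -expr2 sqr_ge0.
Qed.

Lemma norm_le_enorm (n : nat) (a : 'rV[K]_n) : `|a| <= enorm a.
Proof.
apply: norm_leP; first exact: enorm_ge0.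
by move=> i j; rewrite ord1; exact: coord_le_enorm.
Qed.

Lemma enorm_le_norm (n : nat) (a : 'rV[K]_n) : enorm a <= n%:R * `|a|.
Proof.
have h : enorm a <= \sum_(i < n) `|a 0 i|.
  have s0 : 0 <= \sum_(i < n) `|a 0 i| by apply: sumr_ge0.
  rewrite (nrm_leP (dotp_semi_inner n))// expr2 mulr_suml.
  apply: ler_sum => i _; apply: le_trans (ler_norm _) _; rewrite normrM.
  by rewrite ler_wpM2l// (bigD1 i)//= lerDl sumr_ge0.
apply: (le_trans h).
rewrite mulr_natl -[X in _ *+ X]card_ord -sumr_const.
by apply: ler_sum => i _; exact: coord_le_norm.
Qed.

Lemma enorm_eq0 (n : nat) (a : 'rV[K]_n) : enorm a = 0 -> a = 0.
Proof.
move=> a0; apply/eqP; rewrite -normr_le0.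
by apply: le_trans (norm_le_enorm _) _; rewrite a0.
Qed.

Lemma dotp_norm_le (n : nat) (a b : 'rV[K]_n) : `|dotp a b| <= enorm a * enorm b.
Proof. exact: (si_CS (dotp_semi_inner n)). Qed.

Lemma det_norm_le (n : nat) (A : 'M[K]_n) (c : K) :
  (forall i j, `|A i j| <= c) -> `|\det A| <= \sum_(s : {perm 'I_n}) c ^+ n.
Proof.
move=> h; apply: le_trans (ler_norm_sum _ _ _) _; apply: ler_sum => s _.
rewrite normrM normrX normrN1 expr1n mul1r normr_prod.
rewrite -[X in _ ^+ X]card_ord -prodr_const.
by apply: ler_prod => i _; rewrite normr_ge0 h.
Qed.

End Euclid.

(** The sets whose relative complement in A has the property form a filter; if
    A lacked it, that filter would be proper and would cluster at a point of A,
    near which the property holds. *)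
Lemma compact_local (T : topologicalType) (A : set T) (P : set T -> Prop) :
  P set0 -> (forall S S', S `<=` S' -> P S' -> P S) ->
  (forall S S', P S -> P S' -> P (S `|` S')) ->
  (forall x, A x -> exists2 N, nbhs x N & P (A `&` N)) ->
  compact A -> P A.
Proof.
move=> P0 PS PU PN cA; have [//|nPA] := pselect (P A); exfalso.
pose F : set_system T := [set S | P (A `\` S)].
have FF : ProperFilter F.
  apply: Build_ProperFilter.
    by rewrite /F/= setD0.
  split.
  - by rewrite /F/= setDT.
  - by move=> S S' FS FS'; rewrite /F/= setDIr; exact: PU.
  - by move=> S S' SS'; apply: PS; exact: setDS.
have FA : F A by rewrite /F/= setDv.
have [x [Ax cx]] := cA _ FF FA.
have [N Nx PN'] := PN _ Ax.
have FN : F (~` N) by rewrite /F/= setDE setCK.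
by have [y []] := cx _ _ FN Nx.
Qed.

Section Borel.
Context (K : realType) (n : nat).

Lemma borel_open (U : set 'rV[K]_n) : open U -> measurable (U : set (borel K n)).
Proof. by move=> oU; apply: sub_sigma_algebra. Qed.

Lemma borel_closed (U : set 'rV[K]_n) : closed U -> measurable (U : set (borel K n)).
Proof.
move=> cU; rewrite -(setCK U); apply: measurableC; apply: borel_open.
exact: closed_openC.
Qed.

Lemma borel_compact (M : set 'rV[K]_n) : compact M -> measurable (M : set (borel K n)).
Proof. by move=> cM; apply: borel_closed; apply: compact_closed. Qed.

Lemma meas_continuous (M : set 'rV[K]_n) (f : 'rV[K]_n -> K) :
  measurable (M : set (borel K n)) -> {within M, continuous f} -> meas M f.
Proof.
move=> mM /continuousP cf.
rewrite /meas; apply: (measurability _ (RGenOpens.measurableE K)) => _ [_ [a [b ->] <-]].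
have oI : open (f @^-1` `]a, b[ : set (subspace M)) by exact/cf/interval_open.
have [V oV VM] := (open_subspaceP _ _).1 oI.
by rewrite setIC -VM; apply: measurableI => //; exact: borel_open.
Qed.

(** Integrals of nonnegative functions are suprema over the simple functions
    below them, so the comparison holds without measurability. *)
Lemma integral_dom (lam : {measure set (borel K n) -> \bar K})
    (D Q : set (borel K n)) (f g : borel K n -> \bar K) :
  D `<=` Q -> (forall x, D x -> (0 <= f x)%E) -> (forall x, Q x -> (0 <= g x)%E) ->
  (forall x, D x -> (f x <= g x)%E) ->
  (\int[lam]_(x in D) f x <= \int[lam]_(x in Q) g x)%E.
Proof.
move=> DQ f0 g0 fg; rewrite integral_mkcond [leRHS]integral_mkcond.
have p0 (E : set (borel K n)) h : (forall x, E x -> (0 <= h x)%E) ->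
    forall x, (0 <= (h \_ E) x)%E.
  by move=> hE x; rewrite patchE; case: ifPn => // /set_mem/hE.
rewrite !ge0_integralTE; [|exact: p0|exact: p0].
apply: le_ereal_sup => _ [h hf <-]; exists h => // x.
apply: le_trans (hf x) _; rewrite !patchE.
case: ifPn => [/set_mem Dx|_].
  by rewrite mem_set; [exact: fg|exact: DQ].
by case: ifPn => // /set_mem/g0.
Qed.

End Borel.

Section FiniteSurface.
Context (K : realType) (n d : nat) (M : set 'rV[K]_d)
  (sigma : {measure set (borel K d) -> \bar K}).
Hypotheses (hM : compact_manifold n M) (hs : surface_measure n M sigma).

(** Near each point the area formula bounds the measure by that of a box, on
    which the area density is bounded. *)
Lemma surface_local_finite x : M x ->
  exists2 O, nbhs x O & open O /\ (sigma (M `&` O) < +oo)%E.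
Proof.
move=> Mx; have [cM /(_ _ Mx)[W [psi [hp [t [Wt Ht] tx]]]]] := hM.
have [oW dpsi cJ [U [g [oU imU gpsi cg]]]] := hp.
have [lam hlam harea] := hs.
have /cvgrPdist_lt/(_ 1 ltr01) Jt : (fun s => 'J psi s) @ t --> 'J psi t.
  by move: cJ; rewrite continuous_open_subspace// => /(_ t (mem_set Wt)).
have : \forall s \near t, W s /\ `|'J psi t - 'J psi s| < 1.
  by apply: filterI => //; exact: open_nbhs_nbhs.
move=> /nbhs_ballP[r /= r0 hr].
have [V oV VM] : exists2 V, open V &
    V `&` (M `&` U) = g @^-1` (ball t r) `&` (M `&` U).
  apply/open_subspaceP; apply: (continuousP _).1 => //.
  exact: ball_open.
have xMU : (M `&` U) x by rewrite -imU -tx; exists t.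
have gx : g x = t by rewrite -tx gpsi.
have Vx : V x.
  have [] // : (V `&` (M `&` U)) x.
  by rewrite VM; split=> //=; rewrite gx; exact: ballxx.
exists (U `&` V).
  by apply: open_nbhs_nbhs; split; [exact: openI|split=> //; exact: xMU.2].
split; first exact: openI.
pose c := `|'J psi t| + 1.
pose C : K := Num.sqrt (\sum_(s : {perm 'I_n}) (d%:R * c ^+ 2) ^+ n).
pose a : 'rV[K]_n := \row_i (t 0 i - r).
pose b : 'rV[K]_n := \row_i (t 0 i + r).
pose Q : set (borel K n) := [set s | forall i, a 0 i <= s 0 i <= b 0 i].
have ab i : a 0 i <= b 0 i by rewrite !mxE; lra.
have lamQ : lam Q = (\prod_(i < n) (b 0 i - a 0 i))%:E by exact: hlam.
have mQ : measurable Q.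
  apply: borel_closed.
  have -> : Q = \bigcap_(i in setT)
      ((fun s : 'rV[K]_n => s 0 i) @^-1` `[a 0 i, b 0 i]%classic).
    apply/seteqP; split=> s hsQ i.
      by move=> _; have := hsQ i; rewrite /= in_itv.
    by have := hsQ i I; rewrite /= in_itv.
  apply: closed_bigI => i _; apply: preimage_closed; last exact: interval_closed.
  by move=> s _; exact: coord_continuous.
have mA : measurable (M `&` (U `&` V) : set (borel K d)).
  apply: measurableI; first exact: borel_compact.
  by apply: borel_open; exact: openI.
have key s : (W `&` @halfspace K n `&` psi @^-1` (M `&` (U `&` V))) s -> ball t r s.
  move=> [[Ws Hs] [Mp [Up Vp]]].
  have : (V `&` (M `&` U)) (psi s) by [].
  by rewrite VM => -[/=]; rewrite gpsi.
rewrite (harea W psi hp)//; last by rewrite imU setIA => y [].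
apply: (@le_lt_trans _ _ (\int[lam]_(s in Q) C%:E)%E).
  apply: integral_dom => //.
  - move=> s /key [_ bs] i; rewrite !mxE.
    by have := bs 0 i; rewrite /ball/= ltr_distlC => /andP[/ltW -> /ltW ->].
  - by move=> s _; rewrite lee_fin sqrtr_ge0.
  - move=> s /key/hr[Ws hJ]; rewrite lee_fin ler_wsqrtr//.
    apply: le_trans (ler_norm _) _; apply: det_norm_le => i j.
    have hc : `|'J psi s| <= c.
      rewrite -(subrK ('J psi t) ('J psi s)) addrC; apply: le_trans (ler_normD _ _) _.
      by rewrite lerD2l distrC ltW.
    rewrite mxE; apply: le_trans (ler_norm_sum _ _ _) _.
    rewrite mulr_natl -[X in _ *+ X]card_ord -sumr_const; apply: ler_sum => k _.
    rewrite normrM expr2; apply: ler_pM => //.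
    + exact: le_trans (coord_le_norm _ _ _) hc.
    + rewrite mxE; exact: le_trans (coord_le_norm _ _ _) hc.
rewrite integral_cst//= lamQ -EFinM; exact: ltry.
Qed.

Lemma surface_finite : (sigma M < +oo)%E.
Proof.
have [cM _] := hM; have mM := borel_compact cM.
suff : exists2 O, open O & M `<=` O /\ (sigma (M `&` O) < +oo)%E.
  by move=> [ O _ [MO fO]]; rewrite setIidl in fO.
apply: (compact_local (P := fun S => exists2 O, open O &
  S `<=` O /\ (sigma (M `&` O) < +oo)%E)) cM.
- by exists set0; [exact: open0|split=> //; rewrite setI0 measure0].
- by move=> S S' SS' [ O oO [SO fO]]; exists O => //; split=> //; exact: subset_trans SO.
- move=> S S' [ O oO [SO fO]] [ O' oO' [SO' fO']]; exists (O `|` O'); first exact: openU.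
  split; first exact: setUSS.
  have mO := measurableI _ _ mM (borel_open oO).
  have mO' := measurableI _ _ mM (borel_open oO').
  rewrite setIUr; apply: le_lt_trans (measureU2 _ mO mO') _.
  exact: lte_add_pinfty.
- move=> x /surface_local_finite[ O Ox [oO fO]]; exists O => //; exists O => //.
Qed.

End FiniteSurface.

(** * Tangential gradients *)

Lemma diff_eps (K : realType) (n d : nat) (f : 'rV[K]_n -> 'rV[K]_d) (t : 'rV[K]_n) :
  differentiable f t -> forall e : K, 0 < e ->
  \forall s \near t, `|f s - f t - (s - t) *m 'J f t| <= e * `|s - t|.
Proof.
move=> df e e0; have /diff_locallyx/eqaddoEx h := df.
have {}h : (fun h => f (h + t)) = (fun h => f t + 'd f t h) +o_ (0 : 'rV[K]_n) id.
  by apply/funext => y; exact: h.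
have /eqaddoP/(_ e e0) := h.
rewrite (near_shift 0 t) => //=; apply: filterS => s.
by rewrite /= subr0 addrK -deriveEjacobian// deriveE// /GRing.sub_fun/= opprD addrA.
Qed.

Section TangentialGradient.
Context (K : realType) (n d : nat) (M : set 'rV[K]_d).
Implicit Types (D G x w : 'rV[K]_d) (f g : 'rV[K]_d -> K).

Let S0 := @dotp_semi_inner K d.

Lemma enormD (a b : 'rV[K]_d) : enorm (a + b) <= enorm a + enorm b.
Proof. exact: (nrmD S0). Qed.

Lemma enormZ (c : K) (a : 'rV[K]_d) : enorm (c *: a) = `|c| * enorm a.
Proof. exact: (nrmZ S0). Qed.

Lemma enormN (a : 'rV[K]_d) : enorm (- a) = enorm a.
Proof. exact: (nrmN S0). Qed.

Lemma dotpBr (a b c : 'rV[K]_d) : dotp a (b - c) = dotp a b - dotp a c.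
Proof. exact: (siBr S0). Qed.

Lemma dotpDr (a b c : 'rV[K]_d) : dotp a (b + c) = dotp a b + dotp a c.
Proof. exact: (siDr S0). Qed.

Lemma dotpBl (a b c : 'rV[K]_d) : dotp (b - c) a = dotp b a - dotp c a.
Proof. exact: (siBl S0). Qed.

Lemma dotpZr (c : K) (a b : 'rV[K]_d) : dotp a (c *: b) = c * dotp a b.
Proof. exact: (siZr S0). Qed.

Lemma dotp_eq0 (a : 'rV[K]_d) : dotp a a = 0 -> a = 0.
Proof. by move=> a0; apply: enorm_eq0; rewrite /enorm a0 sqrtr0. Qed.

(** Orthogonal to [M] at [x] to first order: two candidate gradients of the
    same function differ by such a vector. *)
Definition flat x D := forall e : K, 0 < e ->
  \forall z \near within M (nbhs x), `|dotp D (z - x)| <= e * enorm (z - x).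

(** A curve of M leaving x with velocity h J stays on M for h pointing into
    the half-space, so a flat vector is orthogonal to its velocity. *)
Lemma flat_orth_inward x D (W : set 'rV[K]_n) (psi : 'rV[K]_n -> 'rV[K]_d)
    (t h : 'rV[K]_n) : param M W psi -> W t -> @halfspace K n t ->
  psi t = x -> flat x D -> (forall i : 'I_n, val i = 0%N -> 0 <= h 0 i) ->
  dotp D (h *m 'J psi t) = 0.
Proof.
move=> [oW dpsi _ [U [g [_ imU _ _]]]] Wt Ht tx fD h0.
have [dt _] := dpsi _ Wt.
set w := h *m _.
pose y (s : K) := s^-1 *: (psi (s *: h + t) - x).
have cy : y s @[s --> 0^'+] --> w.
  apply: cvg_dnbhs_at_right; rewrite /w -deriveEjacobian// /y -tx.
  exact: diff_derivable dt.
have ct : s *: h + t @[s --> 0^'+] --> t.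
  apply: cvg_at_right_filter.
  have -> : nbhs t = nbhs (0 *: h + t) by rewrite scale0r add0r.
  by apply: cvgD; [apply: cvgZr_tmp; exact: cvg_id|exact: cvg_cst].
have cx : psi (s *: h + t) @[s --> 0^'+] --> x.
  by rewrite -tx; apply: continuous_cvg => //; exact: differentiable_continuous.
have inM : \forall s \near 0^'+, M (psi (s *: h + t)).
  have : \forall s \near 0^'+, W (s *: h + t) by apply: ct; exact: open_nbhs_nbhs.
  apply: filterS2 (nbhs_right_gt _) => s s0 Ws.
  suff [] : (M `&` U) (psi (s *: h + t)) by [].
  rewrite -imU; exists (s *: h + t) => //; split=> // i i0.
  rewrite !mxE; apply: addr_ge0; last exact: Ht.
  by apply: mulr_ge0; [exact: ltW|exact: h0].
have main e : 0 < e -> e < 1 -> `|dotp D w| <= e * (enorm D + 1 + enorm w).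
  move=> e0 e1.
  have e0' : 0 < e / (d%:R + 1) by rewrite divr_gt0// ltr_wpDl.
  have h1 : \forall s \near 0^'+, `|w - y s| < e / (d%:R + 1).
    by move/cvgrPdist_lt : cy; apply.
  have h2 : \forall s \near 0^'+,
      `|dotp D (psi (s *: h + t) - x)| <= e * enorm (psi (s *: h + t) - x).
    have /cx := fD _ e0; rewrite near_simpl => h2.
    by apply: filterS2 inM h2 => s Ms; apply.
  near (0:K)^'+ => s.
  have s0 : 0 < s by near: s; exact: nbhs_right_gt.
  have hs1 : enorm (w - y s) <= e.
    apply: le_trans (enorm_le_norm _) _.
    have /ltW : `|w - y s| < e / (d%:R + 1) by near: s.
    rewrite ler_pdivlMr ?ltr_wpDl// mulrC => /(le_trans _); apply.
    by rewrite ler_wpM2r// lerDl.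
  have hs2 : `|dotp D (y s)| <= e * enorm (y s).
    have h3 : `|dotp D (psi (s *: h + t) - x)| <= e * enorm (psi (s *: h + t) - x).
      by near: s.
    rewrite /y dotpZr normrM enormZ mulrCA.
    by rewrite ler_wpM2l.
  have -> : w = (w - y s) + y s by rewrite subrK.
  rewrite dotpDr subrK; apply: le_trans (ler_normD _ _) _.
  have t1 : `|dotp D (w - y s)| <= enorm D * e.
    by apply: le_trans (dotp_norm_le _ _) _; rewrite ler_wpM2l// enorm_ge0.
  have t2 : enorm (y s) <= enorm w + e.
    rewrite -(subrK w (y s)) addrC; apply: le_trans (enormD _ _) _.
    by rewrite lerD2l -opprB enormN.
  have t3 := ler_wpM2l (ltW e0) t2.
  have := ler_wpM2l (ltW e0) (ltW e1).
  move: (enorm_ge0 D) (enorm_ge0 w) => ? ?; nra.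
apply/eqP; rewrite -normr_le0; apply/ler_addgt0Pr => e e0; rewrite add0r.
pose c := enorm D + 1 + enorm w.
have c1 : 1 <= c by rewrite /c; have := enorm_ge0 D; have := enorm_ge0 w; lra.
have c0 : 0 < c by lra.
pose e' := Num.min (e / c) 2^-1.
have e'0 : 0 < e' by rewrite lt_min divr_gt0//=.
have e'1 : e' < 1 by rewrite gt_min; apply/orP; right; lra.
apply: le_trans (main _ e'0 e'1) _; rewrite -/c.
by rewrite -ler_pdivlMr// ge_min lexx.
Unshelve. all: by end_near. Qed.

Lemma flat_orth x D (W : set 'rV[K]_n) (psi : 'rV[K]_n -> 'rV[K]_d)
    (t h : 'rV[K]_n) : param M W psi -> W t -> @halfspace K n t ->
  psi t = x -> flat x D -> dotp D (h *m 'J psi t) = 0.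
Proof.
move=> hp Wt Ht tx fD.
have inw h' := flat_orth_inward hp Wt Ht tx fD (h := h').
(* the half-space constrains one coordinate only, so h or - h points inward *)
have [h0|h0] := pselect (forall i : 'I_n, val i = 0%N -> 0 <= h 0 i).
  exact: inw.
have : dotp D (- h *m 'J psi t) = 0.
  apply: inw => i i0; rewrite mxE oppr_ge0; apply: contrapT => /negP.
  rewrite -ltNge => hi; apply: h0 => j j0.
  by rewrite (_ : j = i) ?ltW//; apply: val_inj; rewrite /= j0 i0.
by rewrite mulNmx -scaleN1r dotpZr mulN1r => /eqP; rewrite oppr_eq0 => /eqP.
Qed.

(** Conversely, the range of the differential approximates M to first order: by
    [row_free] the parameter moves at most proportionally to the point, so the
    error of the differential is small relative to the move of the point. *)
Lemma orth_flat x D (W : set 'rV[K]_n) (psi : 'rV[K]_n -> 'rV[K]_d)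
    (t : 'rV[K]_n) : param M W psi -> W t -> @halfspace K n t ->
  psi t = x -> (forall h, dotp D (h *m 'J psi t) = 0) -> flat x D.
Proof.
move=> [oW dpsi _ [U [g [oU imU gpsi cg]]]] Wt Ht tx oD e e0.
have [dt /row_freeP[B JB]] := dpsi _ Wt.
have xMU : (M `&` U) x by rewrite -imU -tx; exists t.
have gx : g x = t by rewrite -tx gpsi.
pose k : K := d%:R * `|B| + 1.
have k0 : 0 < k by rewrite /k ltr_wpDl// mulr_ge0.
have Bk (h : 'rV[K]_n) : `|h| <= k * `|h *m 'J psi t|.
  rewrite -[X in `|X| <= _]mulmx1 -JB mulmxA; apply: norm_leP.
    by rewrite mulr_ge0// ltW.
  move=> i j; rewrite mxE; apply: le_trans (ler_norm_sum _ _ _) _.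
  apply: (@le_trans _ _ (\sum_(l < d) `|h *m 'J psi t| * `|B|)).
    by apply: ler_sum => l _; rewrite normrM ler_pM// coord_le_norm.
  rewrite sumr_const card_ord -mulr_natl /k.
  have := normr_ge0 (h *m 'J psi t); have := normr_ge0 B; nra.
pose c : K := enorm D * d%:R * 2 * k + 1.
have c0 : 0 < c.
  by rewrite /c ltr_wpDl// !mulr_ge0// ?enorm_ge0// ltW.
pose e1 := Num.min (e / c) (2 * k)^-1.
have e10 : 0 < e1 by rewrite lt_min divr_gt0//= invr_gt0 mulr_gt0.
have e1k : k * e1 <= 2^-1.
  have : e1 <= (2 * k)^-1 by rewrite ge_min lexx orbT.
  by rewrite -(ler_pM2l k0) invfM mulrCA divff ?mulr1// gt_eqF.
have e1c : c * e1 <= e.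
  by rewrite mulrC -ler_pdivlMr// ge_min lexx.
have hd := diff_eps dt e10.
have cgx : g z @[z --> within (M `&` U) (nbhs x)] --> t.
  by rewrite -gx; exact: (subspace_continuousP _ _).1.
have nU : \forall z \near x, U z by apply: open_nbhs_nbhs; split=> //; exact: xMU.2.
have hz : nbhs x [set z | (M `&` U) z ->
    `|psi (g z) - psi t - (g z - t) *m 'J psi t| <= e1 * `|g z - t|].
  exact: cgx _ hd.
apply: filterS2 nU hz => z Uz hz Mz.
have {}hz := hz (conj Mz Uz).
have [s [Ws Hs] sz] : (psi @` (W `&` @halfspace K n)) z by rewrite imU.
have gz : psi (g z) = z by rewrite -sz gpsi.
move: hz; rewrite gz tx; set r := _ - _ *m _ => hr.
have zr : z - x = r + (g z - t) *m 'J psi t by rewrite /r subrK.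
have gt : `|g z - t| <= 2 * k * `|z - x|.
  have h1 := Bk (g z - t).
  have h2 : `|(g z - t) *m 'J psi t| <= `|z - x| + e1 * `|g z - t|.
    have -> : (g z - t) *m 'J psi t = (z - x) - r by rewrite zr [RHS]addrC addKr.
    by apply: le_trans (ler_normB _ _) _; rewrite lerD2l.
  have h3 := ler_wpM2l (ltW k0) h2.
  have h4 := ler_wpM2r (normr_ge0 (g z - t)) e1k.
  lra.
rewrite zr dotpDr oD addr0 -zr; apply: le_trans (dotp_norm_le _ _) _.
have t1 : enorm r <= d%:R * (e1 * (2 * k * enorm (z - x))).
  apply: le_trans (enorm_le_norm _) _; rewrite ler_wpM2l//.
  apply: le_trans hr _; apply: ler_wpM2l; first exact: ltW.
  apply: le_trans gt _.
  by rewrite ler_wpM2l ?norm_le_enorm// mulr_ge0// ltW.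
apply: le_trans (ler_wpM2l (enorm_ge0 D) t1) _.
apply: (@le_trans _ _ ((c * e1) * enorm (z - x))); last first.
  by rewrite ler_wpM2r// enorm_ge0.
have := mulr_ge0 (ltW e10) (enorm_ge0 (z - x)); rewrite /c; nra.
Qed.

Lemma flatB x G G' f : is_tgrad n M f x G -> is_tgrad n M f x G' -> flat x (G - G').
Proof.
move=> [_ hG] [_ hG'] e e0; have e2 : 0 < e / 2 by rewrite divr_gt0.
apply: filterS2 (hG _ e2) (hG' _ e2) => z h h'.
rewrite dotpBl.
have -> : dotp G (z - x) - dotp G' (z - x) =
  (f z - f x - dotp G' (z - x)) - (f z - f x - dotp G (z - x)) by ring.
apply: le_trans (ler_normB _ _) _; lra.
Qed.

(** The difference of two gradients is both tangent and flat, so it is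
    orthogonal to itself. *)
Lemma is_tgrad_unique x G G' f : is_tgrad n M f x G -> is_tgrad n M f x G' -> G = G'.
Proof.
move=> hG hG'; have fG := flatB hG hG'.
have tang w : tangent n M x w -> dotp (G - G') w = 0.
  move=> [W [psi [t [hp Wt Ht tx /submxP[a ->]]]]].
  exact: (flat_orth a hp Wt Ht tx fG).
apply/eqP; rewrite -subr_eq0; apply/eqP; apply: dotp_eq0.
by rewrite dotpBr (tang _ hG.1) (tang _ hG'.1) subrr.
Qed.

(** The part of a tangent vector orthogonal to the range of another
    parametrization is flat, hence orthogonal to the vector, hence zero. *)
Lemma tangent_param x w (W : set 'rV[K]_n) (psi : 'rV[K]_n -> 'rV[K]_d)
    (t : 'rV[K]_n) : tangent n M x w -> param M W psi -> W t ->
  @halfspace K n t -> psi t = x -> (w <= 'J psi t)%MS.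
Proof.
move=> [W1 [psi1 [t1 [hp1 Wt1 Ht1 tx1 /submxP[a wa]]]]] hp Wt Ht tx.
set J := 'J psi t.
have rJ : row_free J by have [_ h _ _] := hp; exact: (h _ Wt).2.
have dotm (u : 'rV[K]_d) (h : 'rV[K]_n) : dotp u (h *m J) = (u *m J^T *m h^T) 0 0.
  rewrite -mulmxA -trmx_mul mxE; apply: eq_bigr => i _.
  by rewrite [(_^T) _ _]mxE.
have uG : J *m J^T \in unitmx.
  rewrite -row_free_unit; apply: inj_row_free => v vJ.
  have v0 : v *m J = 0.
    by apply: dotp_eq0; rewrite dotm -(mulmxA v) vJ mul0mx mxE.
  have /row_freeP[C JC] := rJ.
  by rewrite -(mulmx1 v) -JC mulmxA v0 mul0mx.
(* the orthogonal projection of w onto the range of J *)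
pose p := w *m J^T *m invmx (J *m J^T) *m J.
have oq h : dotp (w - p) (h *m J) = 0.
  rewrite dotm; have -> : (w - p) *m J^T = 0.
    by rewrite mulmxBl /p -!mulmxA mulVmx// mulmx1 subrr.
  by rewrite mul0mx mxE.
have fq := orth_flat hp Wt Ht tx oq.
have q0 : w - p = 0.
  have e1 : dotp (w - p) p = 0 by exact: oq.
  have e2 : dotp (w - p) w = 0.
    by rewrite [X in dotp _ X]wa; exact: (flat_orth a hp1 Wt1 Ht1 tx1 fq).
  by apply: dotp_eq0; rewrite dotpBr e1 e2 subr0.
have pJ : (p <= J)%MS by exact: submxMl.
by move/eqP: q0; rewrite subr_eq0 => /eqP ->.
Qed.

Lemma tangentZD x w w' (a : K) : tangent n M x w -> tangent n M x w' ->
  tangent n M x (a *: w + w').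
Proof.
move=> tw [W [psi [t [hp Wt Ht tx w'J]]]]; exists W, psi, t; split=> //.
by apply: addmx_sub => //; apply: scalemx_sub; exact: tangent_param tw hp Wt Ht tx.
Qed.

Lemma is_tgradZD x f g G G' (a : K) : is_tgrad n M f x G -> is_tgrad n M g x G' ->
  is_tgrad n M (a *: f + g) x (a *: G + G').
Proof.
move=> [tG hG] [tG' hG']; split; first exact: tangentZD.
move=> e e0; have a1 : 0 < `|a| + 1 by rewrite ltr_wpDl.
have e1 : 0 < e / 2 / (`|a| + 1) by rewrite !divr_gt0.
have e2 : 0 < e / 2 by rewrite divr_gt0.
apply: filterS2 (hG _ e1) (hG' _ e2) => z h h'.
have -> : (a *: f + g) z - (a *: f + g) x - dotp (a *: G + G') (z - x) =
    a * (f z - f x - dotp G (z - x)) + (g z - g x - dotp G' (z - x)).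
  rewrite (siZDl S0)//; have -> : (a *: f + g) z = a * f z + g z by [].
  have -> : (a *: f + g) x = a * f x + g x by [].
  by ring.
apply: le_trans (ler_normD _ _) _; rewrite normrM.
have h1 : `|a| * `|f z - f x - dotp G (z - x)| <= e / 2 * enorm (z - x).
  apply: le_trans (ler_wpM2l (normr_ge0 a) h) _.
  rewrite mulrA ler_wpM2r ?enorm_ge0// mulrA ler_pdivrMr// mulrC.
  by rewrite ler_wpM2l ?(ltW e2)// lerDl.
lra.
Qed.

Lemma is_tgrad_tgrad x f : tdifferentiable n M f x ->
  is_tgrad n M f x (tgrad n M f x).
Proof. by move=> [G hG]; apply: xgetPex; exists G. Qed.

Lemma tgrad_eq x f G : is_tgrad n M f x G -> tgrad n M f x = G.
Proof.
move=> hG; have ex : tdifferentiable n M f x by exists G.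
exact: is_tgrad_unique (is_tgrad_tgrad ex) hG.
Qed.

Lemma tgradZD x f g (a : K) : tdifferentiable n M f x -> tdifferentiable n M g x ->
  tdifferentiable n M (a *: f + g) x /\
  tgrad n M (a *: f + g) x = a *: tgrad n M f x + tgrad n M g x.
Proof.
move=> /is_tgrad_tgrad hf /is_tgrad_tgrad hg.
have h := is_tgradZD a hf hg.
by split; [eexists; exact: h|exact: tgrad_eq].
Qed.

Lemma is_tgrad0 x : compact_manifold n M -> M x -> is_tgrad n M 0 x 0.
Proof.
move=> [_ hM] Mx; have [W [psi [hp [t [Wt Ht] tx]]]] := hM _ Mx; split.
  by exists W, psi, t; split=> //; exact: sub0mx.
move=> e e0; apply: nearW => z.
have -> : dotp 0 (z - x) = 0 :> K by exact: (si0l S0).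
have -> : (0 : 'rV[K]_d -> K) z - (0 : 'rV[K]_d -> K) x = 0 by exact: subrr.
by rewrite subr0 normr0 mulr_ge0 ?enorm_ge0// (ltW e0).
Qed.

Lemma tdifferentiable_continuous f : (forall x, M x -> tdifferentiable n M f x) ->
  {within M, continuous f}.
Proof.
move=> hf; apply/subspace_continuousP => x Mx.
have [G [_ hG]] := hf _ Mx; apply/cvgrPdist_le => e e0.
have c0 : 0 < enorm G + 1 by rewrite ltr_wpDl ?enorm_ge0.
pose c := d%:R + 1 : K.
have c1 : 0 < c by rewrite ltr_wpDl.
have r0 : 0 < e / (enorm G + 1) / c by rewrite !divr_gt0.
have nb : \forall z \near within M (nbhs x), `|z - x| < e / (enorm G + 1) / c.
  have /nbhs_normP nb : exists2 r : K, 0 < r & ball_ Num.Def.normr x r `<=`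
      [set z | `|z - x| < e / (enorm G + 1) / c].
    by exists (e / (enorm G + 1) / c) => // z /=; rewrite distrC.
  exact: (@filterS _ (nbhs x) _ _ _ (fun z h _ => h) nb).
apply: filterS2 (hG _ ltr01) nb => z h h'.
have ez : enorm (z - x) * (enorm G + 1) <= e.
  rewrite -ler_pdivlMr//; apply: le_trans (enorm_le_norm _) _.
  move: h'; rewrite ltr_pdivlMr// mulrC => /ltW/(le_trans _); apply.
  by rewrite ler_wpM2r// lerDl.
have h2 := dotp_norm_le G (z - x).
rewrite distrC -[X in `|X|](subrK (dotp G (z - x))).
apply: le_trans (ler_normD _ _) _; lra.
Qed.

End TangentialGradient.

(** * H^1_0 as a Hilbert space *)

Lemma si_complete_scaled (K : realType) (X : lmodType K) (D : set X)
    (f : X -> X -> K) (c : K) (u : nat -> X) :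
  semi_inner D f -> si_complete D f -> (forall k, D (u k)) ->
  (forall k, f (u k.+1 - u k) (u k.+1 - u k) <= c * 8^-1 ^+ k) ->
  exists2 l, D l & (fun k => nrm f (u k - l)) @ \oo --> (0 : K).
Proof.
move=> S Dc Du hu; pose s := Num.sqrt (`|c| + 1).
have s0 : 0 < s by rewrite sqrtr_gt0 ltr_wpDl.
have s2 : s ^+ 2 = `|c| + 1 by rewrite sqr_sqrtr// addr_ge0.
have [k|k|l Dl hl] := @Dc (fun k => s^-1 *: u k).
- exact: (siZ S).
- rewrite -scalerBr (siZl S) ?(siZr S)//; try by [apply: (siB S)|apply: (siZ S); apply: (siB S)].
  rewrite mulrA -expr2 (exprVn s) s2 mulrC ler_pdivrMr ?ltr_wpDl//.
  apply: le_trans (hu k) _; rewrite mulrC ler_wpM2l ?exprn_ge0//.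
  by have := ler_norm c; lra.
exists (s *: l); first exact: (siZ S).
have -> : (fun k => nrm f (u k - s *: l)) = (fun k => s * nrm f (s^-1 *: u k - l)).
  apply/funext => k; rewrite -[X in X * _]gtr0_norm// -(nrmZ S); last first.
    by apply: (siB S) => //; exact: (siZ S).
  by rewrite scalerBr scalerA divff ?scale1r// gt_eqF.
by rewrite -(mulr0 s); apply: cvgMr.
Qed.

Lemma cvg_sum0 (K : realType) (I : Type) (r : seq I) (F : I -> nat -> K) :
  (forall i, F i @ \oo --> (0 : K)) -> (fun k => \sum_(i <- r) F i k) @ \oo --> (0 : K).
Proof.
move=> h; elim: r => [|i r IH].
  by under eq_fun do rewrite big_nil; exact: cvg_cst.
under eq_fun do rewrite big_cons.
have -> : nbhs (0 : K) = nbhs (0 + 0 : K) by rewrite addr0.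
exact: cvgD.
Qed.

Lemma continuous_bounded (K : realType) (T : topologicalType) (M : set T)
    (f : T -> K) : compact M -> {within M, continuous f} ->
  exists2 c : K, 0 <= c & forall x, M x -> `|f x| <= c.
Proof.
move=> cM cf; have [c [_ hc]] := compact_bounded (continuous_compact cf cM).
exists (`|c| + 1); first by rewrite addr_ge0.
move=> x Mx; apply: hc; last by exists x.
by have := ler_norm c; lra.
Qed.

Section BoundedL2.
Context (K : realType) (n : nat) (M : set 'rV[K]_n)
  (sigma : {measure set (borel K n) -> \bar K}).
Hypotheses (mM : measurable (M : set (borel K n))) (fM : (sigma M < +oo)%E).
Implicit Types f g h : 'rV[K]_n -> K.

Lemma bounded_integrable f (c : K) : meas M f -> (forall x, M x -> `|f x| <= c) ->
  sigma.-integrable M (fun x => (f x)%:E).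
Proof.
move=> mf fc; apply/integrableP; split; first exact: emeas.
apply: (@le_lt_trans _ _ (\int[sigma]_(x in M) `|c|%:E)%E).
  apply: ge0_le_integral => //.
  - by apply: measurableT_comp => //; exact: emeas.
  - by move=> x Mx; rewrite lee_fin; apply: le_trans (fc _ Mx) _; exact: ler_norm.
rewrite integral_cst//=; apply: lte_mul_pinfty => //.
Qed.

Lemma bounded_inL2 f (c : K) : meas M f -> (forall x, M x -> `|f x| <= c) ->
  inL2 M sigma f.
Proof.
move=> mf fc; split=> //.
apply: (@bounded_integrable (fun x => f x ^+ 2) (c ^+ 2)); first exact: meas_sqr.
move=> x Mx; rewrite normrX; have := fc _ Mx; have := normr_ge0 (f x) => *.
by rewrite ler_sqr ?nnegrE//; lra.
Qed.

Lemma continuous_inL2 f : compact M -> {within M, continuous f} -> inL2 M sigma f.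
Proof.
move=> cM cf; have [c _ hc] := continuous_bounded cM cf.
by apply: bounded_inL2 hc; exact: meas_continuous.
Qed.

End BoundedL2.

Section H10.
Context (K : realType) (n d : nat) (M : set 'rV[K]_d)
  (sigma : {measure set (borel K d) -> \bar K}).
Hypotheses (hM : compact_manifold n M) (hs : surface_measure n M sigma).
Implicit Types u v w : fungrad K d.

Let mM : measurable (M : set (borel K d)) := borel_compact hM.1.
Let fM := surface_finite hM hs.
Let SL := L2_semi_inner sigma mM.

(** The ambient space in which H^1_0 is a closure: a function and a vector
    field, unrelated to each other. *)
Definition pairL2 : set (fungrad K d) :=
  [set u : fungrad K d | inL2 M sigma u.1 /\
    forall j, inL2 M sigma (fun x => u.2 x 0 j)].

Lemma dotH10E u v : pairL2 u -> pairL2 v ->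
  dotH10 M sigma u v =
    \sum_(j < d) dotL2 M sigma (fun x => u.2 x 0 j) (fun x => v.2 x 0 j).
Proof.
move=> [_ Lu] [_ Lv]; rewrite /dotH10 /Rintegral.
rewrite [X in fine X](_ : _ = (\sum_(j < d) (dotL2 M sigma (fun x => u.2 x 0 j)
   (fun x => v.2 x 0 j))%:E)%E); first by rewrite sumEFin.
rewrite (eq_bigr _ (fun j _ => dotL2E mM (Lu j) (Lv j))).
rewrite -(@integral_sum _ _ _ sigma M mM _
  (fun j x => (u.2 x 0 j * v.2 x 0 j)%:E)); last first.
  by move=> j; exact: inL2_mul.
by apply: eq_integral => x _; rewrite sumEFin.
Qed.

Lemma pairL2_integrable u v : pairL2 u -> pairL2 v ->
  sigma.-integrable M (fun x => (dotp (u.2 x) (v.2 x))%:E).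
Proof.
move=> [_ Lu] [_ Lv].
have -> : (fun x => (dotp (u.2 x) (v.2 x))%:E) =
    (fun x => \sum_(j < d) (u.2 x 0 j * v.2 x 0 j)%:E)%E.
  by apply/funext => x; rewrite sumEFin.
by apply: integrable_sum => // j _; exact: inL2_mul.
Qed.

Definition h1ip u v : K := dotL2 M sigma u.1 v.1 + dotH10 M sigma u v.

Lemma pairL2ZD (a : K) u v : pairL2 u -> pairL2 v -> pairL2 (a *: u + v).
Proof.
move=> [Lu Lu2] [Lv Lv2]; split; first exact: (siZD SL a Lu Lv).
move=> j; apply: eq_inL2 (siZD SL a (Lu2 j) (Lv2 j)) => // x _.
by rewrite !mxE.
Qed.

Lemma dotH10_semi_inner : semi_inner pairL2 (dotH10 M sigma).
Proof.
split.
- by split; [exact: (si0 SL)|move=> j; apply: eq_inL2 (si0 SL) => // x _; rewrite mxE].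
- exact: pairL2ZD.
- move=> u v Du Dv; rewrite !dotH10E//; apply: eq_bigr => j _.
  exact: (siC SL (Du.2 j) (Dv.2 j)).
- move=> a u v w Du Dv Dw; have Duv := pairL2ZD a Du Dv.
  rewrite !dotH10E// mulr_sumr -big_split/=; apply: eq_bigr => j _.
  rewrite -(siZDl SL a (Du.2 j) (Dv.2 j) (Dw.2 j)).
  by apply: eq_dotL2 => // x _; rewrite !mxE.
- move=> u Du; rewrite dotH10E//; apply: sumr_ge0 => j _.
  exact: (si_ge0 SL (Du.2 j)).
Qed.

Let SG := dotH10_semi_inner.

Lemma h1ip_semi_inner : semi_inner pairL2 h1ip.
Proof.
split; [exact: (si0 SG)|exact: pairL2ZD|..].
- move=> u v Du Dv; rewrite /h1ip (siC SG Du Dv).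
  by rewrite (siC SL Du.1 Dv.1).
- move=> a u v w Du Dv Dw; rewrite /h1ip (siZDl SG)//.
  by rewrite (siZDl SL a Du.1 Dv.1 Dw.1); ring.
- by move=> u Du; rewrite addr_ge0 ?(si_ge0 SG)// (si_ge0 SL Du.1).
Qed.

Let SH := h1ip_semi_inner.

Lemma dotL2_le_h1ip u : pairL2 u -> dotL2 M sigma u.1 u.1 <= h1ip u u.
Proof. by move=> Du; rewrite lerDl (si_ge0 SG). Qed.

Lemma dotH10_le_h1ip u : pairL2 u -> dotH10 M sigma u u <= h1ip u u.
Proof. by move=> Du; rewrite lerDr; exact: (si_ge0 SL Du.1). Qed.

Lemma pairL2_complete : si_complete pairL2 h1ip.
Proof.
move=> u Du hu.
have Dd k : pairL2 (u k.+1 - u k) by exact: (siB SH).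
have [l1 Ll1 hl1] := @L2_complete _ _ _ _ mM (fun k => (u k).1)
  (fun k => (Du k).1) (fun k => le_trans (dotL2_le_h1ip (Dd k)) (hu k)).
have hc j : exists l, inL2 M sigma l /\
    (fun k => nrm (dotL2 M sigma) ((fun x => (u k).2 x 0 j) - l)) @ \oo --> (0 : K).
  pose w k x := (u k).2 x 0 j.
  have hw k : dotL2 M sigma (w k.+1 - w k) (w k.+1 - w k) <= 8^-1 ^+ k.
    apply: le_trans (hu k); apply: le_trans (dotH10_le_h1ip (Dd k)).
    rewrite dotH10E// (bigD1 j)//=.
    rewrite [leLHS](_ : _ = dotL2 M sigma (fun x => (u k.+1 - u k).2 x 0 j)
     (fun x => (u k.+1 - u k).2 x 0 j)).
      by rewrite lerDl; apply: sumr_ge0 => i _; exact: (si_ge0 SL ((Dd k).2 i)).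
    by apply: eq_dotL2 => x _; rewrite !mxE.
  have [l Ll hl] := @L2_complete _ _ _ _ mM w (fun k => (Du k).2 j) hw.
  by exists l.
have [l2 {}hc] := choice hc.
pose l : fungrad K d := (l1, fun x => \row_j l2 j x).
have Dl : pairL2 l.
  split=> // j; apply: (@eq_inL2 _ _ _ _ mM (l2 j)); last exact: (hc j).1.
  by move=> x _; rewrite mxE.
exists l => //.
have Dul k : pairL2 (u k - l) by exact: (siB SH).
have -> : (fun k => nrm h1ip (u k - l)) = (fun k => Num.sqrt (
   nrm (dotL2 M sigma) ((u k).1 - l1) ^+ 2 + \sum_(j < d)
   nrm (dotL2 M sigma) ((fun x => (u k).2 x 0 j) - l2 j) ^+ 2)).
  apply/funext => k; rewrite /nrm /h1ip dotH10E//; congr Num.sqrt; congr (_ + _).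
    by rewrite sqr_sqrtr//; exact: (si_ge0 SL (Dul k).1).
  apply: eq_bigr => j _; rewrite sqr_sqrtr; last first.
    by apply: (si_ge0 SL); apply: (siB SL); [exact: (Du k).2|exact: (hc j).1].
  by apply: eq_dotL2 => x _; rewrite !mxE.
rewrite -[X in _ --> X]sqrtr0; apply: continuous_cvg; first exact: sqrt_continuous.
have -> : nbhs (0 : K) = nbhs (0 + 0 : K) by rewrite addr0.
apply: cvgD.
  by rewrite -(mulr0 0); exact: (cvgM hl1 hl1).
apply: cvg_sum0 => j.
by rewrite -(mulr0 0); exact: (cvgM (hc j).2 (hc j).2).
Qed.

Definition test_pair (phi : 'rV[K]_d -> K) : fungrad K d := (phi, tgrad n M phi).

Lemma test_pairL2 phi : testfun n M phi -> pairL2 (test_pair phi).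
Proof.
move=> [dphi cphi _]; split.
  exact: (continuous_inL2 mM fM hM.1 (tdifferentiable_continuous dphi)).
move=> j; apply: (continuous_inL2 mM fM hM.1).
move=> x; apply: (continuous_comp (f := tgrad n M phi : subspace M -> _)
  (g := fun a : 'rV[K]_d => a 0 j)); first exact: cphi.
exact: coord_continuous.
Qed.

Lemma testfunZD (a : K) phi psi : testfun n M phi -> testfun n M psi ->
  testfun n M (a *: phi + psi) /\ forall x, M x ->
    tgrad n M (a *: phi + psi) x = a *: tgrad n M phi x + tgrad n M psi x.
Proof.
move=> [dphi cphi [A [cA AM Aphi]]] [dpsi cpsi [B [cB BM Bpsi]]].
have h x (Mx : M x) := tgradZD a (dphi _ Mx) (dpsi _ Mx).
split; last by move=> x /h[].
split; first by move=> x /h[].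
- apply: (@subspace_eq_continuous _ _ _
    (fun x => a *: tgrad n M phi x + tgrad n M psi x)).
    by move=> x; rewrite inE => /h[_ /esym].
  by move=> x; apply: cvgD; [apply: cvgZl_tmp; exact: cphi|exact: cpsi].
- exists (A `|` B); split; first exact: compactU.
    by move=> x [/AM|/BM].
  move=> x Mx nAB; have -> : (a *: phi + psi) x = a * phi x + psi x by [].
  rewrite Aphi ?Bpsi ?mulr0 ?addr0// => hx; apply: nAB; first by right.
  by left.
Qed.

(** The two pairs agree on [M] only, since the gradient is linear only there. *)
Lemma test_pairZD (a : K) phi psi u v : testfun n M phi -> testfun n M psi ->
  pairL2 u -> pairL2 v ->
  nrm h1ip (a *: u + v - test_pair (a *: phi + psi)) =
  nrm h1ip (a *: (u - test_pair phi) + (v - test_pair psi)).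
Proof.
move=> tphi tpsi Du Dv; have [t1 t2] := testfunZD a tphi tpsi.
have D1 := test_pairL2 tphi; have D2 := test_pairL2 tpsi; have D3 := test_pairL2 t1.
have e1 x : (a *: u + v - test_pair (a *: phi + psi)).1 x =
    (a *: (u - test_pair phi) + (v - test_pair psi)).1 x.
  change (a * u.1 x + v.1 x - (a * phi x + psi x) =
    a * (u.1 x - phi x) + (v.1 x - psi x)); ring.
have e2 x : M x -> (a *: u + v - test_pair (a *: phi + psi)).2 x =
    (a *: (u - test_pair phi) + (v - test_pair psi)).2 x.
  move=> Mx; change (a *: u.2 x + v.2 x - tgrad n M (a *: phi + psi) x =
    a *: (u.2 x - tgrad n M phi x) + (v.2 x - tgrad n M psi x)).
  by rewrite (t2 _ Mx) scalerBr opprD addrACA.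
rewrite /nrm /h1ip; congr (Num.sqrt (_ + _)); first by apply: eq_dotL2 => x _; exact: e1.
by apply: eq_Rintegral => x; rewrite inE => Mx; rewrite e2.
Qed.

(** The two sequential limits that define H^1_0 amount to approximation in the
    single norm of [h1ip]. *)
Lemma H10_closureP u : H10 n M sigma u <-> pairL2 u /\
  forall e : K, 0 < e -> exists2 phi, testfun n M phi &
    nrm h1ip (u - test_pair phi) < e.
Proof.
have E1 phi : pairL2 u -> testfun n M phi ->
    (\int[sigma]_(x in M) ((u.1 x - phi x) ^+ 2)%:E =
     (dotL2 M sigma (u - test_pair phi).1 (u - test_pair phi).1)%:E)%E.
  move=> Du /test_pairL2 Dp; rewrite dotL2_sqrE//.
  exact: (siB SH Du Dp).1.
have E2 phi : pairL2 u -> testfun n M phi ->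
    (\int[sigma]_(x in M) (enorm (u.2 x - tgrad n M phi x) ^+ 2)%:E =
     (dotH10 M sigma (u - test_pair phi) (u - test_pair phi))%:E)%E.
  move=> Du /test_pairL2 Dp; have Dup := siB SH Du Dp.
  rewrite /dotH10 /Rintegral fineK; last first.
    by apply: integrable_fin_num => //; exact: pairL2_integrable.
  by apply: eq_integral => x _; rewrite sqr_enorm.
split=> [[Lu1 Lu2 [phi tphi [+ +]]]|[Du hu]].
  have Du : pairL2 u by [].
  rewrite (funext (fun k => E1 _ Du (tphi k))) (funext (fun k => E2 _ Du (tphi k))).
  move=> /fine_cvgP[_ c1] /fine_cvgP[_ c2]; split=> // e e0.
  have e2 : 0 < e ^+ 2 / 2 by rewrite divr_gt0// exprn_gt0.
  move/cvgr0Pnorm_lt : c1 => /(_ _ e2) c1; move/cvgr0Pnorm_lt : c2 => /(_ _ e2) c2.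
  have [k [h1 h2]] := filter_ex (filterI c1 c2).
  exists (phi k) => //; have Dup := siB SH Du (test_pairL2 (tphi k)).
  rewrite -ltr_sqr ?nnegrE ?nrm_ge0 ?ltW//.
  rewrite (sqr_nrm SH)// /h1ip.
  have := ler_norm (dotL2 M sigma (u - test_pair (phi k)).1 (u - test_pair (phi k)).1).
  have := ler_norm (dotH10 M sigma (u - test_pair (phi k)) (u - test_pair (phi k))).
  move: h1 h2 => /=; lra.
have h k : exists phi, testfun n M phi /\ nrm h1ip (u - test_pair phi) < 2^-1 ^+ k.
  by have [|phi ? ?] := hu (2^-1 ^+ k); [rewrite exprn_gt0|exists phi].
have [phi {}h] := choice h.
have Dup k : pairL2 (u - test_pair (phi k)).
  by apply: (siB SH) => //; apply: test_pairL2; exact: (h k).1.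
have hle k : h1ip (u - test_pair (phi k)) (u - test_pair (phi k)) <= 2^-1 ^+ k.
  rewrite -(sqr_nrm SH)// expr2; have := (h k).2; have := nrm_ge0 h1ip (u - test_pair (phi k)).
  have : (2^-1 : K) ^+ k <= 1 by rewrite exprn_ile1//; lra.
  nra.
have c0 : (fun k => (2^-1 : K) ^+ k) @ \oo --> (0 : K).
  by apply: cvg_expr; rewrite ger0_norm//; lra.
split; [exact: Du.1|exact: Du.2|exists phi; first by move=> k; exact: (h k).1].
split.
  have -> : (fun k => \int[sigma]_(x in M) ((u.1 x - phi k x) ^+ 2)%:E)%E =
      (fun k => (dotL2 M sigma (u - test_pair (phi k)).1 (u - test_pair (phi k)).1)%:E).
    by apply/funext => k; apply: E1 => //; exact: (h k).1.
  apply/fine_cvgP; split; first exact: nearW.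
  apply: squeeze_cvgr (cvg_cst 0) c0; apply: nearW => k /=.
  apply/andP; split; first exact: (si_ge0 SL (Dup k).1).
  exact: le_trans (dotL2_le_h1ip (Dup k)) (hle k).
have -> : (fun k => \int[sigma]_(x in M) (enorm (u.2 x - tgrad n M (phi k) x) ^+ 2)%:E)%E =
    (fun k => (dotH10 M sigma (u - test_pair (phi k)) (u - test_pair (phi k)))%:E).
  by apply/funext => k; apply: E2 => //; exact: (h k).1.
apply/fine_cvgP; split; first exact: nearW.
apply: squeeze_cvgr (cvg_cst 0) c0; apply: nearW => k /=.
apply/andP; split; first exact: (si_ge0 SG (Dup k)).
exact: le_trans (dotH10_le_h1ip (Dup k)) (hle k).
Qed.

Lemma testfun0 : testfun n M 0 /\ forall x, M x -> tgrad n M 0 x = 0.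
Proof.
have h x : M x -> is_tgrad n M 0 x 0 by exact: is_tgrad0.
split; last by move=> x /h; exact: tgrad_eq.
split; first by move=> x /h ?; exists 0.
- apply: (@subspace_eq_continuous _ _ _ (fun=> (0 : 'rV[K]_d))).
    by move=> x; rewrite inE => /h/tgrad_eq/esym.
  by move=> x; exact: cvg_cst.
- by exists set0; split=> //; exact: compact0.
Qed.

Lemma H10_pairL2 u : H10 n M sigma u -> pairL2 u.
Proof. by move=> /H10_closureP[]. Qed.

Lemma H10ZD (a : K) u v : H10 n M sigma u -> H10 n M sigma v ->
  H10 n M sigma (a *: u + v).
Proof.
move=> /H10_closureP[Du hu] /H10_closureP[Dv hv]; apply/H10_closureP.
split; first exact: pairL2ZD.
move=> e e0; have a1 : 0 < `|a| + 1 by rewrite ltr_wpDl.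
have [|phi tphi hphi] := hu (e / 2 / (`|a| + 1)); first by rewrite !divr_gt0.
have [|psi tpsi hpsi] := hv (e / 2); first by rewrite divr_gt0.
exists (a *: phi + psi); first exact: (testfunZD a tphi tpsi).1.
rewrite test_pairZD//.
have D1 : pairL2 (u - test_pair phi) by apply: (siB SH) => //; exact: test_pairL2.
have D2 : pairL2 (v - test_pair psi) by apply: (siB SH) => //; exact: test_pairL2.
apply: le_lt_trans (nrmD SH (siZ SH a D1) D2) _.
rewrite (nrmZ SH)//; move: hphi; rewrite ltr_pdivlMr// => hphi.
have : `|a| * nrm h1ip (u - test_pair phi) <=
    nrm h1ip (u - test_pair phi) * (`|a| + 1).
  by rewrite mulrC ler_wpM2l ?nrm_ge0// lerDl.
move: hphi hpsi; move: (nrm _ (u - _)) (nrm _ (v - _)) => A1 A2; lra.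
Qed.

Lemma H100 : H10 n M sigma 0.
Proof.
have [t0 g0] := testfun0; have Dt := test_pairL2 t0.
apply/H10_closureP; split; first exact: (si0 SH).
move=> e e0; exists 0 => //.
have -> : nrm h1ip (0 - test_pair 0) = nrm h1ip 0; last by rewrite (nrm0 SH).
rewrite /nrm /h1ip; congr (Num.sqrt (_ + _)).
  by apply: eq_dotL2 => x _; exact: subr0.
apply: eq_Rintegral => x; rewrite inE => Mx.
have -> : (0 - test_pair 0).2 x = 0; last by [].
change (0 - tgrad n M 0 x = 0); by rewrite g0// subr0.
Qed.

Lemma H10_semi_inner : semi_inner (H10 n M sigma) (dotH10 M sigma).
Proof.
have DH := H10_pairL2.
split; [exact: H100|exact: H10ZD|..].
- by move=> u v /DH Du /DH Dv; exact: (siC SG).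
- by move=> a u v w /DH Du /DH Dv /DH Dw; exact: (siZDl SG).
- by move=> u /DH Du; exact: (si_ge0 SG).
Qed.

Lemma H10_closed (u : nat -> fungrad K d) l : (forall k, H10 n M sigma (u k)) ->
  pairL2 l -> (fun k => nrm h1ip (u k - l)) @ \oo --> (0 : K) -> H10 n M sigma l.
Proof.
move=> Hu Dl hl; apply/H10_closureP; split=> // e e0.
have e2 : 0 < e / 2 by rewrite divr_gt0.
move/cvgr0Pnorm_lt : hl => /(_ _ e2)/filter_ex[k hk].
have [Du /(_ _ e2)[phi tphi hphi]] := (H10_closureP (u k)).1 (Hu k).
exists phi => //; have Dt := test_pairL2 tphi.
rewrite -(subrK (u k) l) -addrA.
apply: le_lt_trans (nrmD SH _ _) _; try by apply: (siB SH).
rewrite (nrm_sym SH)//; move: hk; rewrite ger0_norm ?nrm_ge0//.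
by move: hphi; move: (nrm _ _) (nrm _ _) => A1 A2; lra.
Qed.

Hypothesis hP : poincare n M sigma.

Lemma poincareP : exists2 c : K, 0 < c & forall u, H10 n M sigma u ->
  nrm h1ip u <= c * nrm (dotH10 M sigma) u.
Proof.
have [c hc] := hP; exists (`|c| + 1); first by rewrite ltr_wpDl.
move=> u Hu; have Du := H10_pairL2 Hu.
have -> : nrm h1ip u = normH1 M sigma u.
  rewrite /normH1 /normL2 /normH10 !sqr_sqrtr//; first exact: (si_ge0 SG).
  exact: (si_ge0 SL Du.1).
apply: le_trans (hc _ Hu) _; apply: ler_wpM2r; first exact: nrm_ge0.
by have := ler_norm c; lra.
Qed.

(** Poincare's inequality upgrades a Cauchy sequence for the gradient norm to
    one for [h1ip], whose limit stays in the closure. *)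
Lemma H10_complete : si_complete (H10 n M sigma) (dotH10 M sigma).
Proof.
have [c c0 hc] := poincareP; have S := H10_semi_inner.
move=> u Hu hu.
have Du k := H10_pairL2 (Hu k).
have [k|l Dl hl] := @si_complete_scaled _ _ _ _ (c ^+ 2) u SH pairL2_complete Du.
  have Hd := siB S (Hu k.+1) (Hu k); have Dd := H10_pairL2 Hd.
  rewrite -(sqr_nrm SH)//; apply: (@le_trans _ _ ((c * nrm (dotH10 M sigma) (u k.+1 - u k)) ^+ 2)).
    by rewrite lerXn2r ?nnegrE ?nrm_ge0 ?mulr_ge0 ?nrm_ge0 ?(ltW c0)// hc.
  by rewrite exprMn (sqr_nrm SG)// ler_wpM2l ?sqr_ge0.
exists l; first exact: H10_closed hl.
apply: squeeze_cvgr (cvg_cst 0) hl; apply: nearW => k; rewrite nrm_ge0/=.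
rewrite /nrm ler_wsqrtr//; apply: dotH10_le_h1ip; exact: (siB SH).
Qed.

Lemma H10_L2_le : exists2 c : K, 0 < c & forall u, H10 n M sigma u ->
  nrm (dotL2 M sigma) u.1 <= c * nrm (dotH10 M sigma) u.
Proof.
have [c c0 hc] := poincareP; exists c => // u Hu.
apply: le_trans (hc _ Hu); rewrite /nrm ler_wsqrtr//.
exact: dotL2_le_h1ip (H10_pairL2 Hu).
Qed.

Lemma eqH10_dot u v w : H10 n M sigma u -> H10 n M sigma v -> H10 n M sigma w ->
  eqH10 M sigma u v -> dotH10 M sigma u w = dotH10 M sigma v w.
Proof.
move=> /H10_pairL2 Du /H10_pairL2 Dv /H10_pairL2 Dw e; rewrite !dotH10E//.
apply: eq_bigr => j _; apply: (eqL2_dot mM (Du.2 j) (Dv.2 j) (Dw.2 j)).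
by apply: ae_imp e => x h Mx; have [_ ->] := h Mx.
Qed.

End H10.

(** * Integral operators with continuous kernels *)

Section Tube.
Context (K : realType).

(** The tube lemma: compactness of [M] makes the continuity in the first
    variable uniform in the second. *)
Lemma continuous_tube (T1 T2 : topologicalType) (A : set T1) (M : set T2)
    (G : T1 * T2 -> K) (t0 : T1) (e : K) : compact M ->
  {within A `*` M, continuous G} -> A t0 -> 0 < e ->
  \forall t \near within A (nbhs t0), forall y, M y -> `|G (t, y) - G (t0, y)| <= e.
Proof.
move=> cM /subspace_continuousP cG At0 e0.
have e2 : 0 < e / 2 by rewrite divr_gt0.
apply: ((near_covering_withinP M).2 ((compact_near_coveringP M).1 cM) _
  (within A (nbhs t0)) (fun t y => `|G (t, y) - G (t0, y)| <= e)) => y0 My0.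
have /cvgrPdist_lt/(_ _ e2)[[U N] [/= Ut0 Ny0] UN] := cG (t0, y0) (conj At0 My0).
exists (N, [set t | U t /\ A t]).
  by split=> //=; apply: (@filterS _ (nbhs t0) _ U).
move=> [y t] [/= Ny [Ut At]] My.
have h1 := UN (t, y) (conj Ut Ny) (conj At My).
have h2 := UN (t0, y) (conj (nbhs_singleton Ut0) Ny) (conj At0 My).
rewrite -(subrK (G (t0, y0)) (G (t, y))) -addrA; apply: le_trans (ler_normD _ _) _.
rewrite distrC [leRHS](splitr e); apply: lerD; exact: ltW.
Qed.

Lemma continuous_slice (T1 T2 : topologicalType) (A : set T1) (M : set T2)
    (G : T1 * T2 -> K) (t0 : T1) : {within A `*` M, continuous G} -> A t0 ->
  {within M, continuous (fun y => G (t0, y))}.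
Proof.
move=> /subspace_continuousP cG At0; apply/subspace_continuousP => y0 My0.
apply/cvgrPdist_lt => e e0.
have /cvgrPdist_lt/(_ _ e0)[[U N] [/= Ut0 Ny0] UN] := cG (t0, y0) (conj At0 My0).
apply: (@filterS _ (nbhs y0) _ N) => // y Ny My.
exact: UN (t0, y) (conj (nbhs_singleton Ut0) Ny) (conj At0 My).
Qed.

End Tube.

Section Kernels.
Context (K : realType) (d : nat) (V M : set 'rV[K]_d).
Hypotheses (cV : compact V) (cM : compact M).
Implicit Types k : 'rV[K]_d -> 'rV[K]_d -> K.

(** What the integral operators need of a kernel on the compact set V x M:
    continuous slices, moving continuously in sup norm.  For a continuous
    kernel both follow from compactness, and the property is stable under the
    pointwise operations that produce difference quotients. *)
Definition admissible k := (forall x, V x -> {within M, continuous (k x)}) /\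
  forall x0 (e : K), V x0 -> 0 < e ->
    \forall x \near within V (nbhs x0), forall y, M y -> `|k x y - k x0 y| <= e.

Lemma adm_bounded k : admissible k ->
  exists2 c : K, 0 <= c & forall x y, V x -> M y -> `|k x y| <= c.
Proof.
move=> [ck uk].
suff [c hc] : exists c : K, forall x y, V x -> M y -> `|k x y| <= c.
  by exists `|c| => // x y Vx My; apply: le_trans (hc x y Vx My) _; exact: ler_norm.
pose P (S : set 'rV[K]_d) := exists c : K, forall x y, (V `&` S) x -> M y -> `|k x y| <= c.
have : P V.
  apply: (compact_local (P := P)) cV.
  - by exists 0 => x y [].
  - move=> S S' SS' [c hc]; exists c => x y [Vx Sx]; apply: hc; split=> //.
    exact: SS'.
  - move=> S S' [c hc] [c' hc']; exists (Num.max c c') => x y [Vx [Sx|Sx]] My.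
      by rewrite le_max hc.
    by rewrite le_max hc' ?orbT.
  - move=> x0 Vx0; have h := uk x0 1 Vx0 ltr01.
    have [c c0 hc] := continuous_bounded cM (ck _ Vx0).
    exists [set x | V x -> forall y, M y -> `|k x y - k x0 y| <= 1] => //.
    exists (1 + c) => x y [Vx [_ /(_ Vx) hx]] My.
    rewrite -(subrK (k x0 y) (k x y)); apply: le_trans (ler_normD _ _) _.
    by apply: lerD; [exact: hx|exact: hc].
by move=> [c hc]; exists c => x y Vx; exact: hc.
Qed.

Lemma admZD (a : K) k k' : admissible k -> admissible k' -> admissible (fun x y => a * k x y + k' x y).
Proof.
move=> [ck uk] [ck' uk']; split.
  move=> x Vx y; apply: cvgD; last exact: ck'.
  by apply: cvgMr; exact: ck.
move=> x0 e Vx0 e0; have e2 : 0 < e / 2 by rewrite divr_gt0.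
have a1 : 0 < `|a| + 1 by rewrite ltr_wpDl.
have e1 : 0 < e / 2 / (`|a| + 1) by rewrite !divr_gt0.
apply: filterS2 (uk _ _ Vx0 e1) (uk' _ _ Vx0 e2) => x h h' y My.
have -> : a * k x y + k' x y - (a * k x0 y + k' x0 y) =
  a * (k x y - k x0 y) + (k' x y - k' x0 y) by ring.
rewrite [leRHS](splitr e); apply: le_trans (ler_normD _ _) (lerD _ (h' _ My)).
rewrite normrM; have := h _ My; rewrite ler_pdivlMr// mulrC; apply: le_trans.
by rewrite ler_wpM2r// lerDl.
Qed.

Lemma adm0 : admissible (fun _ _ => 0).
Proof.
split=> [x _ y|x0 e _ e0]; first exact: cvg_cst.
by apply: nearW => x y _; rewrite subr0 normr0 ltW.
Qed.

Lemma adm_sum (I : Type) (s : seq I) (k : I -> 'rV[K]_d -> 'rV[K]_d -> K) :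
  (forall i, admissible (k i)) -> admissible (fun x y => \sum_(i <- s) k i x y).
Proof.
move=> h; elim: s => [|i s IH].
  rewrite (_ : (fun _ => _) = fun _ _ => 0); first exact: adm0.
  by apply/funext => x; apply/funext => y; rewrite big_nil.
rewrite (_ : (fun _ => _) = fun x y => 1 * k i x y + \sum_(i <- s) k i x y).
  exact: admZD.
by apply/funext => x; apply/funext => y; rewrite big_cons mul1r.
Qed.

Lemma admM (a : K) k : admissible k -> admissible (fun x y => a * k x y).
Proof.
move=> hk; have := admZD a hk adm0.
by under eq_fun do under eq_fun do rewrite addr0.
Qed.

(** The tube lemma, over M for the slices and then over V for the uniformity
    in the parameter. *)
Lemma adm_slice (T : topologicalType) (A : set T)
    (H : T -> 'rV[K]_d -> 'rV[K]_d -> K) (t0 : T) :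
  {within A `*` V `*` M, continuous (fun z : T * 'rV[K]_d * 'rV[K]_d =>
     H z.1.1 z.1.2 z.2)} -> A t0 ->
  admissible (H t0) /\ forall e : K, 0 < e -> \forall t \near within A (nbhs t0),
    forall x y, V x -> M y -> `|H t x y - H t0 x y| <= e.
Proof.
move=> cH At0; split.
  split=> [x Vx|x0 e Vx0 e0].
    exact: (continuous_slice (t0 := (t0, x)) cH (conj At0 Vx)).
  have [[U N] [/= Ut0 Nx0] UN] := continuous_tube cM cH (conj At0 Vx0 : (A `*` V) (t0, x0)) e0.
  apply: (@filterS _ (nbhs x0) _ N) => // x Nx Vx y My.
  by apply: (UN (t0, x)) => //; split=> //; exact: nbhs_singleton.
move=> e e0; have e2 : 0 < e / 2 by rewrite divr_gt0.
have := ((near_covering_withinP V).2 ((compact_near_coveringP V).1 cV) _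
  (within A (nbhs t0)) (fun t x => forall y, M y -> `|H t x y - H t0 x y| <= e)).
move=> /(_ _) h.
have {}h : \forall t \near within A (nbhs t0), V `<=`
    (fun x => forall y, M y -> `|H t x y - H t0 x y| <= e).
  apply: h => x0 Vx0.
  have [[U N] [/= Ut0 Nx0] UN] := continuous_tube cM cH (conj At0 Vx0 : (A `*` V) (t0, x0)) e2.
  exists (N, [set t | U t /\ A t]).
    by split=> //=; apply: (@filterS _ (nbhs t0) _ U).
  move=> [x t] [/= Nx [Ut At]] Vx y My.
  have h1 := UN (t, x) (conj Ut Nx) (conj At Vx) y My.
  have h2 := UN (t0, x) (conj (nbhs_singleton Ut0) Nx) (conj At0 Vx) y My.
  rewrite -(subrK (H t0 x0 y) (H t x y)) -addrA; apply: le_trans (ler_normD _ _) _.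
  by rewrite [X in _ + X]distrC [leRHS](splitr e); apply: lerD.
by apply: filterS h => t h x y Vx; exact: h.
Qed.

End Kernels.

Section IntegralOperators.
Context (K : realType) (nR nV d : nat) (M V : set 'rV[K]_d)
  (sigma sigma' : {measure set (borel K d) -> \bar K}).
Hypotheses (hM : compact_manifold nR M) (hV : compact_manifold nV V)
  (hs : surface_measure nR M sigma) (hs' : surface_measure nV V sigma')
  (hP : poincare nR M sigma).
Implicit Types (k : 'rV[K]_d -> 'rV[K]_d -> K) (u v : fungrad K d).

Let mM : measurable (M : set (borel K d)) := borel_compact hM.1.
Let mV : measurable (V : set (borel K d)) := borel_compact hV.1.
Let fM := surface_finite hM hs.
Let fV := surface_finite hV hs'.
Let SL := L2_semi_inner sigma mM.
Let SV := L2_semi_inner sigma' mV.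
Let S := H10_semi_inner hM hs.
Local Notation D := (H10 nR M sigma).
Local Notation nD := (nrm (dotH10 M sigma)).
Local Notation nL := (nrm (dotL2 sigma)).
Local Notation nY := (nrm (dotL2 V sigma')).
Local Notation admissible := (admissible V M).

(** A bound on V only costs a factor in L^2, because V has finite measure. *)
Lemma sup_L2_le : exists2 s : K, 0 < s & forall (f : 'rV[K]_d -> K) (c : K),
  inL2 V sigma' f -> 0 <= c -> (forall x, V x -> `|f x| <= c) -> nY f <= s * c.
Proof.
pose a := fine (sigma' V).
have a0 : 0 <= a by apply: fine_ge0; exact: measure_ge0.
exists (Num.sqrt a + 1); first by rewrite ltr_wpDl// sqrtr_ge0.
move=> f c Lf c0 hf.
have s0 := sqrtr_ge0 a.
apply: (@le_trans _ _ (Num.sqrt a * c)); last by rewrite ler_wpM2r// lerDl.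
rewrite (nrm_leP SV)// ?mulr_ge0// exprMn sqr_sqrtr//.
rewrite -lee_fin (dotL2_sqrE mV)//.
apply: (@le_trans _ _ (\int[sigma']_(x in V) (c ^+ 2)%:E)%E).
  apply: ge0_le_integral => //.
  - by move=> x _; rewrite lee_fin sqr_ge0.
  - exact: measurable_int Lf.2.
  - by move=> x Vx; rewrite lee_fin -real_normK ?num_real// ler_sqr ?nnegrE// hf.
by rewrite integral_cst//= (EFinM a) /a fineK ?ge0_fin_numE// muleC.
Qed.

Lemma slice_inL2 k x : admissible k -> V x -> inL2 M sigma (k x).
Proof. by move=> [ck _] Vx; apply: continuous_inL2 (ck _ Vx) => //; exact: hM.1. Qed.

Lemma intop_dot k u x : intop M sigma k u x = dotL2 M sigma (k x) u.1.
Proof. by []. Qed.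

(** By Cauchy-Schwarz and Poincare, a kernel slice acts on H^1_0 with norm
    at most a constant times its sup norm. *)
Lemma slice_le : exists2 a : K, 0 < a & forall (g : 'rV[K]_d -> K) (c : K) u,
  inL2 M sigma g -> 0 <= c -> (forall y, M y -> `|g y| <= c) -> D u ->
  `|dotL2 M sigma g u.1| <= a * c * nD u.
Proof.
have [cP cP0 hcP] := H10_L2_le hM hs hP.
pose b := fine (sigma M).
have b0 : 0 <= b by apply: fine_ge0; exact: measure_ge0.
have s0 := sqrtr_ge0 b.
exists ((Num.sqrt b + 1) * cP); first by rewrite mulr_gt0// ltr_wpDl.
move=> g c u Lg c0 hg Du.
have ng : nrm (dotL2 M sigma) g <= Num.sqrt b * c.
  rewrite (nrm_leP SL)// ?mulr_ge0// exprMn sqr_sqrtr//.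
  rewrite -lee_fin (dotL2_sqrE mM)//.
  apply: (@le_trans _ _ (\int[sigma]_(x in M) (c ^+ 2)%:E)%E).
    apply: ge0_le_integral => //.
    - by move=> x _; rewrite lee_fin sqr_ge0.
    - exact: measurable_int Lg.2.
    - by move=> x Vx; rewrite lee_fin -real_normK ?num_real// ler_sqr ?nnegrE// hg.
  by rewrite integral_cst//= (EFinM b) /b fineK ?ge0_fin_numE// muleC.
have Lu := (H10_pairL2 hM hs Du).1.
apply: le_trans (si_CS SL Lg Lu) _.
have -> : (Num.sqrt b + 1) * cP * c * nD u = ((Num.sqrt b + 1) * c) * (cP * nD u) by ring.
apply: ler_pM; rewrite ?nrm_ge0//; last exact: hcP.
by apply: le_trans ng _; rewrite ler_wpM2r// lerDl.
Qed.

Lemma slice_functional k x : admissible k -> V x ->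
  bounded_functional D (dotH10 M sigma) (fun u => intop M sigma k u x).
Proof.
move=> ak Vx; have Lk := slice_inL2 ak Vx.
have DL u : D u -> inL2 M sigma u.1 by move=> /(H10_pairL2 hM hs)[].
split.
  move=> a u v /DL Lu /DL Lv; rewrite !intop_dot.
  have LD := siZD SL a Lu Lv.
  by rewrite (siC SL Lk LD) (siZDl SL a Lu Lv Lk) (siC SL Lu Lk) (siC SL Lv Lk).
have [a a0 ha] := slice_le; have [c c0 hc] := adm_bounded hV.1 hM.1 ak.
exists (a * c) => u Du; apply: ha => //; by move=> y My; exact: hc.
Qed.

Lemma intop_continuous k u : admissible k -> D u -> {within V, continuous (intop M sigma k u)}.
Proof.
move=> ak Du; apply/subspace_continuousP => x0 Vx0; apply/cvgrPdist_le => e e0.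
have [a a0 ha] := slice_le.
have c0 : 0 < a * nD u + 1 by rewrite ltr_wpDl// mulr_ge0 ?nrm_ge0// ltW.
have e1 : 0 < e / (a * nD u + 1) by rewrite divr_gt0.
have Lu := (H10_pairL2 hM hs Du).1.
have h := ak.2 x0 _ Vx0 e1.
apply: (@filterS _ (nbhs x0) _ [set x | V x -> forall y, M y ->
  `|k x y - k x0 y| <= e / (a * nD u + 1)]) h => x hx Vx; rewrite distrC.
change (`|dotL2 M sigma (k x) u.1 - dotL2 M sigma (k x0) u.1| <= e).
have Lk := slice_inL2 ak Vx; have Lk0 := slice_inL2 ak Vx0.
have LB := siB SL Lk Lk0.
rewrite -(siBl SL Lk Lk0 Lu).
apply: le_trans (ha _ _ _ LB (ltW e1) (hx Vx) Du) _.
rewrite mulrAC mulrA ler_pdivrMr// mulrC ler_wpM2l ?(ltW e0)//.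
by rewrite lerDl.
Qed.

(** Extended by 0 outside V, so that it depends linearly on [u] as a function on
    the whole space, and not only up to equality on V. *)
Definition opA k u : 'rV[K]_d -> K := (intop M sigma k u) \_ V.

Lemma opAE k u x : V x -> opA k u x = intop M sigma k u x.
Proof. by move=> Vx; rewrite /opA patchE mem_set. Qed.

Lemma opA_out k u x : ~ V x -> opA k u x = 0.
Proof. by move=> nVx; rewrite /opA patchE memNset. Qed.

Lemma opA_inL2 k u : admissible k -> D u -> inL2 V sigma' (opA k u).
Proof.
move=> ak Du; apply: (@eq_inL2 _ _ _ _ mV (intop M sigma k u)).
  by move=> x Vx; rewrite opAE.
exact: (continuous_inL2 mV fV hV.1 (intop_continuous ak Du)).
Qed.

Lemma opA_linear k : admissible k -> linear_on D (inL2 V sigma') (opA k).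
Proof.
move=> ak; split=> [u|a u v Du Dv]; first exact: opA_inL2.
apply/funext => x; have [Vx|nVx] := pselect (V x).
  change (opA k (a *: u + v) x = a * opA k u x + opA k v x).
  by rewrite !opAE//; exact: ((slice_functional ak Vx).1 a u v Du Dv).
change (opA k (a *: u + v) x = a * opA k u x + opA k v x).
by rewrite !opA_out// mulr0 addr0.
Qed.

Lemma opA_kernelB k k' u : admissible k -> admissible k' -> D u ->
  opA (fun x y => k x y - k' x y) u = opA k u - opA k' u.
Proof.
move=> ak ak' Du; have Lu := (H10_pairL2 hM hs Du).1.
apply/funext => x; change (opA (fun x y => k x y - k' x y) u x = opA k u x - opA k' u x).
have [Vx|nVx] := pselect (V x); last by rewrite !opA_out// subr0.
rewrite !opAE// !intop_dot.
by rewrite -(siBl SL (slice_inL2 ak Vx) (slice_inL2 ak' Vx) Lu).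
Qed.

Lemma opA_kernelZ (a : K) k u : admissible k -> D u ->
  opA (fun x y => a * k x y) u = a *: opA k u.
Proof.
move=> ak Du; have Lu := (H10_pairL2 hM hs Du).1.
apply/funext => x; change (opA (fun x y => a * k x y) u x = a * opA k u x).
have [Vx|nVx] := pselect (V x); last by rewrite !opA_out// mulr0.
by rewrite !opAE// !intop_dot -(siZl SL a (slice_inL2 ak Vx) Lu).
Qed.

Lemma opA_bound : exists2 b : K, 0 < b & forall k (c : K), admissible k -> 0 <= c ->
  (forall x y, V x -> M y -> `|k x y| <= c) ->
  forall u, D u -> nY (opA k u) <= b * c * nD u.
Proof.
have [a a0 ha] := slice_le; have [s s0 hs2] := sup_L2_le.
exists (s * a); first by rewrite mulr_gt0.
move=> k c ak c0 hc u Du; rewrite -!mulrA; apply: hs2.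
- exact: opA_inL2.
- by rewrite !mulr_ge0 ?nrm_ge0// ltW.
move=> x Vx; rewrite opAE// intop_dot mulrA; apply: ha => //; first exact: slice_inL2.
by move=> y My; exact: hc.
Qed.

(** Bessel's inequality for the functionals u |-> (A u)(x), integrated over V. *)
Lemma opA_hs : exists2 b : K, 0 < b & forall k (c : K), admissible k -> 0 <= c ->
  (forall x y, V x -> M y -> `|k x y| <= c) ->
  hs_bounded D (dotH10 M sigma) (dotL2 V sigma') (opA k) (b * c ^+ 2).
Proof.
have [a a0 ha] := slice_le.
pose b := fine (sigma' V).
have b0 : 0 <= b by apply: fine_ge0; exact: measure_ge0.
exists (a ^+ 2 * b + 1); first by rewrite ltr_wpDl// mulr_ge0 ?sqr_ge0.
move=> k c ak c0 hc s e us De he.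
have bessel x : V x -> \sum_(l <- s) opA k (e l) x ^+ 2 <= (a * c) ^+ 2.
  (* w represents L on the span of the family; L is tested on w itself *)
  move=> Vx; pose L u := intop M sigma k u x.
  have [LZD _] := slice_functional ak Vx.
  have hL u : D u -> `|L u| <= a * c * nD u.
    move=> Du; apply: ha => //; first exact: slice_inL2.
    by move=> y My; exact: hc.
  pose w := \sum_(l <- s) L (e l) *: e l.
  pose T := \sum_(l <- s) L (e l) ^+ 2.
  have -> : \sum_(l <- s) opA k (e l) x ^+ 2 = T.
    by apply: eq_bigr => l _; rewrite opAE.
  have Dle l : l \in s -> D (L (e l) *: e l) by move=> /De; exact: (siZ S).
  have Dw : D w by apply: (si_sum S) => l ls _; exact: Dle.
  have L0 : L 0 = 0.
    have := LZD 1 0 0 (si0 S) (si0 S); rewrite scaler0 addr0 mul1r -/(L 0).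
    by move=> /eqP; rewrite -subr_eq subrr eq_sym => /eqP.
  have Lw : L w = T.
    rewrite /w /T; elim: (s) De => [|l r IH] Dr; first by rewrite !big_nil.
    have Dr' l' : l' \in r -> D (e l') by move=> l'r; apply: Dr; rewrite inE l'r orbT.
    rewrite !big_cons /L LZD -/(L _); first by rewrite -/(L _) IH// expr2.
      by apply: Dr; rewrite mem_head.
    by apply: (si_sum S) => l' l'r _; apply: (siZ S); exact: Dr'.
  have nw : nD w ^+ 2 = T.
    rewrite (sqr_nrm S)// {1}/w (si_suml S)//; apply: eq_big_seq => l ls.
    have Dl := De _ ls.
    rewrite (siZl S)// /w (si_sumr S)// (bigD1_seq l)//= big1_seq ?addr0.
      by rewrite (siZr S)// he// eqxx mulr1 expr2.
    move=> l' /andP[ll' l's]; have Dl' := De _ l's.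
    by rewrite (siZr S)// he// eq_sym (negbTE ll') mulr0.
  have T0 : 0 <= T by rewrite -nw sqr_ge0.
  have ac0 : 0 <= a * c by rewrite mulr_ge0// ltW.
  have := le_trans (ler_norm _) (hL w Dw); rewrite Lw -nw expr2.
  have [h0|h0] := eqVneq (nD w) 0; first by move=> _; rewrite h0 mul0r sqr_ge0.
  have n0 : 0 < nD w by rewrite lt_neqAle eq_sym h0 nrm_ge0.
  rewrite ler_pM2r// => h; rewrite -expr2 ler_sqr ?nnegrE// nrm_ge0//.
have Lo l : l \in s -> inL2 V sigma' (opA k (e l)) by move=> /De; exact: opA_inL2.
(* the exchange of sum and integral wants measurability at every index *)
pose e' l := if l \in s then e l else 0.
have De' l : D (e' l) by rewrite /e'; case: ifPn => [/De//|_]; exact: si0 S.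
have -> : \sum_(l <- s) dotL2 V sigma' (opA k (e l)) (opA k (e l)) =
    \sum_(l <- s) dotL2 V sigma' (opA k (e' l)) (opA k (e' l)).
  by apply: eq_big_seq => l ls; rewrite /e' ls.
have {}bessel x : V x -> \sum_(l <- s) opA k (e' l) x ^+ 2 <= (a * c) ^+ 2.
  move=> /bessel; rewrite [X in X <= _ -> _](_ : _ = \sum_(l <- s) opA k (e' l) x ^+ 2)//.
  by apply: eq_big_seq => l ls; rewrite /e' ls.
rewrite -lee_fin -sumEFin.
rewrite (eq_bigr _ (fun l _ => dotL2_sqrE mV (opA_inL2 ak (De' l)))).
rewrite -(@ge0_integral_sum _ _ _ sigma' V mV _
  (fun l x => (opA k (e' l) x ^+ 2)%:E)); last first.
- by move=> l x _; rewrite lee_fin sqr_ge0.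
- by move=> l; exact: measurable_int (opA_inL2 ak (De' l)).2.
apply: (@le_trans _ _ (\int[sigma']_(x in V) ((a * c) ^+ 2)%:E)%E).
  apply: ge0_le_integral => //.
  - by move=> x _; apply: sume_ge0 => l _; rewrite lee_fin sqr_ge0.
  - apply: emeasurable_sum => l; exact: measurable_int (opA_inL2 ak (De' l)).2.
  - by move=> x Vx; rewrite sumEFin lee_fin; exact: bessel.
rewrite integral_cst//= -(@fineK _ (sigma' V)); last by rewrite ge0_fin_numE.
rewrite -/b -EFinM lee_fin exprMn mulrDl mul1r mulrAC lerDl.
exact: sqr_ge0.
Qed.

Definition unif_cvg (F : set_system nat) (f : nat -> 'rV[K]_d -> K) f0 :=
  forall e : K, 0 < e -> \forall j \near F, forall x, V x -> `|f j x - f0 x| <= e.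

(** The functions A u_j are equicontinuous, so on the compact V the pointwise
    convergence coming from the weak convergence of u_j is uniform. *)
Lemma intop_unif_cvg (F : set_system nat) (k : nat -> 'rV[K]_d -> 'rV[K]_d -> K) k0
    (u : nat -> fungrad K d) u0 (c : K) : Filter F ->
  (forall j, admissible (k j)) -> admissible k0 ->
  (forall e : K, 0 < e -> \forall j \near F,
     forall x y, V x -> M y -> `|k j x y - k0 x y| <= e) ->
  (forall j, D (u j)) -> D u0 -> (forall j, nD (u j) <= c) ->
  (forall L, bounded_functional D (dotH10 M sigma) L ->
     (fun j => L (u j)) @ F --> L u0) ->
  unif_cvg F (fun j => opA (k j) (u j)) (opA k0 u0).
Proof.
move=> FF ak ak0 hk Du Du0 uc hw e e0.
have [a a0 ha] := slice_le.
pose C := a * (`|c| + nD u0 + 1).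
have C0 : 0 < C by rewrite mulr_gt0// ltr_wpDl// addr_ge0 ?nrm_ge0.
have Lu j := (H10_pairL2 hM hs (Du j)).1.
have Lu0 := (H10_pairL2 hM hs Du0).1.
have small g (e' : K) v : inL2 M sigma g -> 0 <= e' -> D v ->
    (forall y, M y -> `|g y| <= e' / C) -> nD v <= `|c| + nD u0 + 1 ->
    `|dotL2 M sigma g v.1| <= e'.
  move=> Lg e'0 Dv hg hv; have eC0 : 0 <= e' / C by rewrite divr_ge0// ltW.
  apply: le_trans (ha _ _ _ Lg eC0 hg Dv) _.
  have -> : a * (e' / C) * nD v = e' / C * (a * nD v) by ring.
  rewrite -mulrA ler_piMr// mulrC ler_pdivrMr// mul1r.
  by rewrite ler_wpM2l// ltW.
have nu j : nD (u j) <= `|c| + nD u0 + 1.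
  by apply: le_trans (uc j) _; have := ler_norm c; have := nrm_ge0 (dotH10 M sigma) u0;
    move: (nD u0) => A1; lra.
have nu0 : nD u0 <= `|c| + nD u0 + 1.
  by have := normr_ge0 c; move: (nD u0) => A1; lra.
have e4 : 0 < e / 4 by rewrite divr_gt0.
have eC : 0 < e / 4 / C by rewrite divr_gt0.
suff h : \forall j \near F, V `<=` (fun x =>
    `|intop M sigma k0 (u j) x - intop M sigma k0 u0 x| <= e / 4 + (e / 4 + e / 4)).
  apply: filterS2 h (hk _ eC) => j h1 h2 x Vx; rewrite !opAE//.
  rewrite -(subrK (intop M sigma k0 (u j) x) (intop M sigma (k j) (u j) x)) -addrA.
  apply: le_trans (ler_normD _ _) _.
  have -> : e = e / 4 + (e / 4 + (e / 4 + e / 4)) by field.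
  apply: lerD; last exact: h1.
  have Lk := slice_inL2 (ak j) Vx; have Lk0 := slice_inL2 ak0 Vx.
  rewrite !intop_dot -(siBl SL Lk Lk0 (Lu j)).
  apply: small => //; [exact: (siB SL Lk Lk0)|exact: ltW|].
  by move=> y My; exact: h2.
apply: ((near_covering_withinP V).2 ((compact_near_coveringP V).1 hV.1) _ F
  (fun j x => `|intop M sigma k0 (u j) x - intop M sigma k0 u0 x|
     <= e / 4 + (e / 4 + e / 4))) => x0 Vx0.
have /cvgrPdist_le/(_ _ e4) hp := hw _ (slice_functional ak0 Vx0).
exists ([set x | V x -> forall y, M y -> `|k0 x y - k0 x0 y| <= e / 4 / C],
  [set j | `|intop M sigma k0 u0 x0 - intop M sigma k0 (u j) x0| <= e / 4]).
  by split=> //=; exact: ak0.2.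
move=> [x j] [/= hx hj] Vx; have {}hx := hx Vx.
have Lk := slice_inL2 ak0 Vx; have Lk0 := slice_inL2 ak0 Vx0.
have LB := siB SL Lk Lk0.
have d1 : `|intop M sigma k0 (u j) x - intop M sigma k0 (u j) x0| <= e / 4.
  rewrite !intop_dot -(siBl SL Lk Lk0 (Lu j)); apply: small => //; exact: ltW.
have d2 : `|intop M sigma k0 u0 x0 - intop M sigma k0 u0 x| <= e / 4.
  rewrite distrC !intop_dot -(siBl SL Lk Lk0 Lu0); apply: small => //; exact: ltW.
have -> : intop M sigma k0 (u j) x - intop M sigma k0 u0 x =
  (intop M sigma k0 (u j) x - intop M sigma k0 (u j) x0) +
  ((intop M sigma k0 (u j) x0 - intop M sigma k0 u0 x0) +
   (intop M sigma k0 u0 x0 - intop M sigma k0 u0 x)) by ring.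
apply: le_trans (ler_normD _ _) _; apply: lerD => //.
apply: le_trans (ler_normD _ _) _; apply: lerD => //.
by rewrite distrC.
Qed.

End IntegralOperators.

(** * Difference quotients of the kernel *)

Section Differences.
Context (K : realType) (p : nat).
Implicit Types (f : 'rV[K]_p -> K) (a m z : 'rV[K]_p).

Local Notation e_ i := (delta_mx 0 i : 'rV[K]_p).

Lemma norm_ltP (n : nat) (a : 'rV[K]_n) (c : K) : 0 < c ->
  (forall i, `|a 0 i| < c) -> `|a| < c.
Proof.
move=> c0 h; rewrite /Num.Def.normr /= mx_normrE; apply/bigmax_ltP; split=> // -[i j] _ /=.
by rewrite (ord1 i).
Qed.

Lemma is_derive_line f a (v : 'rV[K]_p) (t : K) : derivable f (a + t *: v) v ->
  is_derive t (1 : K) (fun s : K => f (a + s *: v)) ('D_v f (a + t *: v)).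
Proof.
move=> df.
have E : (fun h : K => h^-1 *: (((fun s : K => f (a + s *: v)) \o shift t) (h *: 1) -
      f (a + t *: v))) =
    (fun h : K => h^-1 *: ((f \o shift (a + t *: v)) (h *: v) - f (a + t *: v))).
  apply/funext => h /=; congr (_ *: (f _ - _)).
  by rewrite scalerDl addrCA -!scalerA scale1r.
by apply: DeriveDef; rewrite /derivable /derive E.
Qed.

(** The mean value theorem on the segment. *)
Lemma coord_step f i a (s c eps : K) : 0 <= s ->
  (forall t, 0 <= t <= s -> derivable f (a + t *: e_ i) (e_ i) /\
     `|dm i f (a + t *: e_ i) - c| <= eps) ->
  `|f (a + s *: e_ i) - f a - s * c| <= eps * s.
Proof.
move=> s0 h.
have dline t : 0 <= t <= s ->
    is_derive t (1 : K) (fun s : K => f (a + s *: e_ i)) (dm i f (a + t *: e_ i)).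
  by move=> /h[dt _]; exact: is_derive_line.
have cline : {within `[0, s], continuous (fun s : K => f (a + s *: e_ i))}.
  apply: derivable_within_continuous => t; rewrite in_itv/= => /dline dt.
  exact: ex_derive.
have [|t] := @MVT_segment K _ (fun t => dm i f (a + t *: e_ i)) 0 s s0 _ cline.
  move=> t; rewrite in_itv/= => /andP[t0 ts]; apply: dline.
  by rewrite (ltW t0) (ltW ts).
rewrite in_itv/= => /h[_ ht].
rewrite scale0r addr0 subr0 => ->.
by rewrite mulrC -mulrBr normrM (ger0_norm s0) mulrC ler_wpM2r.
Qed.

(** The coordinates of m and m' are exchanged one at a time; the intermediate
    points stay in the same ball because the norm is the sup norm. *)
Lemma coord_differences f m0 (c : 'I_p -> K) (r eps : K) m m' :
  (forall z i, `|z - m0| < r -> derivable f z (e_ i) /\ `|dm i f z - c i| <= eps) ->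
  `|m - m0| < r -> `|m' - m0| < r ->
  `|f m - f m' - \sum_(i < p) c i * (m - m') 0 i|
    <= eps * \sum_(i < p) `|(m - m') 0 i|.
Proof.
move=> hf hm hm'.
have r0 : 0 < r by exact: le_lt_trans hm.
have cm i : `|m 0 i - m0 0 i| < r.
  have := le_lt_trans (coord_le_norm (m - m0) 0 i) hm; by rewrite !mxE.
have cm' i : `|m' 0 i - m0 0 i| < r.
  have := le_lt_trans (coord_le_norm (m' - m0) 0 i) hm'; by rewrite !mxE.
(* the first j coordinates come from m, the others from m' *)
pose z (j : nat) : 'rV[K]_p := \row_i (if (i < j)%N then m 0 i else m' 0 i).
have z0 : z 0%N = m' by apply/rowP => i; rewrite mxE.
have zp : z p = m by apply/rowP => i; rewrite mxE ltn_ord.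
have zS (j : 'I_p) : z j.+1 = z j + (m - m') 0 j *: e_ j.
  apply/rowP => i; rewrite !mxE eqxx /= ltnS leq_eqVlt.
  have [->|ij] := eqVneq i j; first by rewrite eqxx ltnn mulr1 addrC subrK.
  by rewrite mulr0 addr0; have /negbTE -> : (i != j :> nat) by [].
have step (j : 'I_p) : `|f (z j.+1) - f (z j) - c j * (m - m') 0 j|
    <= eps * `|(m - m') 0 j|.
  have zc (k : nat) i : `|z k 0 i - m0 0 i| < r by rewrite mxE; case: ifP.
  have seg a (t : K) : (forall i, i != j -> a 0 i = z j 0 i) ->
      `|a 0 j + t - m0 0 j| < r -> `|a + t *: e_ j - m0| < r.
    move=> ha ht; apply: norm_ltP => // i; rewrite !mxE eqxx /=.
    have [->|ij] := eqVneq i j; first by rewrite mulr1.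
    by rewrite mulr0 addr0 ha.
  have zj : z j 0 j = m' 0 j by rewrite mxE ltnn.
  have zj1 : z j.+1 0 j = m 0 j by rewrite mxE ltnS leqnn.
  have dE : (m - m') 0 j = m 0 j - m' 0 j by rewrite !mxE.
  have [d0|d0] := leP 0 ((m - m') 0 j).
    rewrite zS (ger0_norm d0) [c j * _]mulrC; apply: coord_step => // t /andP[t0 tD].
    apply: hf; apply: seg => //; rewrite zj.
    have := cm j; have := cm' j; rewrite !ltr_norml => /andP[? ?] /andP[? ?].
    by apply/andP; split; move: tD; rewrite dE; lra.
  have d1 : 0 <= - (m - m') 0 j by rewrite oppr_ge0 ltW.
  have zj' : z j = z j.+1 + (- (m - m') 0 j) *: e_ j.
    by rewrite zS scaleNr addrK.
  rewrite (ltr0_norm d0) -normrN opprB.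
  have -> : c j * (m - m') 0 j - (f (z j.+1) - f (z j)) =
     f (z j) - f (z j.+1) - (- (m - m') 0 j) * c j by ring.
  rewrite {1}zj'; apply: coord_step => // t /andP[t0 tD].
  apply: hf; apply: seg.
    by move=> i ij; rewrite zS !mxE eqxx /= (negbTE ij) mulr0 addr0.
  rewrite zj1; have := cm j; have := cm' j; rewrite !ltr_norml => /andP[? ?] /andP[? ?].
  by apply/andP; split; move: tD; rewrite dE; lra.
have tel : f m - f m' = \sum_(j < p) (f (z j.+1) - f (z j)).
  by rewrite -(big_mkord xpredT (fun j => f (z j.+1) - f (z j)))
    (telescope_sumr (fun j => f (z j)))// zp z0.
rewrite tel -sumrB mulr_sumr; apply: le_trans (ler_norm_sum _ _ _) _.
by apply: ler_sum => j _; exact: step.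
Qed.

End Differences.

Section KernelDerivative.
Context (K : realType) (p d nV : nat) (V M : set 'rV[K]_d).
Hypotheses (cV : compact V) (cM : compact M).
Context (B' : set 'rV[K]_p) (oB' : open B').
Context (H : 'rV[K]_p -> 'rV[K]_d -> 'rV[K]_d -> K).
Hypothesis hreg2 : regularity2 nV B' V M H.

Lemma dm_slice i m0 : B' m0 ->
  admissible V M (fun x y => dm i (fun m => H m x y) m0) /\
  forall e : K, 0 < e -> \forall m \near m0, forall x y, V x -> M y ->
    `|dm i (fun m => H m x y) m - dm i (fun m => H m x y) m0| <= e.
Proof.
move=> B0; have [_ /(_ i)[_ cH _ _]] := hreg2.
have [h1 h2] := adm_slice cV cM (H := fun m x y => dm i (fun m => H m x y) m) cH B0.
split=> // e e0; have := h2 e e0; rewrite /within/= => h.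
have nB : \forall m \near m0, B' m by exact: open_nbhs_nbhs.
by apply: filterS2 nB h => m Bm; apply.
Qed.

Lemma adm_dirker q m0 : B' m0 -> admissible V M (dirker H q m0).
Proof.
move=> B0; apply: adm_sum => i.
have := admM (q 0 i) (dm_slice i B0).1.
by under eq_fun do under eq_fun do rewrite mulrC.
Qed.

(** The derivatives in the parameter are continuous at [m0] uniformly over the
    compact set V x M, so the difference of two kernels is linear in the
    difference of the parameters up to a uniformly small relative error. *)
Lemma kernel_differences m0 (eps : K) : B' m0 -> 0 < eps ->
  \forall r \near 0^'+, forall m m', `|m - m0| < r -> `|m' - m0| < r ->
    forall x y, V x -> M y ->
    `|H m x y - H m' x y - dirker H (m - m') m0 x y| <= eps * enorm (m - m').
Proof.
move=> B0 eps0.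
have e1 : 0 < eps / (p%:R + 1) by rewrite divr_gt0// ltr_wpDl.
have nB : \forall m \near m0, B' m by exact: open_nbhs_nbhs.
have := filter_forall (nbhs_filter m0) (fun i => (dm_slice i B0).2 _ e1).
move=> /(filterI nB)/nbhs_ballP[r0 /= r00 hr].
near=> r.
have rr0 : r <= r0 by near: r; exact: nbhs_right_le.
move=> m m' hm hm' x y Vx My.
apply: le_trans (@coord_differences K p (fun m => H m x y) m0
  (fun i => dm i (fun m => H m x y) m0) r (eps / (p%:R + 1)) m m' _ hm hm') _.
  move=> z i hz; have hz' : ball m0 r0 z.
    by rewrite -ball_normE /= distrC; exact: lt_le_trans hz rr0.
  have [Bz hd] := hr z hz'.
  split; last exact: hd.
  by have [_ /(_ i)[+ _ _ _]] := hreg2; apply.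
rewrite mulrAC ler_pdivrMr ?ltr_wpDl// -mulrA ler_wpM2l ?(ltW eps0)//.
apply: (@le_trans _ _ (\sum_(i < p) enorm (m - m'))).
  by apply: ler_sum => i _; exact: coord_le_enorm.
rewrite sumr_const card_ord -[leLHS]mulr_natr ler_wpM2l ?enorm_ge0//.
by rewrite lerDl.
Unshelve. all: by end_near. Qed.

End KernelDerivative.

(** * The spans of eigenvectors *)

Section Eigenspaces.
Context (K : realType) (nR nV d : nat) (M V : set 'rV[K]_d)
  (sigma sigma' : {measure set (borel K d) -> \bar K}).
Hypotheses (hM : compact_manifold nR M) (hV : compact_manifold nV V)
  (hs : surface_measure nR M sigma) (hs' : surface_measure nV V sigma')
  (hP : poincare nR M sigma).
Implicit Types (k : 'rV[K]_d -> 'rV[K]_d -> K) (u v : fungrad K d).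

Let mM : measurable (M : set (borel K d)) := borel_compact hM.1.
Let mV : measurable (V : set (borel K d)) := borel_compact hV.1.
Let SV := L2_semi_inner sigma' mV.
Let S := H10_semi_inner hM hs.
Local Notation D := (H10 nR M sigma).
Local Notation dH := (dotH10 M sigma).
Local Notation dV := (dotL2 V sigma').
Local Notation opA := (opA M V sigma).

Lemma eqH10_null u v : D u -> D v -> eqH10 M sigma u v -> nrm dH (u - v) = 0.
Proof.
move=> Du Dv e; have Duv := siB S Du Dv.
by rewrite /nrm (siBl S Du Dv Duv) (eqH10_dot hM hs Du Dv Duv e) subrr sqrtr0.
Qed.

Lemma normL2_diffE k k' u v :
  normL2 V sigma' (fun x => intop M sigma k u x - intop M sigma k' v x) =
  nrm dV (opA k u - opA k' v).
Proof.
have e x : V x -> intop M sigma k u x - intop M sigma k' v x = (opA k u - opA k' v) x.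
  by move=> Vx; change (intop M sigma k u x - intop M sigma k' v x =
    opA k u x - opA k' v x); rewrite !opAE.
by rewrite /normL2 /nrm; congr Num.sqrt; apply: eq_dotL2.
Qed.

Lemma normL2E k u : normL2 V sigma' (intop M sigma k u) = nrm dV (opA k u).
Proof.
have e x : V x -> intop M sigma k u x = opA k u x by move=> Vx; rewrite opAE.
by rewrite /normL2 /nrm; congr Num.sqrt; apply: eq_dotL2.
Qed.

(** When the adjoint does not exist, its default value leaves no eigenvector
    for a positive eigenvalue. *)
Lemma eigenvector_eig k (lam : K) e : admissible V M k -> 0 < lam ->
  eigenvector nR M sigma (normal_op nR M V sigma sigma' (intop M sigma k)) lam e ->
  eig D dH dV (opA k) lam e.
Proof.
move=> ak lam0 [De ne he]; split=> // w Dw.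
have [ex|nex] := pselect (exists Sa, is_adjoint nR M V sigma sigma' (intop M sigma k) Sa).
  have ad := xgetPex (fun _ => (cst 0, cst 0)) ex.
  have LT : inL2 V sigma' (intop M sigma k e).
    apply: (@eq_inL2 _ _ _ _ mV (opA k e)); last exact: (opA_inL2 hM hV hs hs' hP ak De).
    by move=> x Vx; rewrite opAE.
  have [Dn hn] := ad _ LT.
  have Dl : D (lam *: e) by exact: (siZ S).
  rewrite -(siZl S lam De Dw) -(eqH10_dot hM hs Dn Dl Dw he) (siC S Dn Dw) -hn//.
  have Lw := opA_inL2 hM hV hs hs' hP ak Dw; have Le := opA_inL2 hM hV hs hs' hP ak De.
  rewrite (siC SV Le Lw); apply: eq_dotL2 => x Vx; by rewrite opAE.
exfalso; apply: ne; move: he; rewrite /normal_op /adjoint xgetPN; last first.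
  by move=> x hx; apply: nex; exists x.
apply: ae_imp => x h Mx; have [h1 h2] := h Mx; split.
  have : lam * e.1 x = 0 by rewrite -[LHS]/((lam *: e).1 x) -h1.
  by move/eqP; rewrite mulf_eq0 gt_eqF//= => /eqP.
have : lam *: e.2 x = 0 by rewrite -[LHS]/((lam *: e).2 x) -h2.
by move/eqP; rewrite scaler_eq0 gt_eqF//= => /eqP.
Qed.

Definition orth_spectral k (b2 : K) (s : seq K) (a : K -> fungrad K d) :=
  [/\ uniq s, spectral D dH dV (opA k) b2 s a &
      forall l, l \in s -> 0 < dH (a l) (a l)].

Lemma eigenspan_spectral k (b2 : K) u : admissible V M k -> 0 < b2 ->
  eigenspan nR M sigma (normal_op nR M V sigma sigma' (intop M sigma k)) b2 u ->
  exists s a, orth_spectral k b2 s a /\ nrm dH (u - \sum_(l <- s) a l) = 0.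
Proof.
move=> ak b0 [Du [n [c [e [he ue]]]]].
have /choice[lam hlam] i : exists l, b2 < l /\ eig D dH dV (opA k) l (e i).
  have [l bl el] := he i; exists l; split; first exact: bl.
  exact: eigenvector_eig ak (lt_trans b0 bl) el.
have LA := opA_linear hM hV hs hs' hP ak.
have he' i : eig D dH dV (opA k) (lam i) (c i *: e i).
  exact: (eigZ S SV (c i) LA (hlam i).2).
have [s [a [us sp pos nul]]] := spectral_group S SV LA (fun i => (hlam i).1) he'.
exists s, a; split; first by split.
have Dc : D (\sum_(i < n) c i *: e i).
  by apply: (si_sum S) => i _ _; exact: (he' i).1.
have Da : D (\sum_(l <- s) a l).
  by apply: (si_sum S) => l ls _; have [_ []] := sp l ls.
apply/eqP; rewrite eq_le nrm_ge0 andbT.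
rewrite -(subrK (\sum_(i < n) c i *: e i) u) -addrA.
apply: le_trans (nrmD S _ _) _; try by apply: (siB S).
by rewrite nul addr0 eqH10_null.
Qed.

End Eigenspaces.

(** * Estimates uniform in the parameter *)

Section Stability.
Context (K : realType) (d p nR nV : nat) (M V : set 'rV[K]_d).
Hypotheses (hM : compact_manifold nR M) (hV : compact_manifold nV V).
Context (sigma sigma' : {measure set (borel K d) -> \bar K}).
Hypotheses (hs : surface_measure nR M sigma) (hs' : surface_measure nV V sigma')
  (hP : poincare nR M sigma).
Context (B B' : set 'rV[K]_p).
Hypotheses (hB : compact B) (hB' : open B') (hBB' : B `<=` B').
Context (H : 'rV[K]_p -> 'rV[K]_d -> 'rV[K]_d -> K).
Hypotheses (hreg1 : regularity1 nV B V M H) (hreg2 : regularity2 nV B' V M H).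

Let mV : measurable (V : set (borel K d)) := borel_compact hV.1.
Let SV := L2_semi_inner sigma' mV.
Let S := H10_semi_inner hM hs.
Local Notation X := (fungrad K d).
Local Notation D := (H10 nR M sigma).
Local Notation dH := (dotH10 M sigma).
Local Notation dV := (dotL2 V sigma').
Local Notation nD := (nrm dH).
Local Notation nY := (nrm dV).
Local Notation opA := (opA M V sigma).
Local Notation A m := (opA (H m)).

Lemma adm_H m : B m -> admissible V M (H m).
Proof. by move=> Bm; have [c _ _] := hreg1; exact: (adm_slice hV.1 hM.1 c Bm).1. Qed.

Lemma H_bounded : exists2 c : K, 0 <= c &
  forall m x y, B m -> V x -> M y -> `|H m x y| <= c.
Proof.
have [c _ _] := hreg1.
have cBVM : compact (B `*` V `*` M).
  by apply: compact_setX; [apply: compact_setX => //; exact: hV.1|exact: hM.1].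
have [b b0 hb] := continuous_bounded cBVM c.
by exists b => // m x y Bm Vx My; exact: (hb (m, x, y)).
Qed.

Lemma A_linear m : B m -> linear_on D (inL2 V sigma') (A m).
Proof. by move=> Bm; exact: (opA_linear hM hV hs hs' hP (adm_H Bm)). Qed.

Lemma A_bounded : exists2 c : K, 0 < c &
  forall m, B m -> bounded_by D dH dV (A m) c.
Proof.
have [cH cH0 hH] := H_bounded; have [b b0 hb] := opA_bound hM hV hs hs' hP.
exists (b * (cH + 1)); first by rewrite mulr_gt0// ltr_wpDl.
move=> m Bm u Du; apply: (hb _ _ (adm_H Bm)) => //; first by rewrite addr_ge0.
by move=> x y Vx My; apply: le_trans (hH _ _ _ Bm Vx My) _; rewrite lerDl.
Qed.

(** The kernels are bounded uniformly on B, hence so are the Hilbert-Schmidt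
    sums, which count the eigenvalues above [b2]. *)
Lemma spectral_size_bounded (b2 : K) : 0 < b2 -> exists n : nat,
  forall m s a, B m -> orth_spectral nR M V sigma sigma' (H m) b2 s a -> (size s <= n)%N.
Proof.
move=> b0; have [cH cH0 hH] := H_bounded; have [b bp hb] := opA_hs hM hV hs hs' hP.
pose C := b * cH ^+ 2.
have C0 : 0 <= C by rewrite mulr_ge0 ?sqr_ge0// ltW.
exists (Num.Def.archi_bound (C / b2)) => m s a Bm [us sp pos].
have := spectral_size S SV (A_linear Bm) (hb _ _ (adm_H Bm) cH0 (fun x y => hH m x y Bm)) b0 us sp pos.
rewrite -/C -ler_pdivlMr// => h.
have := le_lt_trans h (archi_boundP (divr_ge0 C0 (ltW b0))).
by rewrite ltr_nat => /ltnW.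
Qed.

(** Eigenvalues may cross the threshold as the parameter moves, so the spectral
    projections need not even be continuous; the uniform count of eigenvalues
    is enough to compare combinations with different parameters. *)
Lemma eigen_close (b2 : K) : 0 < b2 -> exists2 C : K, 0 <= C &
  forall m m' (L : K) s a s' a', B m -> B m' -> 0 <= L ->
    (forall x y, V x -> M y -> `|H m x y - H m' x y| <= L) ->
    orth_spectral nR M V sigma sigma' (H m) b2 s a ->
    orth_spectral nR M V sigma sigma' (H m') b2 s' a' ->
    forall u v, u = \sum_(l <- s) a l -> v = \sum_(l <- s') a' l ->
    nD (u - v) <= C * (nY (A m u - A m' v) + L * nD u).
Proof.
move=> b0; have [n hn] := spectral_size_bounded b0.
have [c c0 hc] := A_bounded; have [b bp hb] := opA_bound hM hV hs hs' hP.
have [C C0 hC] := spectral_close S SV (n + n) (ltW c0) b0.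
exists (C * (1 + 2 * b)).
  by rewrite mulr_ge0// addr_ge0// mulr_ge0// ltW.
move=> m m' L s a s' a' Bm Bm' L0 hL os os' u v ue ve.
have [us sp pos] := os; have [us' sp' pos'] := os'.
have am := adm_H Bm; have am' := adm_H Bm'.
have eta0 : 0 <= b * L by rewrite mulr_ge0// ltW.
have hd w : D w -> nY (A m w - A m' w) <= b * L * nD w.
  move=> Dw; rewrite -(opA_kernelB hM hs am am' Dw); apply: hb => //.
  have := admZD (-1) am' am; rewrite (_ : (fun _ => _) = fun x y => H m x y - H m' x y)//.
  by apply/funext => x; apply/funext => y; rewrite mulN1r addrC.
have sz : (size s + size s' <= n + n)%N.
  by rewrite leq_add//; [exact: hn Bm os|exact: hn Bm' os'].
have h1 := hC _ _ _ _ _ _ _ (A_linear Bm) (A_linear Bm') (hc _ Bm) (hc _ Bm') eta0 hd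
  sp sp' sz u v ue ve.
have Du : D u by rewrite ue; apply: (si_sum S) => l /sp[_ []].
have Dv : D v by rewrite ve; apply: (si_sum S) => l /sp'[_ []].
have L2u := (A_linear Bm).1 _ Du; have L2u' := (A_linear Bm').1 _ Du.
have L2v := (A_linear Bm').1 _ Dv.
have h2 : nY (A m' (u - v)) <= nY (A m u - A m' v) + b * L * nD u.
  rewrite (linB (A_linear Bm') Du Dv).
  have -> : A m' u - A m' v = (A m u - A m' v) - (A m u - A m' u).
    by rewrite opprB [RHS]addrC [RHS]addrA subrK.
  apply: le_trans (nrmB SV _ _) _; try exact: (siB SV).
  by rewrite lerD2l; exact: hd.
apply: le_trans h1 _.
have nu : 0 <= nD u by exact: nrm_ge0.
have ny : 0 <= nY (A m u - A m' v) by exact: nrm_ge0.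
move: h2 nu ny; move: (nY (A m' (u - v))) (nY (A m u - A m' v)) (nD u) => t1 t2 t3.
move=> h2 nu ny; rewrite -[leRHS]mulrA; apply: ler_wpM2l => //.
have : 0 <= L * t3 by rewrite mulr_ge0.
have : 0 <= b * t2 by rewrite mulr_ge0// ltW.
have -> : b * L * t3 = b * (L * t3) by ring.
move: h2; have -> : b * L * t3 = b * (L * t3) by ring.
move: (L * t3) => t4; lra.
Qed.

(** Compactness of the operators, jointly in the kernel and the argument: weak
    convergence of arguments becomes strong convergence of images. *)
Lemma opA_cvg (F : set_system nat) (k : nat -> 'rV[K]_d -> 'rV[K]_d -> K) k0
    (u : nat -> X) (u0 : X) (c : K) : Filter F ->
  (forall j, admissible V M (k j)) -> admissible V M k0 ->
  (forall e : K, 0 < e -> \forall j \near F,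
     forall x y, V x -> M y -> `|k j x y - k0 x y| <= e) ->
  (forall j, D (u j)) -> D u0 -> (forall j, nD (u j) <= c) ->
  (forall L, bounded_functional D dH L -> (fun j => L (u j)) @ F --> L u0) ->
  forall e : K, 0 < e -> \forall j \near F, nY (opA (k j) (u j) - opA k0 u0) <= e.
Proof.
move=> FF ak ak0 hk Du Du0 uc hw e e0.
have [s s0 hsup] := sup_L2_le hV hs'.
have es : 0 < e / s by rewrite divr_gt0.
have h := intop_unif_cvg hM hV hs hP FF ak ak0 hk Du Du0 uc hw es.
apply: filterS h => j hj.
have -> : e = s * (e / s) by rewrite mulrCA divff ?mulr1// gt_eqF.
have L1 := opA_inL2 hM hV hs hs' hP (ak j) (Du j).
have L2 := opA_inL2 hM hV hs hs' hP ak0 Du0.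
exact: hsup (siB SV L1 L2) (ltW es) hj.
Qed.

Lemma H_unif (F : set_system nat) (m : nat -> 'rV[K]_p) m0 : Filter F ->
  (forall j, B (m j)) -> B m0 -> m @ F --> m0 ->
  forall e : K, 0 < e -> \forall j \near F,
     forall x y, V x -> M y -> `|H (m j) x y - H m0 x y| <= e.
Proof.
move=> FF Bm B0 cm e e0; have [c _ _] := hreg1.
have h := (adm_slice hV.1 hM.1 c B0).2 e e0.
have h' := cm _ h.
by apply: (@filterS _ F _ _ _ _ h') => j hj; exact: hj (Bm j).
Qed.

Lemma dirker_lipschitz m0 : B m0 -> exists2 c : K, 0 <= c & forall q q' x y,
  V x -> M y -> `|dirker H q m0 x y - dirker H q' m0 x y| <= c * `|q - q'|.
Proof.
move=> B0; have B0' := hBB' B0.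
have hc i : exists c : K, 0 <= c /\ forall x y, V x -> M y ->
    `|dm i (fun m => H m x y) m0| <= c.
  have [c c0 h] := adm_bounded hV.1 hM.1 (dm_slice hV.1 hM.1 hB' hreg2 i B0').1.
  by exists c.
have [c {}hc] := choice hc.
exists (\sum_i c i); first by apply: sumr_ge0 => i _; exact: (hc i).1.
move=> q q' x y Vx My; rewrite /dirker -sumrB mulr_suml.
apply: le_trans (ler_norm_sum _ _ _) _; apply: ler_sum => i _.
rewrite -mulrBr normrM; apply: ler_pM => //; first exact: (hc i).2.
by have := coord_le_norm (q - q') 0 i; rewrite !mxE.
Qed.

Definition quotient_kernel m m' : 'rV[K]_d -> 'rV[K]_d -> K :=
  fun x y => (enorm (m - m'))^-1 * (H m x y - H m' x y).

Lemma adm_quotient m m' : B m -> B m' -> admissible V M (quotient_kernel m m').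
Proof.
move=> Bm Bm'; apply: admM.
have := admZD (-1) (adm_H Bm') (adm_H Bm).
rewrite (_ : (fun _ => _) = fun x y => H m x y - H m' x y)//.
by apply/funext => x; apply/funext => y; rewrite mulN1r addrC.
Qed.

Lemma quotient_unif (F : set_system nat) (m m' : nat -> 'rV[K]_p) m0 q : Filter F ->
  B m0 -> m @ F --> m0 -> m' @ F --> m0 -> (forall j, 0 < enorm (m j - m' j)) ->
  (fun j => (enorm (m j - m' j))^-1 *: (m j - m' j)) @ F --> q ->
  forall e : K, 0 < e -> \forall j \near F,
     forall x y, V x -> M y ->
       `|quotient_kernel (m j) (m' j) x y - dirker H q m0 x y| <= e.
Proof.
move=> FF B0 cm cm' h0 cq e e0.
have e2 : 0 < e / 2 by rewrite divr_gt0.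
have KD := kernel_differences hV.1 hM.1 hB' hreg2 (hBB' B0) e2.
have R0 : \forall r \near (0 : K)^'+, 0 < r by exact: nbhs_right_gt.
have [r [hr r0]] := filter_ex (filterI KD R0).
have [c c0 hc] := dirker_lipschitz B0.
have e3 : 0 < e / 2 / (c + 1) by rewrite !divr_gt0// ltr_wpDl.
have /cvgrPdist_lt/(_ _ r0) n1 := cm; have /cvgrPdist_lt/(_ _ r0) n2 := cm'.
have /cvgrPdist_le/(_ _ e3) n3 := cq.
apply: filterS3 n1 n2 n3 => j; rewrite ![`|m0 - _|]distrC [`|q - _|]distrC => h1 h2 h3 x y Vx My.
have hj := h0 j; set h := enorm _ in hj *.
pose qj := h^-1 *: (m j - m' j).
have E : dirker H qj m0 x y = h^-1 * dirker H (m j - m' j) m0 x y.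
  by rewrite /dirker mulr_sumr; apply: eq_bigr => i _; rewrite /qj !mxE; ring.
have t1 : `|quotient_kernel (m j) (m' j) x y - dirker H qj m0 x y| <= e / 2.
  rewrite E /quotient_kernel -/h -mulrBr normrM gtr0_norm ?invr_gt0//.
  by rewrite mulrC ler_pdivrMr//; exact: hr.
have t2 : `|dirker H qj m0 x y - dirker H q m0 x y| <= e / 2.
  apply: le_trans (hc qj q x y Vx My) _.
  move: h3; rewrite -/h -/qj ler_pdivlMr ?ltr_wpDl//; apply: le_trans.
  by rewrite mulrC ler_wpM2l// lerDl.
rewrite -(subrK (dirker H qj m0 x y) (quotient_kernel _ _ x y)) -addrA.
by apply: le_trans (ler_normD _ _) _; rewrite [leRHS](splitr e); exact: lerD.
Qed.

End Stability.

(** * The stability estimate *)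

Lemma enorm_diff_bounded (K : realType) (p : nat) (B : set 'rV[K]_p) : compact B ->
  exists2 b : K, 0 < b & forall x y, B x -> B y -> enorm (x - y) <= b.
Proof.
move=> cB; have [b0 [_ hb']] := compact_bounded cB.
have hb x : B x -> `|x| <= `|b0| + 1.
  by apply: hb'; have := ler_norm b0; lra.
exists (p%:R * ((`|b0| + 1) + (`|b0| + 1)) + 1).
  by rewrite ltr_wpDl// mulr_ge0// !addr_ge0.
move=> x y Bx By; apply: le_trans (enorm_le_norm _) _.
apply: (@le_trans _ _ (p%:R * ((`|b0| + 1) + (`|b0| + 1)))); last by rewrite lerDl.
rewrite ler_wpM2l//; apply: le_trans (ler_normB _ _) _.
by apply: lerD; apply: hb.
Qed.

Section Contradiction.
Context (K : realType) (d p nR nV : nat) (M V : set 'rV[K]_d).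
Hypotheses (hM : compact_manifold nR M) (hV : compact_manifold nV V).
Context (sigma sigma' : {measure set (borel K d) -> \bar K}).
Hypotheses (hs : surface_measure nR M sigma) (hs' : surface_measure nV V sigma')
  (hP : poincare nR M sigma).
Context (B B' : set 'rV[K]_p).
Hypotheses (hB : compact B) (hB' : open B') (hBB' : B `<=` B').
Context (H : 'rV[K]_p -> 'rV[K]_d -> 'rV[K]_d -> K).
Hypotheses (hreg1 : regularity1 nV B V M H) (hreg2 : regularity2 nV B' V M H).
Hypotheses (huniq1 : uniqueness1 nR B V M sigma sigma' H)
  (huniq2 : uniqueness2 nR B V M sigma sigma' H).

Let mV : measurable (V : set (borel K d)) := borel_compact hV.1.
Let SV := L2_semi_inner sigma' mV.
Let S := H10_semi_inner hM hs.
Let Dcomp := H10_complete hM hs hP.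
Local Notation X := (fungrad K d).
Local Notation D := (H10 nR M sigma).
Local Notation dH := (dotH10 M sigma).
Local Notation dV := (dotL2 V sigma').
Local Notation nD := (nrm dH).
Local Notation nY := (nrm dV).
Local Notation opA := (opA M V sigma).
Local Notation A m := (opA (H m)).

Section Sequences.
Context (F : set_system nat) (m m' : nat -> 'rV[K]_p) (u v : nat -> X) (c C : K)
  (r : nat -> K).
Hypotheses (FU : UltraFilter F)
  (Bm : forall j, B (m j)) (Bm' : forall j, B (m' j))
  (Du : forall j, D (u j)) (Dv : forall j, D (v j))
  (uc : forall j, nD (u j) <= c) (vc : forall j, nD (v j) <= c)
  (h0 : forall j, 0 < enorm (m j - m' j))
  (v1 : forall j, nY (A (m' j) (v j)) = 1)
  (r0 : r @ F --> (0 : K))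
  (hr : forall j, nY (A (m j) (u j) - A (m' j) (v j)) <= enorm (m j - m' j) * r j)
  (C0 : 0 <= C)
  (hC : forall j L, 0 <= L ->
    (forall x y, V x -> M y -> `|H (m j) x y - H (m' j) x y| <= L) ->
    nD (u j - v j) <= C * (nY (A (m j) (u j) - A (m' j) (v j)) + L * nD (u j))).

Let FF : ProperFilter F := ultra_proper.
Let h j := enorm (m j - m' j).

Lemma nY_eq0 f : (forall e : K, 0 < e -> nY f <= e) -> nY f = 0.
Proof.
move=> hf; apply/eqP; rewrite eq_le nrm_ge0 andbT.
by apply/ler_addgt0Pr => e e0; rewrite add0r; exact: hf.
Qed.

Lemma small_r (e : K) : 0 < e -> \forall j \near F, r j <= e.
Proof.
move=> e0; have /cvgr0Pnorm_le/(_ _ e0) := r0; apply: filterS => j.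
by apply: le_trans; exact: ler_norm.
Qed.

Lemma opA_null m0 w : B m0 -> eqH10 M sigma w 0 -> D w -> nY (A m0 w) = 0.
Proof.
move=> B0 w0 Dw; have [b b0 hb] := A_bounded hM hV hs hs' hP hB hreg1.
have := eqH10_null hM hs Dw (si0 S) w0; rewrite subr0 => n0.
apply/eqP; rewrite eq_le nrm_ge0 andbT.
by apply: le_trans (hb _ B0 _ Dw) _; rewrite n0 mulr0.
Qed.

(** The heart of the argument.  In the limit the images agree, so uniqueness of
    the pair (parameter, density) makes the two limits equal; then the
    difference quotients of the relation between the two sequences converge to
    an identity that the uniqueness for directional derivatives forbids.  The
    bound [hC] is what keeps the quotients of the densities bounded. *)
Lemma sequences_absurd : False.
Proof.
have FI : Filter F by exact: _.
have [m0 B0 cm] := ultra_compact_cvg FU hB Bm.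
have [m0' B0' cm'] := ultra_compact_cvg FU hB Bm'.
have [u0 Du0 wu] := ultra_weak_cvg FU S Dcomp Du uc.
have [v0 Dv0 wv] := ultra_weak_cvg FU S Dcomp Dv vc.
have admH := adm_H hM hV hreg1.
have LA := fun m Bm => @A_linear _ _ _ _ _ _ _ hM hV _ _ hs hs' hP _ _ hreg1 m Bm.
have cu := opA_cvg hM hV hs hs' hP FI (fun j => admH _ (Bm j)) (admH _ B0)
  (H_unif hM hV hreg1 FI Bm B0 cm) Du Du0 uc wu.
have cv := opA_cvg hM hV hs hs' hP FI (fun j => admH _ (Bm' j)) (admH _ B0')
  (H_unif hM hV hreg1 FI Bm' B0' cm') Dv Dv0 vc wv.
have LAu j := (LA _ (Bm j)).1 _ (Du j).
have LAv j := (LA _ (Bm' j)).1 _ (Dv j).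
have LAu0 := (LA _ B0).1 _ Du0.
have LAv0 := (LA _ B0').1 _ Dv0.
have [hb hb0 hhb'] := enorm_diff_bounded hB.
have hhb j : h j <= hb by exact: hhb'.
have e0 : nY (A m0 u0 - A m0' v0) = 0.
  apply: nY_eq0 => e e0.
  have e3 : 0 < e / 3 by rewrite divr_gt0.
  have e4 : 0 < e / 3 / hb by rewrite divr_gt0.
  have [j [[h1 h2] h3]] := filter_ex (filterI (filterI (cu _ e3) (cv _ e3)) (small_r e4)).
  have E : A m0 u0 - A m0' v0 = (A m0 u0 - A (m j) (u j)) +
     ((A (m j) (u j) - A (m' j) (v j)) + (A (m' j) (v j) - A m0' v0)).
    by rewrite !subrKA.
  rewrite E; apply: le_trans (nrmD SV _ _) _.
    exact: (siB SV).
    by apply: (siD SV); exact: (siB SV).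
  apply: le_trans (lerD (lexx _) (nrmD SV _ _)) _.
    exact: (siB SV).
    exact: (siB SV).
  rewrite (nrm_sym SV LAu0 (LAu j)).
  have h4 : nY (A (m j) (u j) - A (m' j) (v j)) <= e / 3.
    apply: le_trans (hr j) _; apply: (@le_trans _ _ (h j * (e / 3 / hb))).
      by rewrite ler_wpM2l ?enorm_ge0.
    rewrite mulrCA ler_piMr ?(ltW e3)// ler_pdivrMr// mul1r; exact: hhb.
  have -> : e = e / 3 + (e / 3 + e / 3) by field.
  by apply: lerD; [exact: h1|apply: lerD; [exact: h4|exact: h2]].
have nv0 : ~ eqH10 M sigma v0 0.
  move=> v00; have := opA_null B0' v00 Dv0.
  have half : (0 : K) < 2^-1 by rewrite invr_gt0.
  have [j hj] := filter_ex (cv _ half).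
  have := nrm_le_sub SV (LAv j) LAv0; rewrite v1 => t1 t2.
  by move: t1 hj; rewrite t2; move: (nY _) => t3; lra.
have eq0 : eqL2 V sigma' (intop M sigma (H m0) u0) (intop M sigma (H m0') v0).
  have LB := siB SV LAu0 LAv0.
  have : dV (A m0 u0 - A m0' v0) (A m0 u0 - A m0' v0) = 0.
    by rewrite -(sqr_nrm SV LB) e0 expr0n.
  move/(dotL2_eq0 mV LB); apply: ae_imp => x hx Vx.
  have := hx Vx; change (A m0 u0 x - A m0' v0 x = 0 ->
    intop M sigma (H m0) u0 x = intop M sigma (H m0') v0 x).
  by rewrite !opAE// => /eqP; rewrite subr_eq0 => /eqP.
have [mm uv] := huniq1 B0 B0' Du0 Dv0 eq0 (or_intror nv0).
subst m0'.
have [q [q1 cq]] : exists q : 'rV[K]_p, enorm q = 1 /\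
    (fun j => (h j)^-1 *: (m j - m' j)) @ F --> q.
  pose qj j := (h j)^-1 *: (m j - m' j).
  have nq j : enorm (qj j) = 1.
    by rewrite enormZ gtr0_norm ?invr_gt0 ?h0// mulVf// gt_eqF// h0.
  have cQ := @rV_compact K p (fun=> `[- 1, 1]%classic) (fun=> @segment_compact K (-1) 1).
  have [j i|q _ cq] := ultra_compact_cvg (u := qj) FU cQ.
    rewrite /= in_itv/= -ler_norml -(nq j); exact: coord_le_enorm.
  exists q; split; last exact: cq.
  have near_q (e : K) : 0 < e -> exists j, enorm (q - qj j) <= e.
    move=> e_gt0; have e1 : 0 < e / (p%:R + 1) by rewrite divr_gt0// ltr_wpDl.
    have /cvgrPdist_le/(_ _ e1)/filter_ex[j hj] := cq; exists j.
    apply: le_trans (enorm_le_norm _) _; move: hj.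
    rewrite ler_pdivlMr ?ltr_wpDl//; apply: le_trans.
    by rewrite mulrC ler_wpM2l// lerDl.
  apply/eqP; rewrite eq_le; apply/andP; split; apply/ler_addgt0Pr => e e_gt0;
    have [j hj] := near_q _ e_gt0.
    rewrite -(nq j) -{1}(subrK (qj j) q) addrC; apply: le_trans (enormD _ _) _.
    by rewrite lerD2l.
  rewrite -{1}(nq j) -(subrK q (qj j)) addrC; apply: le_trans (enormD _ _) _.
  by rewrite lerD2l -opprB enormN.
have B0b := hBB' B0.
have cK := quotient_unif hM hV hB' hBB' hreg2 FI B0 cm cm' h0 cq.
have aK j := adm_quotient hM hV hreg1 (Bm j) (Bm' j).
have aD := adm_dirker hV.1 hM.1 hB' hreg2 q B0b.
have cd := opA_cvg hM hV hs hs' hP FI aK aD cK Du Du0 uc wu.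
have [b b1 hbk] := adm_bounded hV.1 hM.1 aD.
have lipn : \forall j \near F, forall x y, V x -> M y ->
    `|H (m j) x y - H (m' j) x y| <= (b + 1) * h j.
  apply: filterS (cK _ ltr01) => j hj x y Vx My.
  have h1 : `|quotient_kernel H (m j) (m' j) x y| <= b + 1.
    rewrite -(subrK (dirker H q m0 x y) (quotient_kernel _ _ _ x y)) addrC.
    apply: le_trans (ler_normD _ _) _.
    by apply: lerD; [exact: hbk|exact: hj].
  move: h1; rewrite /quotient_kernel normrM gtr0_norm ?invr_gt0 ?h0//.
  by rewrite mulrC ler_pdivrMr ?h0.
pose c2 := C * (1 + (b + 1) * c).
have wbound : \forall j \near F, nD ((h j)^-1 *: (u j - v j)) <= c2.
  apply: filterS2 lipn (small_r ltr01) => j hj rj.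
  have hj0 : 0 < h j := h0 j.
  have L0 : 0 <= (b + 1) * h j by rewrite mulr_ge0 ?addr_ge0// ltW.
  have Duv := siB S (Du j) (Dv j).
  rewrite (nrmZ S _ Duv) gtr0_norm ?invr_gt0// mulrC ler_pdivrMr//.
  apply: le_trans (hC L0 hj) _; rewrite /c2 -[leRHS]mulrA; apply: ler_wpM2l => //.
  have t1 : h j * r j <= h j * 1 by rewrite ler_wpM2l// ltW.
  have t2 : (b + 1) * h j * nD (u j) <= (b + 1) * h j * c by rewrite ler_wpM2l.
  have -> : (1 + (b + 1) * c) * h j = h j * 1 + (b + 1) * h j * c by ring.
  by apply: lerD t2; exact: le_trans (hr j) t1.
(* truncated where the bound, which holds only eventually, fails *)
pose w j := if nD ((h j)^-1 *: (u j - v j)) <= c2 then (h j)^-1 *: (u j - v j) else 0.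
have Dw j : D (w j).
  by rewrite /w; case: ifP => _; [apply: (siZ S); exact: (siB S)|exact: si0 S].
have wc j : nD (w j) <= Num.max c2 0.
  by rewrite /w le_max; case: ifP => [-> //|_]; rewrite (nrm0 S) lexx orbT.
have [w0 Dw0 ww] := ultra_weak_cvg FU S Dcomp Dw wc.
have cw := opA_cvg hM hV hs hs' hP FI (fun j => admH _ (Bm' j)) (admH _ B0)
  (H_unif hM hV hreg1 FI Bm' B0 cm') Dw Dw0 wc ww.
pose Q := opA (dirker H q m0) u0.
have LQ : inL2 V sigma' Q := opA_inL2 hM hV hs hs' hP aD Du0.
have LAw0 := (LA _ B0).1 _ Dw0.
(* (A_m u - A_m' v) / h, which tends to 0, is the sum of A_m' applied to the
   quotient w of u - v and of the quotient of the kernels applied to u *)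
have z0 : nY (A m0 w0 + Q) = 0.
  apply: nY_eq0 => e e_gt0.
  have e3 : 0 < e / 3 by rewrite divr_gt0.
  have [j [[h1 h2] [h3 h4]]] := filter_ex (filterI (filterI (cw _ e3) (cd _ e3))
    (filterI (small_r e3) wbound)).
  have hj0 : 0 < h j := h0 j.
  pose kq := opA (quotient_kernel H (m j) (m' j)) (u j).
  have Lkq : inL2 V sigma' kq := opA_inL2 hM hV hs hs' hP (aK j) (Du j).
  have LAw : inL2 V sigma' (A (m' j) (w j)) := (LA _ (Bm' j)).1 _ (Dw j).
  have Ek : kq = (h j)^-1 *: (A (m j) (u j) - A (m' j) (u j)).
    have aB : admissible V M (fun x y => H (m j) x y - H (m' j) x y).
      have := admZD (-1) (admH _ (Bm' j)) (admH _ (Bm j)).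
      rewrite (_ : (fun _ => _) = fun x y => H (m j) x y - H (m' j) x y)//.
      by apply/funext => x; apply/funext => y; rewrite mulN1r addrC.
    rewrite -(opA_kernelB hM hs (admH _ (Bm j)) (admH _ (Bm' j)) (Du j)).
    exact: (opA_kernelZ hM hs _ aB (Du j)).
  have Ew : A (m' j) (w j) = (h j)^-1 *: (A (m' j) (u j) - A (m' j) (v j)).
    rewrite /w h4 (linZ S _ (LA _ (Bm' j)) (siB S (Du j) (Dv j))).
    by rewrite (linB (LA _ (Bm' j)) (Du j) (Dv j)).
  have Es : A (m' j) (w j) + kq = (h j)^-1 *: (A (m j) (u j) - A (m' j) (v j)).
    rewrite Ew Ek -scalerDr; congr (_ *: _).
    by rewrite addrC addrA subrK.
  have E : A m0 w0 + Q = (A m0 w0 - A (m' j) (w j)) + ((A (m' j) (w j) + kq) + (Q - kq)).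
    by rewrite [Q - kq]addrC [X in _ = _ + X]addrA addrK subrKA.
  rewrite E; apply: le_trans (nrmD SV _ _) _.
    exact: (siB SV).
    by apply: (siD SV); [exact: (siD SV)|exact: (siB SV)].
  apply: le_trans (lerD (lexx _) (nrmD SV _ _)) _.
    exact: (siD SV).
    exact: (siB SV).
  rewrite (nrm_sym SV LAw0 LAw) (nrm_sym SV LQ Lkq).
  have h5 : nY (A (m' j) (w j) + kq) <= e / 3.
    rewrite Es (nrmZ SV _ (siB SV (LAu j) (LAv j))) gtr0_norm ?invr_gt0//.
    rewrite mulrC ler_pdivrMr// mulrC; apply: le_trans (hr j) _.
    by rewrite ler_wpM2l// ltW.
  have -> : e = e / 3 + (e / 3 + e / 3) by field.
  by apply: lerD; [exact: h1|apply: lerD; [exact: h5|exact: h2]].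
have eq2 : eqL2 V sigma' (intop M sigma (dirker H q m0) u0) (intop M sigma (H m0) (- w0)).
  have LB := siD SV LAw0 LQ.
  have : dV (A m0 w0 + Q) (A m0 w0 + Q) = 0 by rewrite -(sqr_nrm SV LB) z0 expr0n.
  have EN : A m0 (- w0) = - A m0 w0.
    by rewrite -scaleN1r (linZ S _ (LA _ B0) Dw0) scaleN1r.
  move/(dotL2_eq0 mV LB); apply: ae_imp => x hx Vx.
  have := hx Vx; change (A m0 w0 x + Q x = 0 -> intop M sigma (dirker H q m0) u0 x =
    intop M sigma (H m0) (- w0) x).
  rewrite -(opAE M sigma (dirker H q m0) u0 Vx) -(opAE M sigma (H m0) (- w0) Vx) -/Q EN.
  by rewrite addrC => /eqP; rewrite addr_eq0 => /eqP.
(* the derivative kernel applied to u0 is the image of - w0, so u0 = v0 is null *)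
have [u00 _] := huniq2 q1 B0 Du0 (siN S Dw0) eq2.
apply: nv0.
apply: ae_imp (@filterI _ _ (ae_filter_ringOfSetsType sigma) _ _ u00 uv) => x [hx1 hx2] Mx.
by have [<- <-] := hx2 Mx; exact: hx1.
Qed.

End Sequences.

Local Notation rep := (orth_spectral nR M V sigma sigma').
Local Notation span s a := (\sum_(l <- s) a l : X).

Lemma orth_spectral_D k (b2 : K) s (a : K -> X) : rep k b2 s a -> D (span s a).
Proof. by move=> [_ sp _]; apply: (si_sum S) => l /sp[_ []]. Qed.

Lemma orth_spectral_scale k (b2 : K) s (a : K -> X) (t : K) : admissible V M k -> t != 0 ->
  rep k b2 s a -> rep k b2 s (fun l => t *: a l).
Proof.
move=> ak t0 [us sp pos]; have LA := opA_linear hM hV hs hs' hP ak.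
split; first exact: us.
  by move=> l ls; have [bl el] := sp l ls; split; [exact: bl|exact: (eigZ S SV t LA el)].
move=> l ls; have [_ [Dl _]] := sp l ls.
rewrite (siZl S t Dl (siZ S t Dl)) (siZr S t Dl Dl) mulrA -expr2.
by apply: mulr_gt0; [rewrite exprn_even_gt0|exact: pos].
Qed.

Lemma stability_spectral (beta : K) : 0 < beta -> exists2 C : K, 0 < C &
  forall m m' s a s' a', B m -> B m' -> rep (H m) (beta ^+ 2) s a ->
    rep (H m') (beta ^+ 2) s' a' ->
    C * nY (A m' (span s' a')) * enorm (m - m') <=
    nY (A m (span s a) - A m' (span s' a')).
Proof.
move=> be0; have b20 : 0 < beta ^+ 2 by rewrite exprn_gt0.
apply: contrapT => nC.
have admH := adm_H hM hV hreg1.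
have LA := fun m Bm => @A_linear _ _ _ _ _ _ _ hM hV _ _ hs hs' hP _ _ hreg1 m Bm.
(* failing constants 1/(j+1), normalized so that the second image has norm 1 *)
have /choice[z hz] (j : nat) : exists z : 'rV[K]_p * 'rV[K]_p *
    (seq K * (K -> X)) * (seq K * (K -> X)),
    [/\ B z.1.1.1, B z.1.1.2, rep (H z.1.1.1) (beta ^+ 2) z.1.2.1 z.1.2.2 &
        rep (H z.1.1.2) (beta ^+ 2) z.2.1 z.2.2] /\
    [/\ 0 < enorm (z.1.1.1 - z.1.1.2),
        nY (A z.1.1.2 (span z.2.1 z.2.2)) = 1 &
        nY (A z.1.1.1 (span z.1.2.1 z.1.2.2) - A z.1.1.2 (span z.2.1 z.2.2))
          <= enorm (z.1.1.1 - z.1.1.2) * j.+1%:R^-1].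
  apply: contrapT => nz; apply: nC; exists j.+1%:R^-1; first by rewrite invr_gt0.
  move=> m m' s a s' a' Bm Bm' os os'; rewrite leNgt; apply/negP => hlt.
  have Du := orth_spectral_D os; have Dv := orth_spectral_D os'.
  have Lu := (LA _ Bm).1 _ Du; have Lv := (LA _ Bm').1 _ Dv.
  pose N := nY (A m' (span s' a')).
  have j0 : 0 < j.+1%:R^-1 :> K by rewrite invr_gt0.
  have P0 := le_lt_trans (nrm_ge0 _ _) hlt.
  have N0 : 0 < N.
    rewrite lt_neqAle nrm_ge0 andbT eq_sym; apply/eqP => N0.
    by move: P0; rewrite -/N N0 mulr0 mul0r ltxx.
  have h0 : 0 < enorm (m - m').
    rewrite lt_neqAle enorm_ge0 andbT eq_sym; apply/eqP => h0.
    by move: P0; rewrite h0 mulr0 ltxx.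
  have Ni0 : N^-1 != 0 by rewrite invr_eq0 gt_eqF.
  apply: nz; exists (m, m', (s, fun l => N^-1 *: a l), (s', fun l => N^-1 *: a' l)).
  split; first by split; [exact: Bm|exact: Bm'
    |exact: (orth_spectral_scale (admH _ Bm) Ni0 os)
    |exact: (orth_spectral_scale (admH _ Bm') Ni0 os')].
  rewrite /= -!scaler_sumr (linZ S _ (LA _ Bm) Du) (linZ S _ (LA _ Bm') Dv).
  rewrite -scalerBr (nrmZ SV _ Lv) (nrmZ SV _ (siB SV Lu Lv)) gtr0_norm ?invr_gt0//.
  split; first exact: h0.
    by rewrite -/N mulVf// gt_eqF.
  rewrite mulrC ler_pdivrMr//; apply: ltW; apply: (lt_le_trans hlt).
  by rewrite -/N le_eqVlt; apply/orP; left; apply/eqP; ring.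
pose m j := (z j).1.1.1; pose m' j := (z j).1.1.2.
pose u j := span (z j).1.2.1 (z j).1.2.2; pose v j := span (z j).2.1 (z j).2.2.
have Bm j : B (m j) by have [[? _ _ _] _] := hz j.
have Bm' j : B (m' j) by have [[_ ? _ _] _] := hz j.
have ou j : rep (H (m j)) (beta ^+ 2) (z j).1.2.1 (z j).1.2.2 by have [[_ _ ? _] _] := hz j.
have ov j : rep (H (m' j)) (beta ^+ 2) (z j).2.1 (z j).2.2 by have [[_ _ _ ?] _] := hz j.
have h0 j : 0 < enorm (m j - m' j) by have [_ [? _ _]] := hz j.
have v1 j : nY (A (m' j) (v j)) = 1 by have [_ [_ ? _]] := hz j.
have hr j : nY (A (m j) (u j) - A (m' j) (v j)) <= enorm (m j - m' j) * j.+1%:R^-1.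
  by have [_ [_ _ ?]] := hz j.
have Du j : D (u j) by exact: orth_spectral_D (ou j).
have Dv j : D (v j) by exact: orth_spectral_D (ov j).
have [b b0 hb] := enorm_diff_bounded hB.
have lowu j : beta * nD (u j) <= nY (A (m j) (u j)).
  have [us sp _] := ou j; exact: (spectral_lower S SV (LA _ (Bm j)) (ltW be0) us sp).
have lowv j : beta * nD (v j) <= nY (A (m' j) (v j)).
  have [us sp _] := ov j; exact: (spectral_lower S SV (LA _ (Bm' j)) (ltW be0) us sp).
have uc j : nD (u j) <= (b + 1) / beta.
  rewrite ler_pdivlMr// mulrC; apply: le_trans (lowu j) _.
  have Lu := (LA _ (Bm j)).1 _ (Du j); have Lv := (LA _ (Bm' j)).1 _ (Dv j).
  apply: le_trans (nrm_le_sub SV Lu Lv) _; rewrite v1 lerD2r.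
  apply: le_trans (hr j) _; apply: le_trans (hb _ _ (Bm j) (Bm' j)).
  by rewrite ler_piMr ?enorm_ge0// invf_le1// ler1n.
have vc j : nD (v j) <= (b + 1) / beta.
  rewrite ler_pdivlMr// mulrC; apply: le_trans (lowv j) _.
  by rewrite v1 lerDr ltW.
have [C C0 hC] := eigen_close hM hV hs hs' hP hB hreg1 b20.
have hC' j L : 0 <= L ->
    (forall x y, V x -> M y -> `|H (m j) x y - H (m' j) x y| <= L) ->
    nD (u j - v j) <= C * (nY (A (m j) (u j) - A (m' j) (v j)) + L * nD (u j)).
  move=> L0 hL; exact: (hC _ _ _ _ _ _ _ (Bm j) (Bm' j) L0 hL (ou j) (ov j) _ _ erefl erefl).
have [F [FU oF]] := ultraFilterLemma (@eventually_filter).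
have r0 : (fun j : nat => (j.+1%:R^-1 : K)) @ F --> (0 : K).
  exact: cvg_trans (cvg_app _ oF) (@cvg_harmonic K).
exact: (sequences_absurd FU Bm Bm' Du Dv uc vc h0 v1 r0 hr C0 hC').
Qed.

End Contradiction.

Lemma nrm_sub_null (K : realType) (Y : lmodType K) (D : set Y) (f : Y -> Y -> K)
  (S : semi_inner D f) (x y x' y' : Y) : D x -> D y -> D x' -> D y' ->
  nrm f (x - x') = 0 -> nrm f (y - y') = 0 -> nrm f (x' - y') <= nrm f (x - y).
Proof.
move=> Dx Dy Dx' Dy' nx ny.
have -> : x' - y' = - (x - x') + ((x - y) + (y - y')).
  by rewrite opprB [X in _ = _ + X]addrA subrK [RHS]addrA subrK.
have Dxx := siB S Dx Dx'; have Dxy := siB S Dx Dy; have Dyy := siB S Dy Dy'.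
apply: le_trans (nrmD S (siN S Dxx) (siD S Dxy Dyy)) _.
rewrite (nrmN S Dxx) nx add0r; apply: le_trans (nrmD S Dxy Dyy) _.
by rewrite ny addr0.
Qed.

Theorem theorem4p1 (K : realType) (d p nR nV : nat)
    (R V : set 'rV[K]_d)
    (hR : compact_manifold nR R) (hV : compact_manifold nV V)
    (sigma sigma' : {measure set (borel K d) -> \bar K})
    (hsigma : surface_measure nR R sigma)
    (hsigma' : surface_measure nV V sigma')
    (hPoincare : poincare nR R sigma)
    (B B' : set 'rV[K]_p) (hB : compact B) (hB' : open B') (hBB' : B `<=` B')
    (H : 'rV[K]_p -> 'rV[K]_d -> 'rV[K]_d -> K)
    (hreg1 : regularity1 nV B V R H) (hreg2 : regularity2 nV B' V R H)
    (huniq1 : uniqueness1 nR B V R sigma sigma' H)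
    (huniq2 : uniqueness2 nR B V R sigma sigma' H)
    (beta : K) (hbeta : 0 < beta)
    (hnorm : forall m, B m ->
       ((beta ^+ 2)%:E < opnormH10 nR R sigma
          (normal_op nR R V sigma sigma' (intop R sigma (H m))))%E) :
  let E (m : 'rV[K]_p) : set (fungrad K d) :=
    eigenspan nR R sigma
      (normal_op nR R V sigma sigma' (intop R sigma (H m))) (beta ^+ 2) in
  exists C : K, 0 < C /\
    forall m m' u v, B m -> B m' -> E m u -> E m' v ->
      C * normL2 V sigma' (intop R sigma (H m') v) * enorm (m - m') <=
      normL2 V sigma'
        (fun x => intop R sigma (H m) u x - intop R sigma (H m') v x).
Proof.
move=> E.
have mV : measurable (V : set (borel K d)) := borel_compact hV.1.
have SV := L2_semi_inner sigma' mV; have S := H10_semi_inner hR hsigma.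
have admH := adm_H hR hV hreg1; have b20 : 0 < beta ^+ 2 by rewrite exprn_gt0.
have LA m (Bm : B m) := A_linear hR hV hsigma hsigma' hPoincare hreg1 Bm.
have [c c0 hc] := A_bounded hR hV hsigma hsigma' hPoincare hB hreg1.
have [C C0 hC] := stability_spectral hR hV hsigma hsigma' hPoincare hB hB' hBB'
  hreg1 hreg2 huniq1 huniq2 hbeta.
exists C; split; first exact: C0.
move=> m m' u v Bm Bm' Emu Emv.
have [s [a [os nu]]] := eigenspan_spectral hR hV hsigma hsigma' hPoincare (admH _ Bm) b20 Emu.
have [s' [a' [os' nv]]] :=
  eigenspan_spectral hR hV hsigma hsigma' hPoincare (admH _ Bm') b20 Emv.
have Du := Emu.1; have Dv := Emv.1.
have Ds := orth_spectral_D hR hsigma os; have Ds' := orth_spectral_D hR hsigma os'.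
have null n w w' : B n -> H10 nR R sigma w -> H10 nR R sigma w' ->
    nrm (dotH10 R sigma) (w - w') = 0 ->
    nrm (dotL2 V sigma') (opA R V sigma (H n) w - opA R V sigma (H n) w') = 0.
  move=> Bn Dw Dw' nw; rewrite -(linB (LA _ Bn) Dw Dw').
  apply/eqP; rewrite eq_le nrm_ge0 andbT.
  by apply: le_trans (hc _ Bn _ (siB S Dw Dw')) _; rewrite nw mulr0.
have Lu := (LA _ Bm).1 _ Du; have Ls := (LA _ Bm).1 _ Ds.
have Lv := (LA _ Bm').1 _ Dv; have Ls' := (LA _ Bm').1 _ Ds'.
have nAu := null _ _ _ Bm Du Ds nu; have nAv := null _ _ _ Bm' Dv Ds' nv.
rewrite normL2E normL2_diffE.
apply: le_trans (nrm_sub_null SV Lu Lv Ls Ls' nAu nAv).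
apply: le_trans (hC _ _ _ _ _ _ Bm Bm' os os').
rewrite ler_wpM2r ?enorm_ge0// ler_wpM2l ?(ltW C0)//.
by apply: le_trans (nrm_le_sub SV Lv Ls') _; rewrite nAv add0r.
Qed.
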